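(* Let $u_0:\mathbb{R}\to\mathbb{R}$ be absolutely continuous with $u_0'=w_0$ a.e. and $w_0\in L^2(\mathbb{R})$. Let $\tilde u$ be the (unique) dissipative solution of the Hunter–Saxton equation with initial datum $u_0$, and let $u$ be any weak solution with the same initial datum $u_0$. Then (1) $E^{\tilde u}(t)\le E^{u}(t)$ for every $t\ge 0$; (2) if $E^{u}(t)=E^{\tilde u}(t)$ for every $t\ge 0$, then $u=\tilde u$.
   Context: The Hunter–Saxton equation is $\partial_t u(x,t)+\partial_x\big[\tfrac12 u^2(x,t)\big]=\tfrac12\int_{-\infty}^x w^2(y,t)\,dy$, $w=\partial_x u$, for $x\in\mathbb{R}$, $t\ge 0$, with $u(x,0)=u_0(x)$, $w(x,0)=w_0(x)=u_0'(x)$. A weak solution is a continuous function $u$ on $\mathbb{R}\times[0,\infty)$ such that for each $t\ge0$, $u(\cdot,t)$ is absolutely continuous on $\mathbb{R}$ with $\partial_x u=w\in L^\infty([0,\infty);L^2(\mathbb{R}))$, the map $t\mapsto u(\cdot,t)\in L^2_{loc}(\mathbb{R})$ is absolutely continuous, the equation holds in the sense of distributions on $\mathbb{R}\times[0,\infty)$, $u(x,0)=u_0(x)$, and $w_0\in L^2(\mathbb{R})$. A weak solution is dissipative if $\partial_x u$ is bounded from above on every compact subset of the open upper half-plane $\{t>0\}$ and $w(\cdot,t)\to w_0$ in $L^2(\mathbb{R})$ as $t\downarrow 0$. (Dissipative solutions exist and are unique.) For a weak solution $u$, its energy is $E^u(t):=\frac12\int_{\mathbb{R}}w^2(y,t)\,dy$.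 *)

(* Defs.v *)
(* Hunter--Saxton equation: weak and dissipative
   solutions, energy.  Functions of two variables are curried as
   u : R -> R -> R, with u x t = u(x,t) (space first, time second). *)
From HB Require Import structures.
From mathcomp Require Import all_boot all_order all_algebra.
From mathcomp Require Import all_classical all_reals all_analysis.
Set Implicit Arguments.
Unset Strict Implicit.
Unset Printing Implicit Defensive.
Import Order.TTheory GRing.Theory Num.Theory.
Import numFieldNormedType.Exports.
Local Open Scope classical_set_scope.
Local Open Scope ring_scope.

Section HunterSaxton.
Context {R : realType}.
Local Notation mu := (@lebesgue_measure R).

(* Absolute continuity on [a,b] of a map t |-> X(t) with values in a
   (pseudo)metric-like space, given through the "distance" dist s t between
   X(s) and X(t): for every eps > 0 there is delta > 0 such that for every
   finite family of pairwise disjoint intervals (s_k, t_k) in [a,b] of total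
   length < delta, sum_k dist (s_k) (t_k) < eps. *)
Definition AC_on (a b : R) (dist : R -> R -> R) : Prop :=
  forall eps : R, 0 < eps -> exists2 delta : R, 0 < delta &
    forall (n : nat) (s t : nat -> R),
      (forall k, (k < n)%N -> a <= s k /\ s k <= t k /\ t k <= b) ->
      (forall i j, (i < n)%N -> (j < n)%N -> i <> j ->
          t i <= s j \/ t j <= s i) ->
      \sum_(k < n) (t k - s k) < delta ->
      \sum_(k < n) dist (s k) (t k) < eps.

Definition abs_cont_R (f : R -> R) : Prop :=
  forall a b : R, a <= b -> AC_on a b (fun s t => `|f t - f s|).

Definition AC_with_deriv (f g : R -> R) : Prop :=
  abs_cont_R f /\ {ae mu, forall x : R, is_derive x (1 : R) f (g x)}.

Definition L2 (g : R -> R) : Prop :=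
  measurable_fun setT g /\ (\int[mu]_x ((g x ^+ 2)%:E) < +oo)%E.

(* Energy E^u(t) = 1/2 \int w(y,t)^2 dy  (w = d_x u) *)
Definition energy (w : R -> R -> R) (t : R) : \bar R :=
  ((2^-1)%:E * \int[mu]_y ((w y t ^+ 2)%:E))%E.

Definition dx (f : R -> R -> R) : R -> R -> R :=
  fun x t => derive1 (fun y => f y t) x.
Definition dt (f : R -> R -> R) : R -> R -> R :=
  fun x t => derive1 (fun s => f x s) t.

Fixpoint pdiff (l : seq bool) (f : R -> R -> R) : R -> R -> R :=
  match l with
  | [::] => f
  | b :: l' => (if b then dx else dt) (pdiff l' f)
  end.

Definition test_fun (phi : R -> R -> R) : Prop :=
  (forall (l : seq bool) (x t : R),
      derivable (fun y => pdiff l phi y t) x (1 : R) /\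
      derivable (fun s => pdiff l phi x s) t (1 : R)) /\
  (forall l : seq bool, continuous (fun p : R * R => pdiff l phi p.1 p.2)) /\
  (exists r : R, forall x t, r < `|x| \/ r < `|t| -> phi x t = 0).

Definition HS_source (w : R -> R -> R) (x t : R) : R :=
  2^-1 * (\int[mu]_(y in `]-oo, x]) (w y t ^+ 2)).

Definition weak_solution (u0 : R -> R) (u w : R -> R -> R) : Prop :=
  [/\ {within [set p : R * R | 0 <= p.2], continuous (fun p => u p.1 p.2)},
      (forall t, 0 <= t -> AC_with_deriv (u ^~ t) (w ^~ t)),
      (* w in L^oo([0,oo); L^2(R)) *)
      (exists C : R, forall t, 0 <= t ->
          measurable_fun setT (w ^~ t) /\ (energy w t <= C%:E)%E),
      (* t |-> u(.,t) in L^2_loc(R) is absolutely continuous (on every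
         [0,T], with respect to every seminorm of L^2 on [-r,r]) *)
      (forall T r : R, 0 <= T ->
          AC_on 0 T (fun s t =>
            Num.sqrt (\int[mu]_(x in `[- r, r]) ((u x t - u x s) ^+ 2)))) &
      ((forall phi, test_fun phi ->
          \int[mu]_(t in `[0, +oo[)
             (\int[mu]_x (u x t * dt phi x t
                          + 2^-1 * u x t ^+ 2 * dx phi x t
                          + HS_source w x t * phi x t))
          + \int[mu]_x (u0 x * phi x 0) = 0) /\
      (forall x, u x 0 = u0 x))].

Definition dissipative_solution (u0 w0 : R -> R) (u w : R -> R -> R) : Prop :=
  [/\ weak_solution u0 u w,
      (forall K : set (R * R), compact K -> K `<=` [set p | 0 < p.2] ->
          exists M : R, forall t, {ae mu, forall x, K (x, t) -> w x t <= M}) &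
      ((fun t => (\int[mu]_x (((w x t - w0 x) ^+ 2)%:E))%E) @ 0^'+ --> 0%E)].

End HunterSaxton.

(* Main.v *)
(* Along a characteristic x' = u(x, t) of a weak solution the speed u changes at the rate
   1/2 \int_{-oo}^x w^2.  For two characteristics at distance h, with p = h' and e the integral of w^2
   between them, this gives p' = e / 2, while p^2 <= h e by Cauchy-Schwarz.  Hence sqrt h is convex, and
   p^2 / h varies at the rate (p / h) (e - p^2 / h), where e - p^2 / h is the variance of w between the two
   characteristics.  For a mesh of characteristics the variances sum to o(1) as the mesh gets finer.  A cell of
   initial slope omega > -2/T therefore keeps a positive width up to time T and then carries its
   initial energy up to o(1), so every weak solution satisfies
     \int w(T)^2 >= \int_{w0 > -2/T} w0^2,
   and likewise on the half-lines to the left and to the right of a characteristic.  For the dissipative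
   solution the one-sided bound p <= M h allows the argument to run backwards from T to tau > 0; letting
   tau tend to 0 gives the reverse inequality.  A weak solution with the least energy thus has equality on every
   half-line, so that u along its characteristics is an explicit function of the initial data; two such
   solutions have the same characteristics and agree. *)
Require Import Defs.
From HB Require Import structures.
From mathcomp Require Import all_boot all_order all_algebra.
From mathcomp Require Import all_classical all_reals all_analysis measurable_realfun.
From mathcomp Require Import ring lra.
Set Implicit Arguments.
Unset Strict Implicit.
Unset Printing Implicit Defensive.
Import Order.TTheory GRing.Theory Num.Theory.
Import numFieldNormedType.Exports.
Local Open Scope classical_set_scope.
Local Open Scope ring_scope.

(** As [w] is only square integrable in space, [u] is Hoelder continuous of exponent 1/2 there:
    characteristics exist by Peano's theorem but may merge, branch and cross. Maxima and minima of
    characteristics are again characteristics, so finite families can be ordered; uniqueness appears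
    only at the end, through the explicit speed. The law along a characteristic is extracted from
    the distributional equation with bumps that travel along it; the error is the energy inside the
    shrinking bump. The threshold -2/T is the slope at which the tangent line of sqrt h at time 0,
    sqrt(h(0)) (1 + omega t / 2), vanishes at t = T. Variances are controlled only for cells that
    stay narrow, hence meshes much finer than the width that counts as narrow. Slopes of cells
    approximate [w] only in the mean square, while the cut at -2/T is discontinuous, so the cut has
    to be loosened slightly. The lower bound recovers the exact threshold by left continuity in the
    cut, the upper bound by passing through slightly later times. *)

(** * Gluing local estimates, and real integrals over compact intervals *)

Section Calculus.
Context {R : realType}.
Local Notation mu := (@lebesgue_measure R).
Implicit Types (a b c M : R) (f g Z : R -> R).

(* Cousin's lemma. *)
Lemma itv_additive_ind (a b : R) (P : R -> R -> Prop) : a <= b ->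
  (forall s m t, a <= s -> s <= m -> m <= t -> t <= b -> P s m -> P m t -> P s t) ->
  (forall x, a <= x -> x <= b -> exists2 r, 0 < r & forall s t,
     a <= s -> t <= b -> s <= x -> x <= t -> x - r < s -> t < x + r -> P s t) ->
  P a b.
Proof.
move=> ab Padd Ploc.
pose S := [set x | a <= x <= b /\ P a x].
have Sa : S a.
  have [r r0 H] := Ploc a (lexx a) ab.
  by split; [rewrite lexx ab|apply: H => //; lra].
have supS : has_sup S by split; [exists a|exists b => x [/andP[]]].
have aS : a <= sup S by apply: ub_le_sup => //; case: supS.
have Sb : sup S <= b by apply: ge_sup; [exists a|move=> x [/andP[]]].
have [r r0 H] := Ploc (sup S) aS Sb.
have [x Sx xr] := sup_adherent r0 supS.
have xS : x <= sup S by apply: ub_le_sup => //; case: supS.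
case: Sx => /andP[ax xb] Px.
have key t : sup S <= t -> t <= b -> t < sup S + r -> S t.
  move=> St tb tr; split; first by rewrite (le_trans aS St) tb.
  by apply: (Padd _ x) => //; [exact: le_trans St|apply: H].
have : S (Num.min b (sup S + r / 2)).
  apply: key.
  - by rewrite le_min Sb lerDl; lra.
  - by rewrite ge_min lexx.
  - by rewrite gt_min [in X in _ || X]ltrD2l; apply/orP; right; lra.
have [br|br] := leP b (sup S + r / 2).
  by case.
move=> Ssr; have : sup S + r / 2 <= sup S by apply: ub_le_sup => //; case: supS.
lra.
Qed.

(** The estimate is additive over adjacent intervals, so Cousin's lemma makes it global with a total
    error of at most [e * (b - a)]. Neither function has to be differentiable, which suits time
    integrals of sources that are merely measurable in time. *)
Lemma le_of_small_increments (f g : R -> R) a b : a <= b ->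
  (forall e, 0 < e -> exists2 d, 0 < d & forall s t, a <= s -> s <= t -> t <= b ->
     t - s < d -> `|f t - f s| <= g t - g s + e * (t - s)) -> `|f b - f a| <= g b - g a.
Proof.
move=> ab H; apply/ler_addgt0Pr => e e0.
have k0 : 0 < b - a + 1 by rewrite ltr_wpDl// subr_ge0.
have e1 : 0 < e / (b - a + 1) by exact: divr_gt0.
have [d d0 Hd] := H _ e1.
apply: (@le_trans _ _ (g b - g a + (e / (b - a + 1)) * (b - a))); last first.
  rewrite lerD2l -mulrA ler_piMr ?(ltW e0)// mulrC ler_pdivrMr// mul1r; lra.
apply: (@itv_additive_ind a b (fun s t => `|f t - f s| <= g t - g s + (e / (b - a + 1)) * (t - s))) => //.
  move=> s m t _ _ _ _ H1 H2.
  have -> : f t - f s = (f t - f m) + (f m - f s) by ring.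
  by apply: le_trans (ler_normD _ _) _; move: H1 H2; set k := e / _ => H1 H2; lra.
move=> x ax xb; exists (d / 2); first by rewrite divr_gt0.
by move=> s t *; apply: Hd => //; lra.
Qed.

Lemma const_of_small_increments (Z : R -> R) a b : a <= b ->
  (forall e, 0 < e -> exists2 d, 0 < d & forall s t, a <= s -> s <= t -> t <= b ->
     t - s < d -> `|Z t - Z s| <= e * (t - s)) -> Z b = Z a.
Proof.
move=> ab H; apply/eqP; rewrite -subr_eq0 -normr_le0 -[leRHS](subrr 0).
apply: (@le_of_small_increments Z (fun=> 0) a b ab) => e /H[d d0 Hd].
by exists d => // s t *; rewrite subrr add0r; exact: Hd.
Qed.

Lemma integrable_bounded f a b M : measurable_fun `[a, b] f ->
  (forall x, a <= x <= b -> `|f x| <= M) -> mu.-integrable `[a, b] (EFin \o f).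
Proof.
move=> mf fM; apply: measurable_bounded_integrable => //.
  by rewrite /= lebesgue_measure_itv/=; case: ifP => // _; rewrite -EFinB ltry.
exists M; split; first exact: num_real.
by move=> M' MM' x /=; rewrite in_itv/= => /fM /le_trans -> //; exact: ltW.
Qed.

Lemma integrable_sub_itv f a b c d : mu.-integrable `[a, b] (EFin \o f) ->
  a <= c -> d <= b -> mu.-integrable `[c, d] (EFin \o f).
Proof.
move=> fi ac db; apply: integrableS fi => //; apply: subset_itv; by rewrite bnd_simp.
Qed.

Lemma Rintegral_split f a c b : a <= c -> c <= b -> mu.-integrable `[a, b] (EFin \o f) ->
  \int[mu]_(x in `[a, b]) f x = \int[mu]_(x in `[a, c]) f x + \int[mu]_(x in `[c, b]) f x.
Proof.
move=> ac cb fi; rewrite -(@Rintegral_itv_obnd_cbnd _ c).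
  by rewrite -(@Rintegral_itvB _ f (BLeft a) (BRight b))//; ring.
by apply: integrableS fi => //; apply: subset_itvr; rewrite bnd_simp.
Qed.

Lemma Rintegral_cst_itv a b M : a <= b -> \int[mu]_(x in `[a, b]) M = M * (b - a).
Proof.
move=> ab; rewrite Rintegral_cst//= lebesgue_measure_itv/= lte_fin.
case: ifPn => [_|]; first by rewrite -EFinB.
rewrite -leNgt => ba; have -> : b = a by lra.
by rewrite subrr /= !mulr0.
Qed.

Lemma Rintegral_point f a : \int[mu]_(x in `[a, a]) f x = 0.
Proof. by rewrite set_itv1 Rintegral_set1. Qed.

Lemma integrable_cst_itv a b M : mu.-integrable `[a, b] (EFin \o (fun=> M)).
Proof. by apply: (@integrable_bounded _ _ _ `|M|) => //; exact: measurable_cst. Qed.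

Lemma le_Rintegral_cst f a b M : a <= b -> mu.-integrable `[a, b] (EFin \o f) ->
  (forall x, a <= x <= b -> f x <= M) -> \int[mu]_(x in `[a, b]) f x <= M * (b - a).
Proof.
move=> ab fi fM; rewrite -Rintegral_cst_itv//; apply: le_Rintegral => //.
exact: integrable_cst_itv.
Qed.

Lemma normr_Rintegral_le f a b M : a <= b -> mu.-integrable `[a, b] (EFin \o f) ->
  (forall x, a <= x <= b -> `|f x| <= M) -> `|\int[mu]_(x in `[a, b]) f x| <= M * (b - a).
Proof.
move=> ab fi fM; apply: le_trans (le_normr_Rintegral _ fi) _ => //.
apply: le_Rintegral_cst => //; exact: integrable_norm.
Qed.

End Calculus.

(** * Pointwise derivatives and absolutely continuous functions *)

Section AbsolutelyContinuous.
Context {R : realType}.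
Local Notation mu := (@lebesgue_measure R).
Implicit Types (f g : R -> R).

(** Multiplied out, the condition is trivial at [y = x] and looks at [f] only near [x]; derivatives
    can then be passed between functions that agree there or that are glued from pieces. *)
Lemma is_derive_epsP f (x L : R) : is_derive x 1 f L <->
  forall e, 0 < e -> exists2 r, 0 < r & forall y, `|y - x| < r ->
    `|f y - f x - L * (y - x)| <= e * `|y - x|.
Proof.
have E h : h != 0 -> h^-1 *: (f (h *: 1 + x) - f x) - L = (f (x + h) - f x - L * h) / h.
  by move=> h0; rewrite /GRing.scale/= mulr1 (addrC h); field.
split=> [[fd fL] e e0|H].
  have : h^-1 *: (f (h *: 1 + x) - f x) @[h --> 0^'] --> L by rewrite -fL; exact: fd.
  move=> /cvgrPdist_le /(_ e e0); rewrite near_withinE => -[/= r r0 Hr].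
  exists r => // y yr.
  have [->|yx] := eqVneq y x; first by rewrite !subrr mulr0 subrr normr0 mulr0.
  have h0 : y - x != 0 by rewrite subr_eq0.
  have := Hr (y - x); rewrite /ball_/= sub0r normrN => /(_ yr h0).
  rewrite distrC E// subrKC normrM normfV ler_pdivrMr//.
  by rewrite normr_gt0.
have C : h^-1 *: (f (h *: 1 + x) - f x) @[h --> 0^'] --> L.
  apply/cvgrPdist_le => e e0; have [r r0 Hr] := H e e0.
  rewrite near_withinE; exists r => // h /=; rewrite sub0r normrN => hr h0.
  rewrite distrC E// normrM normfV ler_pdivrMr ?normr_gt0//.
  by have := Hr (x + h); rewrite addrAC subrr add0r => /(_ hr).
split; first by apply/cvg_ex; exists L; exact: C.
by apply/cvg_lim => //; exact: C.
Qed.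

(* Straddle lemma: the two points of the difference quotient need not include [x]. *)
Lemma is_derive_straddle f (x L e : R) : is_derive x 1 f L -> 0 < e ->
  exists2 r, 0 < r & forall s t, s <= x -> x <= t -> x - r < s -> t < x + r ->
    `|f t - f s - L * (t - s)| <= e * (t - s).
Proof.
move=> /is_derive_epsP fx e0; have [r r0 H] := fx e e0; exists r => // s t sx xt xs tx.
have -> : f t - f s - L * (t - s) = (f t - f x - L * (t - x)) - (f s - f x - L * (s - x)) by ring.
apply: le_trans (ler_normB _ _) _.
have Ht : `|t - x| = t - x by rewrite ger0_norm// subr_ge0.
have Hs : `|s - x| = x - s by rewrite ler0_norm ?opprB// subr_le0.
have := H t; have := H s; rewrite Ht Hs => /(_ _)H1 /(_ _)H2.
have {}H1 := H1 ltac:(lra); have {}H2 := H2 ltac:(lra); lra.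
Qed.

Lemma is_derive_unique f (x L L' : R) : is_derive x 1 f L -> is_derive x 1 f L' -> L = L'.
Proof. by move=> [_ <-] [_ <-]. Qed.

(** A Vitali-type argument with Cousin's lemma in the role of the covering theorem: around points of
    an open neighbourhood [U] of the exceptional null set the increment is charged to absolute
    continuity, around all other points to the vanishing derivative. *)
Lemma abs_cont_zero_derive f a b : a <= b -> AC_on a b (fun s t => `|f t - f s|) ->
  {ae mu, forall x : R, a <= x <= b -> is_derive x (1 : R) f 0} -> f b = f a.
Proof.
move=> ab fac [A [mA A0 fA]].
apply/eqP; rewrite -subr_eq0 -normr_le0; apply/ler_addgt0Pl => e0 e00; rewrite addr0.
(* The two kinds of intervals contribute at most [e * (b - a)] and [e], which add up to [e0]. *)
pose e := e0 / (b - a + 1).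
have e_gt0 : 0 < e by apply: divr_gt0 => //; lra.
have [d d0 Hd] := fac e e_gt0.
have [U [Uo AU UAd]] : exists U : set R, [/\ open U, A `<=` U & (mu U < d%:E)%E].
  have [|U [Uo AU UA]] := lebesgue_regularity_outer mA _ d0; first by move: (A0) => /= ->; rewrite ltry.
  exists U; split => //; rewrite -(setDUK AU) measureU//; last first.
  - by rewrite setDIK.
  - by apply: measurableD => //; exact: open_measurable.
  by move: A0 => /= ->; rewrite add0e.
have mU : measurable U by exact: open_measurable.
have Ufin s t : mu (U `&` `]s, t]) \is a fin_num.
  rewrite ge0_fin_numE ?measure_ge0//; apply: (@le_lt_trans _ _ (mu U)).
    by apply: le_measure; rewrite ?inE//; exact: measurableI.
  by apply: lt_trans UAd _; rewrite ltry.
pose good s t := fun p : R * R => (s <= p.1) && (p.1 <= p.2) && (p.2 <= t).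
(* The list collects the intervals charged to absolute continuity. Their total length is bounded by
   the measure of [U] in the half-open []s, t]], a quantity that is additive when intervals are
   joined. *)
pose P s t := exists l : seq (R * R), [/\ all (good s t) l,
  pairwise (fun p q : R * R => p.2 <= q.1) l,
  \sum_(p <- l) (p.2 - p.1) <= fine (mu (U `&` `]s, t])) &
  `|f t - f s| <= e * (t - s) + \sum_(p <- l) `|f p.2 - f p.1|].
have : P a b.
  apply: itv_additive_ind => //.
  - move=> s m t _ sm mt _ [l1 [g1 p1 s1 f1]] [l2 [g2 p2 s2 f2]].
    exists (l1 ++ l2); split.
    + rewrite all_cat; apply/andP; split.
        by apply: sub_all g1 => p /andP[/andP[h1 h2] h3]; rewrite /good h1 h2 (le_trans h3).
      by apply: sub_all g2 => p /andP[/andP[h1 h2] h3]; rewrite /good h3 h2 (le_trans sm).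
    + rewrite pairwise_cat p1 p2 !andbT; apply/allrelP => p q.
      move=> /(allP g1)/andP[_ h] /(allP g2)/andP[/andP[h' _] _]; exact: le_trans h h'.
    + rewrite big_cat/=; apply: le_trans (lerD s1 s2) _.
      rewrite -fineD// fine_le ?fin_numD ?Ufin// -measureU//=.
      * rewrite -setIUr; apply: le_measure; rewrite ?inE.
        - by apply: measurableI => //; exact: measurableU.
        - exact: measurableI.
        - by apply: setIS => x /=; rewrite !in_itv/= => -[] /andP[]; lra.
      * exact: measurableI.
      * exact: measurableI.
      * rewrite setIACA (_ : `]s, m]%classic `&` `]m, t]%classic = set0) ?setI0//.
        by apply/seteqP; split => x //=; rewrite !in_itv/= => -[] /andP[] ? ? /andP[]; lra.
    + rewrite big_cat/=.
      have -> : f t - f s = (f t - f m) + (f m - f s) by ring.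
      apply: le_trans (ler_normD _ _) _; move: f1 f2; lra.
  - move=> x ax xb; have [xA|xA] := pselect (U x).
      have [r/= r0 Hr] : nbhs x U by move: Uo; rewrite openE => /(_ _ xA).
      exists r => // s t as_ tb sx xt xs tx; exists [:: (s, t)]; split => //=.
      + by rewrite /good/= !lexx (le_trans sx xt).
      + rewrite big_seq1/= setIidr; last first.
          move=> y /=; rewrite in_itv/= => /andP[sy yt]; apply: Hr; rewrite /ball_/=.
          by rewrite ltr_norml; lra.
        rewrite lebesgue_measure_itv/= lte_fin; case: ifPn => //.
        by rewrite -leNgt subr_le0.
      + by rewrite big_seq1/= lerDr mulr_ge0 ?(ltW e_gt0)// subr_ge0 (le_trans sx xt).
    have fx : is_derive x 1 f 0.
      by apply: contrapT => nfx; apply: xA; apply: AU; apply: fA => /= H; apply: nfx; apply: H; rewrite ax xb.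
    have [r r0 Hr] := is_derive_straddle fx e_gt0.
    exists r => // s t as_ tb sx xt xs tx; exists [::]; split => //=.
    + by rewrite big_nil fine_ge0// measure_ge0.
    + rewrite big_nil addr0; have := Hr s t sx xt xs tx; by rewrite mul0r subr0.
case=> l [gl pl sl fl].
have SE (F : R * R -> R) : \sum_(k < size l) F (nth (0, 0) l k) = \sum_(p <- l) F p.
  by rewrite (big_nth (0, 0)) big_mkord.
have : \sum_(k < size l) `|f (nth (0, 0) l k).2 - f (nth (0, 0) l k).1| < e.
  apply: (Hd (size l) (fun k => (nth (0, 0) l k).1) (fun k => (nth (0, 0) l k).2)).
  - by move=> k kl; have /allP/(_ _ (mem_nth (0, 0) kl))/andP[/andP[-> ->] ->] := gl.
  - move=> i j il jl /eqP; rewrite neq_ltn => /orP[ij|ji].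
      by left; move/(pairwiseP (0, 0)) : pl; apply.
    by right; move/(pairwiseP (0, 0)) : pl; apply.
  - rewrite (SE (fun p => p.2 - p.1)).
    apply: le_lt_trans sl _; rewrite -lte_fin fineK//.
    by apply: le_lt_trans UAd; apply: le_measure; rewrite ?inE//; exact: measurableI.
rewrite (SE (fun p => `|f p.2 - f p.1|)) => Hl.
apply: (le_trans fl); apply: (@le_trans _ _ (e * (b - a + 1))); first by lra.
have h : b - a + 1 != 0 by apply: lt0r_neq0; clear -ab; lra.
by rewrite /e divfK.
Qed.

End AbsolutelyContinuous.

(** * Functions whose derivative is square integrable *)

Section SquareIntegrable.
Context {R : realType}.
Local Notation mu := (@lebesgue_measure R).
Implicit Types (f g h : R -> R) (a b : R).

Lemma EFin_Rintegral (D : set R) h : measurable D -> mu.-integrable D (EFin \o h) ->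
  (\int[mu]_(x in D) h x)%:E = (\int[mu]_(x in D) (h x)%:E)%E.
Proof. by move=> mD hi; rewrite /Rintegral fineK// integrable_fin_num. Qed.

Lemma integrable_add (D : set R) f g : measurable D -> mu.-integrable D (EFin \o f) ->
  mu.-integrable D (EFin \o g) -> mu.-integrable D (EFin \o (fun x => f x + g x)).
Proof. by move=> mD fi gi; exact: (integrableD _ fi gi). Qed.

Lemma integrable_sub (D : set R) f g : measurable D -> mu.-integrable D (EFin \o f) ->
  mu.-integrable D (EFin \o g) -> mu.-integrable D (EFin \o (fun x => f x - g x)).
Proof. by move=> mD fi gi; exact: (integrableB _ fi gi). Qed.

Lemma integrable_scale (D : set R) k f : measurable D -> mu.-integrable D (EFin \o f) ->
  mu.-integrable D (EFin \o (fun x => k * f x)).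
Proof. by move=> mD fi; exact: (integrableZl _ k fi). Qed.

Lemma integrable_measurable (D : set R) f : mu.-integrable D (EFin \o f) -> measurable_fun D f.
Proof. by case/integrableP => /measurable_EFinP. Qed.

Lemma integrable_mul_bounded (D : set R) f h M : measurable D -> mu.-integrable D (EFin \o f) ->
  measurable_fun D h -> (forall x, D x -> `|h x| <= M) ->
  mu.-integrable D (EFin \o (fun x => h x * f x)).
Proof.
move=> mD fi mh hM; apply: (@le_integrable _ _ _ mu _ _ _ (EFin \o (fun x => M * `|f x|))) => //.
- apply/measurable_EFinP; apply: measurable_funM => //; exact: integrable_measurable.
- move=> x Dx; rewrite /= lee_fin !normrM normr_id ler_wpM2r//.
  by apply: le_trans (hM x Dx) (ler_norm _).
- by apply: integrable_scale => //; exact: integrable_norm.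
Qed.

Lemma sum_Rintegral_disjoint h n (s t : nat -> R) : (forall x, 0 <= h x) ->
  mu.-integrable setT (EFin \o h) ->
  (forall i j, (i < n)%N -> (j < n)%N -> i <> j -> t i <= s j \/ t j <= s i) ->
  \sum_(k < n) \int[mu]_(x in `[s k, t k]) h x <= \int[mu]_x h x.
Proof.
move=> h0 hi disj.
have hD (D : set R) : measurable D -> mu.-integrable D (EFin \o h).
  by move=> mD; apply: integrableS hi.
rewrite -lee_fin EFin_Rintegral// -sumEFin.
(* Closed intervals may share end points; without the left ones they are disjoint. *)
under eq_bigr => k _ do rewrite -Rintegral_itv_obnd_cbnd ?hD// EFin_Rintegral ?hD//.
rewrite -(big_mkord predT (fun k => \int[mu]_(x in `]s k, t k]) (h x)%:E)%E) /=.
rewrite -(@ge0_integral_bigsetU _ _ _ mu _ (fun k => `]s k, t k]%classic) (EFin \o h)) ?iota_uniq//.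
- apply: ge0_subset_integral => //=.
  + by apply: bigsetU_measurable.
  + by case/integrableP : hi.
  + by move=> x _; rewrite lee_fin.
- apply/trivIsetP => i j /=; rewrite !mem_index_iota /= => i_n j_n /eqP ij.
  apply/seteqP; split => x //=; rewrite !in_itv/= => -[/andP[? ?] /andP[? ?]].
  by case: (disj i j i_n j_n ij); lra.
- by apply: measurable_funTS; case/integrableP : hi.
- by move=> x _; rewrite lee_fin.
Qed.

(** [C] bounds the whole integral of [g ^+ 2], that is, twice the energy. The integral is taken in
    the extended reals, so the bound includes integrability. *)
Definition finite_energy (C : R) f g := [/\ AC_with_deriv f g,
  measurable_fun setT g & (\int[mu]_x ((g x ^+ 2)%:E) <= C%:E)%E].

Variables (C : R) (f g : R -> R).
Hypothesis fg : finite_energy C f g.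

Lemma finite_energy_sqr_integrableT : mu.-integrable setT (EFin \o (fun x => g x ^+ 2)).
Proof.
case: fg => _ mg gC; apply/integrableP; split.
  by apply/measurable_EFinP; exact: measurable_funX.
apply: (@le_lt_trans _ _ C%:E); last by rewrite ltry.
apply: le_trans gC; apply: ge0_le_integral => //=.
- by do 2 apply: measurableT_comp => //; exact: measurable_funX.
- by apply/measurable_EFinP; exact: measurable_funX.
- by move=> x _; rewrite lee_fin ger0_norm// sqr_ge0.
Qed.

Lemma finite_energy_sqr_integrable D : measurable D ->
  mu.-integrable D (EFin \o (fun x => g x ^+ 2)).
Proof. by move=> mD; apply: integrableS finite_energy_sqr_integrableT. Qed.

Lemma finite_energy_integrable_fin D : measurable D -> (mu D < +oo)%E ->
  mu.-integrable D (EFin \o g).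
Proof.
move=> mD Dfin; case: (fg) => _ mg _.
apply: (@le_integrable _ _ _ mu _ _ _ (EFin \o (fun x => 1 + g x ^+ 2))) => //.
- by apply/measurable_EFinP; exact: measurable_funTS.
- move=> x _ /=; rewrite lee_fin.
  rewrite (ger0_norm (_ : 0 <= 1 + _)) ?addr_ge0 ?sqr_ge0//.
  by rewrite ler_norml; apply/andP; split; nra.
- apply: integrable_add => //; last exact: finite_energy_sqr_integrable.
  apply: measurable_bounded_integrable => //.
  by exists 1; split => // M M1 x _ /=; rewrite normr1 ltW.
Qed.

Lemma lebesgue_measure_itv_lty a b : (mu `[a, b] < +oo)%E.
Proof. by rewrite /= lebesgue_measure_itv/=; case: ifP => // _; rewrite -EFinB ltry. Qed.

Lemma finite_energy_integrable a b : mu.-integrable `[a, b] (EFin \o g).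
Proof. by apply: finite_energy_integrable_fin => //; exact: lebesgue_measure_itv_lty. Qed.

Lemma finite_energy_Rintegral_le D : measurable D -> \int[mu]_(x in D) g x ^+ 2 <= C.
Proof.
move=> mD; rewrite -lee_fin EFin_Rintegral//; last exact: finite_energy_sqr_integrable.
case: fg => _ mg gC; apply: le_trans gC; apply: ge0_subset_integral => //.
- by apply/measurable_EFinP; exact: measurable_funX.
- by move=> x _; rewrite lee_fin sqr_ge0.
Qed.

Lemma sqr_Rintegral_ge0 (D : set R) h : 0 <= \int[mu]_(x in D) h x ^+ 2.
Proof. by apply: Rintegral_ge0 => x _; exact: sqr_ge0. Qed.

Lemma finite_energy_ge0 : 0 <= C.
Proof. exact: le_trans (sqr_Rintegral_ge0 setT g) (finite_energy_Rintegral_le measurableT). Qed.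

(** Integrates [|g| <= K + K^-1 * g ^+ 2]. Unlike Cauchy-Schwarz this is linear in the length and in
    the energy, so it can be summed over disjoint intervals, with [K] left to the user. *)
Lemma normr_Rintegral_le_sqr a b K : a <= b -> 0 < K ->
  `|\int[mu]_(x in `[a, b]) g x| <= K * (b - a) + K^-1 * \int[mu]_(x in `[a, b]) g x ^+ 2.
Proof.
move=> ab K0; apply: le_trans (le_normr_Rintegral _ (finite_energy_integrable a b)) _ => //.
have i2 := finite_energy_sqr_integrable (measurable_itv `[a, b]).
rewrite -Rintegral_cst_itv// -RintegralZl// -RintegralD//.
- apply: le_Rintegral => //.
  + exact: integrable_norm (finite_energy_integrable a b).
  + by apply: integrable_add => //; [exact: integrable_cst_itv|exact: integrable_scale].
  + move=> x _; have E : K^-1 * g x ^+ 2 = (K^-1 * `|g x|) ^+ 2 * K.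
      by rewrite -(real_normK (num_real (g x))); field; rewrite gt_eqF.
    rewrite E; set y := K^-1 * `|g x|; have -> : `|g x| = y * K.
      by rewrite /y mulrAC mulVf ?mul1r// gt_eqF.
    have : 0 <= (y - 1 / 2) ^+ 2 by exact: sqr_ge0.
    nra.
- exact: integrable_cst_itv.
- exact: integrable_scale.
Qed.

(** [f] minus a primitive of [g] is absolutely continuous, and by Lebesgue's differentiation theorem
    its derivative vanishes almost everywhere. *)
Lemma finite_energy_FTC a b : a <= b -> \int[mu]_(x in `[a, b]) g x = f b - f a.
Proof.
move=> ab; case: (fg) => -[fac fd] mg gC.
(* Starting at [a - 1] puts all of [[a, b]] strictly to the right of the base point. *)
pose F x := \int[mu]_(y in `[a - 1, x]) g y.
have FE s t : a <= s -> s <= t -> F t - F s = \int[mu]_(y in `[s, t]) g y.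
  move=> as_ st; rewrite /F (@Rintegral_split _ _ _ s t)//; first by ring.
    by lra.
  exact: finite_energy_integrable.
suff : f b - F b = f a - F a.
  by move=> H; rewrite -FE//; lra.
apply: (@abs_cont_zero_derive _ (fun x => f x - F x)) => //.
- move=> e e0; have e2 : 0 < e / 2 by lra.
  have [d1 d10 H1] := fac a b ab _ e2.
  have C0 := finite_energy_ge0.
  (* With this [K] the energy term [K^-1 * C] is below [e / 4]; lengths below [e / (4 * K)] make the
     other term at most [e / 4], and [f] itself uses [e / 2]. *)
  have [K K0 KE] : exists2 K, 0 < K & K = (4 * (C + 1)) / e.
    by exists ((4 * (C + 1)) / e) => //; apply: divr_gt0 => //; lra.
  exists (Num.min d1 (e / (4 * K))).
    by rewrite lt_min d10 divr_gt0// mulr_gt0.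
  move=> n s t st disj; rewrite lt_min => /andP[sd1 sd2].
  have {H1} := H1 n s t st disj sd1 => H1.
  have H2 : \sum_(k < n) `|F (t k) - F (s k)| <= K * (\sum_(k < n) (t k - s k)) + K^-1 * C.
    apply: (@le_trans _ _ (\sum_(k < n) (K * (t k - s k) + K^-1 * \int[mu]_(x in `[s k, t k]) g x ^+ 2))).
      apply: ler_sum => k _; have [h1 [h2 h3]] := st k (ltn_ord k).
      by rewrite FE//; exact: normr_Rintegral_le_sqr.
    rewrite big_split/= -!mulr_sumr lerD2l ler_pM2l ?invr_gt0//.
    apply: le_trans (finite_energy_Rintegral_le measurableT).
    apply: sum_Rintegral_disjoint => //; [by move=> x; exact: sqr_ge0|exact: finite_energy_sqr_integrableT].
  apply: (@le_lt_trans _ _ (\sum_(k < n) (`|f (t k) - f (s k)| + `|F (t k) - F (s k)|))).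
    apply: ler_sum => k _; apply: le_trans (ler_normB _ _); rewrite le_eqVlt; apply/orP; left.
    by apply/eqP; congr (`|_|); ring.
  rewrite big_split/=.
  have H3 : K * (\sum_(k < n) (t k - s k)) <= e / 4.
    by move: sd2; rewrite ltr_pdivlMr ?mulr_gt0//; set S := \sum_(_ < _) _; nra.
  have H4 : K^-1 * C < e / 4 + 0.
    rewrite KE invf_div addr0 mulrAC ltr_pdivrMr; last by lra.
    nra.
  lra.
- have := @FTC1 R g (BLeft (a - 1)) (fun y => finite_energy_integrable (a - 1) y).
  have lg : locally_integrable setT g.
    split => //; first exact: openT.
    move=> K _ cK.
    have mK : measurable K by exact: compact_measurable.
    by have /integrableP[] := finite_energy_integrable_fin mK (compact_finite_measure cK).
  move=> /(_ lg) /= Fd.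
  apply: (@filterS2 _ _ (ae_filter_ringOfSetsType mu) _ _ _ _ Fd fd) => x Fx fx /andP[ax xb].
  have [|F1 F2] := Fx; first by rewrite lte_fin; lra.
  have Fx' : is_derive x 1 F (g x) := DeriveDef F1 (etrans (esym (derive1E _ _)) F2).
  by have := is_deriveB fx Fx'; rewrite subrr.
Qed.

End SquareIntegrable.

(** * Variance of the derivative on a cell and its decay under refinement *)

Section Averaging.
Context {R : realType}.
Local Notation mu := (@lebesgue_measure R).
Implicit Types (f g h : R -> R) (a b : R).

Lemma integrable_le (D : set R) f h : measurable D -> measurable_fun D f ->
  mu.-integrable D (EFin \o h) -> (forall x, D x -> `|f x| <= h x) ->
  mu.-integrable D (EFin \o f).
Proof.
move=> mD mf hi fh; apply: le_integrable hi => //.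
  by apply/measurable_EFinP; exact: mf.
by move=> x Dx /=; rewrite lee_fin; apply: le_trans (fh x Dx) (ler_norm _).
Qed.

Lemma Rintegral_dominated (D : set R) (F : nat -> R -> R) f h : measurable D ->
  (forall n, measurable_fun D (F n)) -> measurable_fun D f ->
  mu.-integrable D (EFin \o h) ->
  {ae mu, forall x, D x -> F n x @[n --> \oo] --> f x} ->
  (forall n x, D x -> `|F n x| <= h x) ->
  \int[mu]_(x in D) F n x @[n --> \oo] --> \int[mu]_(x in D) f x.
Proof.
move=> mD mF mf hi Ff Fh.
have [fi _ cv] : [/\ mu.-integrable D (EFin \o f),
    [sequence \int[mu]_(x in D) `|(F n x)%:E - (f x)%:E|]_n @ \oo --> 0%E &
    [sequence \int[mu]_(x in D) (F n x)%:E]_n @ \oo --> (\int[mu]_(x in D) (f x)%:E)]%E.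
  apply: (@dominated_convergence _ _ _ mu D _ (fun n => EFin \o F n) (EFin \o f) (EFin \o h)) => //.
  - by move=> n; apply/measurable_EFinP; exact: mF.
  - by apply/measurable_EFinP; exact: mf.
  - apply: (@filterS _ _ (ae_filter_ringOfSetsType mu) _ _ _ Ff) => x Hx Dx.
    by apply: cvg_EFin; [exact: nearW|exact: Hx].
  - by apply: aeW => x n Dx /=; rewrite lee_fin; exact: Fh.
have Fi n : mu.-integrable D (EFin \o F n).
  by apply: integrable_le hi _ => // x Dx; exact: Fh.
move: cv; rewrite -(EFin_Rintegral mD fi) => /fine_cvgP[_]; apply: cvg_trans.
by apply: near_eq_cvg; near=> n.
Unshelve. all: by end_near. Qed.

Lemma Rintegral_sum (D : set R) (I : Type) (r : seq I) (P : pred I) (F : I -> R -> R) :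
  measurable D -> (forall i, mu.-integrable D (EFin \o F i)) ->
  mu.-integrable D (EFin \o (fun x => \sum_(i <- r | P i) F i x)) /\
  \int[mu]_(x in D) (\sum_(i <- r | P i) F i x) = \sum_(i <- r | P i) \int[mu]_(x in D) F i x.
Proof.
move=> mD Fi; elim: r => [|i r [IH1 IH2]].
  rewrite big_nil; under eq_Rintegral do rewrite big_nil; rewrite Rintegral_cst// mul0r; split=> //.
  rewrite (_ : _ \o _ = cst 0%E); first exact: integrable0.
  by apply/funext => x /=; rewrite big_nil.
have E : (fun x => \sum_(i <- i :: r | P i) F i x) =
    fun x => (if P i then F i x else 0) + \sum_(i <- r | P i) F i x.
  by apply/funext => x; rewrite big_cons; case: (P i); rewrite ?add0r.
rewrite E big_cons; case: (P i).
  by split; [exact: integrable_add|rewrite RintegralD// IH2].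
rewrite (_ : (fun x => 0 + _) = fun x => \sum_(i <- r | P i) F i x)//.
by apply/funext => x; rewrite add0r.
Qed.

Definition sqint g a b := \int[mu]_(x in `[a, b]) g x ^+ 2.

Section AveragingOneFunction.
Variables (C : R) (f g : R -> R).
Hypothesis fg : finite_energy C f g.

Lemma sqint_ge0 a b : 0 <= sqint g a b. Proof. exact: sqr_Rintegral_ge0. Qed.

Lemma sqint_le a b : sqint g a b <= C.
Proof. by apply: (finite_energy_Rintegral_le fg). Qed.

Lemma sqint_split a b c : a <= b -> b <= c -> sqint g a c = sqint g a b + sqint g b c.
Proof.
move=> ab bc; apply: Rintegral_split => //; exact: (finite_energy_sqr_integrable fg).
Qed.

Lemma sqint_variance a b k : a <= b ->
  \int[mu]_(x in `[a, b]) (g x - k) ^+ 2 = sqint g a b - 2 * k * (f b - f a) + k ^+ 2 * (b - a).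
Proof.
move=> ab; rewrite -(finite_energy_FTC fg ab) -Rintegral_cst_itv//.
have i1 := finite_energy_integrable fg a b.
have i2 := finite_energy_sqr_integrable fg (measurable_itv `[a, b]).
rewrite -RintegralZl// /sqint -RintegralB//; last exact: integrable_scale.
rewrite -RintegralD//.
- by apply: eq_Rintegral => x _; ring.
- by apply: integrable_sub => //; exact: integrable_scale.
- exact: integrable_cst_itv.
Qed.

(** The mean of [g] on [[a, b]] is the slope of [f], so this is the variance of [g] times the length
    of the interval. *)
Lemma sqint_avg a b : a < b ->
  \int[mu]_(x in `[a, b]) (g x - (f b - f a) / (b - a)) ^+ 2 =
  sqint g a b - (f b - f a) ^+ 2 / (b - a).
Proof. by move=> ab; rewrite sqint_variance 1?ltW//; field; rewrite subr_eq0 gt_eqF. Qed.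

(** The Cauchy-Schwarz inequality, read off from the variance being nonnegative. *)
Lemma sqr_incr_le_sqint a b : a <= b -> (f b - f a) ^+ 2 <= (b - a) * sqint g a b.
Proof.
rewrite le_eqVlt => /predU1P[->|ab]; first by rewrite !subrr expr0n mul0r.
have := sqr_Rintegral_ge0 `[a, b] (fun x => g x - (f b - f a) / (b - a)).
rewrite sqint_avg// subr_ge0 ler_pdivrMr; last by rewrite subr_gt0.
by rewrite mulrC.
Qed.

Lemma incr_quot_le_sqint a b : a <= b -> (f b - f a) ^+ 2 / (b - a) <= sqint g a b.
Proof.
move=> ab; have := sqr_incr_le_sqint ab; move: ab; rewrite le_eqVlt => /predU1P[->|ab].
  by rewrite !subrr expr0n /= !mul0r => _; exact: sqint_ge0.
by rewrite ler_pdivrMr ?subr_gt0// mulrC.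
Qed.

Lemma sqr_near (y z r : R) : 0 < r -> `|z - y| <= r -> `|z ^+ 2 - y ^+ 2| <= r * (2 * `|y| + r).
Proof.
move=> r0 zy; have -> : z ^+ 2 - y ^+ 2 = (z - y) * (2 * y + (z - y)) by ring.
rewrite normrM ler_pM//; apply: le_trans (ler_normD _ _) _; rewrite lerD//.
by rewrite normrM ger0_norm.
Qed.

(* The step function equal to the squared average slope on the good cells and to [g ^+ 2]
   elsewhere tends to [g ^+ 2] a.e.; cutting it off at [g ^+ 2] gives a dominated sequence whose
   integrals are at most the integral of [g ^+ 2] minus the total variance. *)
Lemma variance_cvg (N : nat -> nat) (x : nat -> nat -> R) (G : nat -> pred nat) (eps : nat -> R) :
  (forall n k, (k < N n)%N -> x n k <= x n k.+1) ->
  (forall n k, (k < N n)%N -> G n k -> x n k.+1 - x n k <= eps n) ->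
  eps @ \oo --> 0 ->
  \sum_(k < N n | G n k) (sqint g (x n k) (x n k.+1) -
     (f (x n k.+1) - f (x n k)) ^+ 2 / (x n k.+1 - x n k)) @[n --> \oo] --> 0.
Proof.
move=> xmono xeps eps0.
pose q n k := ((f (x n k.+1) - f (x n k)) / (x n k.+1 - x n k)) ^+ 2.
(* Half-open cells: a point lies in at most one of them, and degenerate cells are empty. *)
pose J n k := `[x n k, x n k.+1[%classic.
have mJ n k : measurable (J n k) by exact: measurable_itv.
pose S n y := g y ^+ 2 + \sum_(k < N n | G n k) (q n k - g y ^+ 2) * \1_(J n k) y.
have xle n i j : (i <= j)%N -> (j <= N n)%N -> x n i <= x n j.
  elim: j => [|j IH]; first by rewrite leqn0 => /eqP ->.
  rewrite leq_eqVlt => /predU1P[->//|ij] jN.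
  by apply: le_trans (IH _ _) (xmono _ _ _) => //; exact: ltnW.
have Scase n y : S n y = g y ^+ 2 \/
    exists k, [/\ (k < N n)%N, G n k, J n k y & S n y = q n k].
  have [[k [Gk Jk]]|noJ] := pselect (exists k : 'I_(N n), G n k /\ J n k y).
    right; exists k; split => //; rewrite /S (bigD1 k)//= big1 ?addr0.
      by rewrite indicE mem_set// mulr1 subrKC.
    move=> i /andP[Gi ik]; rewrite indicE memNset ?mulr0// => Ji.
    move: Ji Jk; rewrite /J /= !in_itv/= => /andP[h1 h2] /andP[h3 h4].
    have : (i < k)%N || (k < i)%N by rewrite -neq_ltn.
    case/orP => ik'.
      by have := xle n i.+1 k ik' (ltnW (ltn_ord k)); lra.
    by have := xle n k.+1 i ik' (ltnW (ltn_ord i)); lra.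
  left; rewrite /S big1 ?addr0// => k Gk; rewrite indicE memNset ?mulr0// => Jk.
  by apply: noJ; exists k.
have S0 n y : 0 <= S n y.
  by case: (Scase n y) => [->|[k [_ _ _ ->]]]; exact: sqr_ge0.
case: (fg) => -[_ fd] mg _.
have i2 := finite_energy_sqr_integrableT fg.
have iJ n k : mu.-integrable setT (EFin \o (fun y => (q n k - g y ^+ 2) * \1_(J n k) y)).
  have E : (fun y => (q n k - g y ^+ 2) * \1_(J n k) y) =
      fun y => q n k * \1_(J n k) y - \1_(J n k) y * g y ^+ 2.
    by apply/funext => y; ring.
  rewrite E; apply: integrable_sub => //.
    by apply: integrable_scale => //; exact: integrable_indic_itv.
  apply: (@integrable_mul_bounded _ _ _ _ 1) => //.
  by move=> y _; rewrite indicE; case: (_ \in _); rewrite ?normr1 ?normr0.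
have iS n : mu.-integrable setT (EFin \o S n).
  apply: integrable_add => //.
  by have [] := @Rintegral_sum setT _ (index_enum 'I_(N n)) (fun k => G n k)
    (fun k y => (q n k - g y ^+ 2) * \1_(J n k) y) measurableT (fun k => iJ n k).
pose V n := \sum_(k < N n | G n k) (sqint g (x n k) (x n k.+1) -
     (f (x n k.+1) - f (x n k)) ^+ 2 / (x n k.+1 - x n k)).
have intJ n k : (k < N n)%N -> \int[mu]_y ((q n k - g y ^+ 2) * \1_(J n k) y) =
    - (sqint g (x n k) (x n k.+1) - (f (x n k.+1) - f (x n k)) ^+ 2 / (x n k.+1 - x n k)).
  move=> kN; have xk := xmono n k kN.
  have ig : mu.-integrable (J n k) (EFin \o (fun y => q n k - g y ^+ 2)).
    apply: integrable_sub; [exact: mJ| |by apply: (finite_energy_sqr_integrable fg); exact: mJ].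
    apply: integrableS (integrable_cst_itv (x n k) (x n k.+1) (q n k)); [by []|exact: mJ|].
    by apply: subset_itvl; rewrite bnd_simp.
  transitivity (\int[mu]_(y in J n k) (q n k - g y ^+ 2)).
    rewrite [RHS]Rintegral_mkcond; apply: eq_Rintegral => y _.
    by rewrite patchE indicE; case: (_ \in _); rewrite ?mulr1 ?mulr0.
  rewrite /J Rintegral_itv_bndo_bndc// RintegralB//; last 2 first.
  - exact: integrable_cst_itv.
  - exact: (finite_energy_sqr_integrable fg).
  rewrite Rintegral_cst_itv// /sqint opprB; congr (_ - _).
  rewrite /q expr_div_n; move: xk; rewrite le_eqVlt => /predU1P[->|xk].
    by rewrite !subrr expr0n /= !mul0r.
  by field; rewrite subr_eq0 gt_eqF.
have intS n : \int[mu]_y S n y = \int[mu]_y g y ^+ 2 - V n.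
  rewrite RintegralD//; last first.
    by have [] := @Rintegral_sum setT _ (index_enum 'I_(N n)) (fun k => G n k)
      (fun k y => (q n k - g y ^+ 2) * \1_(J n k) y) measurableT (fun k => iJ n k).
  congr (_ + _).
  have [_ ->] := @Rintegral_sum setT _ (index_enum 'I_(N n)) (fun k => G n k)
      (fun k y => (q n k - g y ^+ 2) * \1_(J n k) y) measurableT (fun k => iJ n k).
  by rewrite /V -sumrN; apply: eq_bigr => k Gk; rewrite intJ.
pose m n y := Num.min (S n y) (g y ^+ 2).
have mS n : measurable_fun setT (S n) by exact: integrable_measurable (iS n).
have mg2 : measurable_fun setT (fun y => g y ^+ 2) by exact: measurable_funX.
have mm n : measurable_fun setT (m n) by exact: measurable_minr.
have m0 n y : 0 <= m n y by rewrite le_min S0 sqr_ge0.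
have mle n y : `|m n y| <= g y ^+ 2 by rewrite ger0_norm// ge_min lexx orbT.
have cv : \int[mu]_y m n y @[n --> \oo] --> \int[mu]_y g y ^+ 2.
  apply: (Rintegral_dominated _ mm mg2 i2) => //.
  apply: (@filterS _ _ (ae_filter_ringOfSetsType mu) _ _ _ fd) => y fy _.
  apply/cvgrPdist_le => e e0.
  have [r r0 re] : exists2 r, 0 < r & r * (2 * `|g y| + r) <= e.
    have k0 : 0 < 2 * `|g y| + 1 by rewrite ltr_wpDl// mulr_ge0.
    pose r := Num.min 1 (e / (2 * `|g y| + 1)).
    have r0 : 0 < r by rewrite lt_min ltr01 divr_gt0.
    exists r => //; have r1 : r <= 1 by rewrite ge_min lexx.
    have r2 : r * (2 * `|g y| + 1) <= e by rewrite -ler_pdivlMr// ge_min lexx orbT.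
    by apply: le_trans r2; rewrite ler_wpM2l ?lerD2l// ltW.
  (* The good cell around [y] is shorter than [d] but need not have [y] as an end point. *)
  have [d d0 Hd] := is_derive_straddle fy r0.
  have : \forall n \near \oo, `|eps n| < d.
    by move/cvgrPdist_lt : eps0 => /(_ d d0); apply: filterS => n; rewrite sub0r normrN.
  apply: filterS => n epsd.
  have : `|S n y - g y ^+ 2| <= e.
    case: (Scase n y) => [->|[k [kN Gk Jk ->]]]; first by rewrite subrr normr0 ltW.
    apply: le_trans re; apply: sqr_near => //.
    move: Jk; rewrite /J /= in_itv/= => /andP[h1 h2].
    have xk := xeps n k kN Gk; have := ler_norm (eps n) => epsn.
    have /(_ _ _ _ _) := Hd (x n k) (x n k.+1).
    move=> /(_ h1 (ltW h2)) H; have {}H := H ltac:(lra) ltac:(lra).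
    have xx : 0 < x n k.+1 - x n k by lra.
    rewrite -(ler_pM2r xx) -[X in _ * X <= _](gtr0_norm xx) -normrM mulrBl divfK// gt_eqF//.
  rewrite /m distrC; case: (leP (S n y) (g y ^+ 2)) => // _ _.
  by rewrite subrr normr0 ltW.
have V0 n : 0 <= V n.
  by apply: sumr_ge0 => k Gk; rewrite subr_ge0; apply: incr_quot_le_sqint; exact: xmono.
have VA n : V n <= \int[mu]_y g y ^+ 2 - \int[mu]_y m n y.
  rewrite lerBrDr -lerBrDl -intS; apply: le_Rintegral => //.
    by apply: integrable_le i2 _ => // y _; exact: mle.
  by move=> y _; rewrite ge_min lexx.
apply: (@squeeze_cvgr _ _ _ _ (fun=> 0) (fun n => \int[mu]_y g y ^+ 2 - \int[mu]_y m n y)).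
- by apply: nearW => n; rewrite V0 VA.
- exact: cvg_cst.
- rewrite -(subrr (\int[mu]_y g y ^+ 2)); apply: cvgB => //; exact: cvg_cst.
Qed.

End AveragingOneFunction.
End Averaging.

(** * Peano's theorem *)

Section Peano.
Context {R : realType}.
Implicit Types (f : R -> R -> R) (x y t s a b c d e r : R).

(** Compactness of the rectangle, with [f] continuous on the whole plane: only [(x, t)] has to lie
    in the rectangle, the nearby point [(y, s)] may leave it. *)
Lemma unif_cont_rectangle f a b c d : continuous (fun p : R * R => f p.1 p.2) ->
  forall e, 0 < e -> exists2 r, 0 < r & forall x t y s, a <= x <= b -> c <= t <= d ->
    `|x - y| < r -> `|t - s| < r -> `|f x t - f y s| <= e.
Proof.
move=> fc e e0.
have cK : compact (`[a, b]%classic `*` `[c, d]%classic).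
  by apply: compact_setX; exact: segment_compact.
pose P (r : R) (p : R * R) := forall q : R * R, `|p.1 - q.1| < r -> `|p.2 - q.2| < r ->
  `|f p.1 p.2 - f q.1 q.2| <= e.
have : \forall r \near 0^'+, (`[a, b]%classic `*` `[c, d]%classic) `<=` P r.
  apply: (iffLR (compact_near_coveringP _) cK) => p _.
  have e2 : 0 < e / 2 by lra.
  have /cvgrPdist_le/(_ _ e2)[/= B [[r1 /= r10 H1] [r2 /= r20 H2] HB]] := fc p.
  have [r r0 [rr1 rr2]] : exists2 r, 0 < r & r <= r1 /\ r <= r2.
    by exists (Num.min r1 r2); [rewrite lt_min r10 r20|rewrite !ge_min !lexx orbT].
  have Hr q : `|p.1 - q.1| < r -> `|p.2 - q.2| < r -> `|f p.1 p.2 - f q.1 q.2| <= e / 2.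
    by move=> h1 h2; apply: HB; split; [apply: H1|apply: H2]; rewrite /ball_/=; lra.
  have r20' : 0 < r / 2 by lra.
  exists (ball p (r / 2), [set s | s < r / 2]).
    split => /=; first exact: nbhsx_ballx.
    exact: nbhs_right_lt.
  move=> [q s]/= [[b1 b2] sr] q' h1 h2.
  have q1 : `|p.1 - q.1| < r / 2 by exact: b1.
  have q2 : `|p.2 - q.2| < r / 2 by exact: b2.
  have h3 := Hr q; have h4 := Hr q'.
  have -> : f q.1 q.2 - f q'.1 q'.2 = (f p.1 p.2 - f q'.1 q'.2) - (f p.1 p.2 - f q.1 q.2) by ring.
  apply: le_trans (ler_normB _ _) _.
  have H1' : `|p.1 - q'.1| < r.
    by have := ler_normD (p.1 - q.1) (q.1 - q'.1); rewrite addrA subrK; lra.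
  have H2' : `|p.2 - q'.2| < r.
    by have := ler_normD (p.2 - q.2) (q.2 - q'.2); rewrite addrA subrK; lra.
  have {}h4 := h4 H1' H2'.
  have {}h3 : `|f p.1 p.2 - f q.1 q.2| <= e / 2.
    by apply: h3; lra.
  lra.
rewrite near_withinE => -[r /= r0 Hr]; exists (r / 2); first by lra.
move=> x t y s ax ct xy ts.
apply: (Hr (r / 2) _ _ (x, t) _ (y, s)) => //=.
- by rewrite sub0r normrN gtr0_norm; lra.
- by lra.
Qed.

Lemma cvg_to_ge0 (T : Type) (F : set_system T) (FF : ProperFilter F) (h : T -> R) (l : R) :
  h n @[n --> F] --> l -> (\forall n \near F, 0 <= h n) -> 0 <= l.
Proof.
move=> hl h0; rewrite leNgt; apply/negP => l0.
have hN : \forall n \near F, h n < 0 by exact: (cvgr_lt _ hl).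
have : \forall n \near F, 0 <= h n /\ h n < 0 by apply: filterS2 h0 hN.
by move=> /filter_ex[n [h1 h2]]; move: h1; rewrite leNgt h2.
Qed.

Lemma ultra_fmap (T U : Type) (h : T -> U) (F : set_system T) :
  UltraFilter F -> UltraFilter (h @ F).
Proof.
move=> FU; have FP : ProperFilter F by exact: ultra_proper.
split; first exact: fmap_proper_filter.
move=> G GP FG; apply/seteqP; split => [A GA|]; last exact: FG.
have [//|nA] := in_ultra_setVsetC (h @^-1` A) FU.
have /FG GnA : (h @ F) (~` A) by [].
have : G (A `&` ~` A) by exact: filterI.
by rewrite setICr => /filter_ex[].
Qed.

Section Forward.
Variables (f : R -> R -> R) (K y t0 : R).
Hypothesis fK : forall x t, `|f x t| <= K.
Hypothesis fU : forall e, 0 < e -> exists2 d, 0 < d & forall x t x' t',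
  `|x - x'| < d -> `|t - t'| < d -> `|f x t - f x' t'| <= e.

Let K0 : 0 <= K. Proof. exact: le_trans (fK 0 0). Qed.
Let step (n : nat) : R := n.+1%:R^-1.
Let step_gt0 n : 0 < step n. Proof. by rewrite invr_gt0. Qed.
Fixpoint euler n k : R :=
  if k is k'.+1 then euler n k' + step n * f (euler n k') (t0 + k'%:R * step n) else y.

Let euler_lip n i m : `|euler n (i + m) - euler n i| <= K * (m%:R * step n).
Proof.
elim: m => [|m IH]; first by rewrite addn0 subrr normr0 mul0r mulr0.
rewrite addnS /= addrAC; apply: le_trans (ler_normD _ _) _.
have := fK (euler n (i + m)) (t0 + (i + m)%:R * step n).
have s0 := step_gt0 n; rewrite normrM (gtr0_norm s0) -natr1 mulrDl mul1r mulrDr.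
by move=> h; apply: lerD => //; rewrite mulrC ler_pM2r.
Qed.

(** While the polygon stays within [d] of its starting node, every velocity it uses is within [e] of
    the first one. The factor [K + 1] bounds the displacement in position, at speed [K], and in
    time, at speed 1, together. *)
Let euler_step n i m e d : 0 < d -> (forall x t x' t',
    `|x - x'| < d -> `|t - t'| < d -> `|f x t - f x' t'| <= e) ->
  (K + 1) * (m%:R * step n) < d ->
  `|euler n (i + m) - euler n i - m%:R * step n * f (euler n i) (t0 + i%:R * step n)|
     <= e * (m%:R * step n).
Proof.
move=> d0 fd; have s0 := step_gt0 n; elim: m => [|m IH].
  by move=> _; rewrite addn0 subrr !mul0r subr0 normr0 mulr0.
move=> Hm; have mm : m%:R * step n <= m.+1%:R * step n by rewrite ler_pM2r// ler_nat.
have m0 : 0 <= m%:R * step n by rewrite mulr_ge0// ltW.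
have {}IH := IH ltac:(nra).
rewrite addnS /= -natr1 !mulrDl mul1r mulrDr.
set E := euler n (i + m); set E0 := euler n i.
have -> : E + step n * f E (t0 + (i + m)%:R * step n) - E0 -
    (m%:R * step n * f E0 (t0 + i%:R * step n) + step n * f E0 (t0 + i%:R * step n)) =
   (E - E0 - m%:R * step n * f E0 (t0 + i%:R * step n)) +
   step n * (f E (t0 + (i + m)%:R * step n) - f E0 (t0 + i%:R * step n)) by ring.
apply: le_trans (ler_normD _ _) _; apply: lerD => //.
rewrite normrM (gtr0_norm s0) mulrC ler_pM2r//; apply: fd.
  by apply: le_lt_trans (euler_lip n i m) _; nra.
have -> : t0 + (i + m)%:R * step n - (t0 + i%:R * step n) = m%:R * step n by rewrite natrD; ring.
rewrite ger0_norm//; apply: le_lt_trans Hm; apply: (le_trans mm).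
by rewrite ler_peMl ?(le_trans m0)// lerDr.
Qed.

(* Taking the limit of the Euler polygons along an ultrafilter avoids extracting a subsequence. *)
Lemma peano_forward : exists Z : R -> R, [/\ Z 0 = y,
  (forall s t, 0 <= s -> s <= t -> `|Z t - Z s| <= K * (t - s)) &
  forall e, 0 < e -> exists2 d, 0 < d & forall s t, 0 <= s -> s <= t -> t - s < d ->
    `|Z t - Z s - (t - s) * f (Z s) (t0 + s)| <= e * (t - s)].
Proof.
have [U [UU EU]] := ultraFilterLemma eventually_filter.
have UP := @ultra_proper _ _ UU.
have K1 : 0 < K + 1 by rewrite ltr_wpDl.
pose c n s := Num.truncn (s * n.+1%:R).
pose z n s := euler n (c n s).
have c_cvg s : 0 <= s -> (c n s)%:R * step n @[n --> U] --> s.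
  move=> s0; have : (c n s)%:R * step n @[n --> \oo] --> s.
    apply: (@squeeze_cvgr _ _ _ _ (fun n => s - step n) (fun=> s)).
    - apply: nearW => n; have n0 : (0 : R) < n.+1%:R by [].
      have /truncn_itv/andP[h1 h2] : 0 <= s * n.+1%:R by rewrite mulr_ge0.
      have h3 : (c n s)%:R * step n <= s by rewrite ler_pdivrMr.
      have : s <= (c n s).+1%:R * step n by rewrite ler_pdivlMr// ltW.
      by rewrite -natr1 mulrDl mul1r => h4; apply/andP; split; lra.
    - rewrite -[X in _ --> X]subr0; apply: cvgB; [exact: cvg_cst|exact: cvg_harmonic].
    - exact: cvg_cst.
  by apply: cvg_trans; exact: cvg_app.
have c_le n s t : 0 <= s -> s <= t -> (c n s <= c n t)%N.
  move=> s0 st; have n0 : (0 : R) < n.+1%:R by [].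
  have /truncn_itv/andP[h1 _] : 0 <= s * n.+1%:R by rewrite mulr_ge0.
  have /truncn_itv/andP[_ h2] : 0 <= t * n.+1%:R by rewrite mulr_ge0// (le_trans s0).
  rewrite -ltnS -(ltr_nat R); apply: le_lt_trans h1 (le_lt_trans _ h2).
  by rewrite ler_pM2r.
have z_lip n s t : 0 <= s -> s <= t ->
    `|z n t - z n s| <= K * ((c n t)%:R * step n - (c n s)%:R * step n).
  move=> s0 st; have cl := c_le n s t s0 st.
  by rewrite /z -{1}(subnKC cl) -mulrBl -natrB//; exact: euler_lip.
have z_cvg s : 0 <= s -> exists l : R, z n s @[n --> U] --> l.
  move=> s0.
  have b n : `[y - K * (s + 1), y + K * (s + 1)]%classic (z n s).
    have := z_lip n 0 s (lexx 0) s0.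
    have -> : z n 0 = y by rewrite /z /c mul0r truncn0.
    have n0 : (0 : R) < n.+1%:R by [].
    have /truncn_itv/andP[h1 _] : 0 <= s * n.+1%:R by rewrite mulr_ge0.
    have : (c n s)%:R * step n <= s by rewrite ler_pdivrMr.
    have : 0 <= (c n 0)%:R * step n by rewrite mulr_ge0// ltW.
    move: ((c n s)%:R * step n) ((c n 0)%:R * step n) => A B hB hA.
    have h : K * (A - B) <= K * (s + 1) by rewrite ler_wpM2l//; lra.
    rewrite ler_norml /= in_itv/=; lra.
  have := @segment_compact R (y - K * (s + 1)) (y + K * (s + 1)).
  rewrite compact_ultra => /(_ _ (ultra_fmap (z^~ s) UU))[|l [_ ul]]; last by exists l.
  exact: nearW.
pose Z s := if pselect (0 <= s) is left s0 then sval (cid (z_cvg s s0)) else 0.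
have ZE s : 0 <= s -> z n s @[n --> U] --> Z s.
  by rewrite /Z; case: pselect => // h _; case: cid.
have cdiff s t : 0 <= s -> s <= t ->
    (c n t)%:R * step n - (c n s)%:R * step n @[n --> U] --> t - s.
  by move=> s0 st; apply: cvgB; apply: c_cvg => //; exact: le_trans st.
exists Z; split.
- have h : z n 0 @[n --> U] --> y.
    rewrite (_ : (fun n => z n 0) = fun=> y); first exact: cvg_cst.
    by apply/funext => n; rewrite /z /c mul0r truncn0.
  exact: (cvg_unique _ (ZE 0 (lexx 0)) h).
- move=> s t s0 st; have t0' := le_trans s0 st.
  rewrite -subr_ge0.
  have H : K * ((c n t)%:R * step n - (c n s)%:R * step n) - `|z n t - z n s| @[n --> U] -->
      K * (t - s) - `|Z t - Z s|.
    apply: cvgB; first by apply: cvgMr; exact: cdiff.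
    by apply: cvg_norm; apply: cvgB; exact: ZE.
  apply: cvg_to_ge0 H _.
  by apply: nearW => n /=; rewrite subr_ge0; exact: z_lip.
- move=> e e0; have [d d0 fd] := fU e0.
  exists (d / (K + 1)); first exact: divr_gt0.
  move=> s t s0 st; rewrite ltr_pdivlMr//.
  move=> std; have t0' := le_trans s0 st; rewrite -subr_ge0.
  have cf : f (z n s) (t0 + (c n s)%:R * step n) @[n --> U] --> f (Z s) (t0 + s).
    apply/cvgrPdist_le => r r0; have [d' d'0 fd'] := fU r0.
    have := c_cvg s s0; move=> /cvgrPdist_lt/(_ d' d'0) h1.
    have := ZE s s0; move=> /cvgrPdist_lt/(_ d' d'0) h2.
    apply: filterS2 h1 h2 => n h1 h2; apply: fd' => //.
    by rewrite opprD addrACA subrr add0r.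
  have cd := cdiff s t s0 st.
  have H : e * ((c n t)%:R * step n - (c n s)%:R * step n) - `|z n t - z n s -
      ((c n t)%:R * step n - (c n s)%:R * step n) * f (z n s) (t0 + (c n s)%:R * step n)|
      @[n --> U] --> e * (t - s) - `|Z t - Z s - (t - s) * f (Z s) (t0 + s)|.
    apply: cvgB; first by apply: cvgMr.
    apply: cvg_norm; apply: cvgB; last exact: cvgM.
    by apply: cvgB; exact: ZE.
  apply: cvg_to_ge0 H _.
  have : \forall n \near U, (K + 1) * ((c n t)%:R * step n - (c n s)%:R * step n) < d.
    have : (K + 1) * ((c n t)%:R * step n - (c n s)%:R * step n) @[n --> U] --> (K + 1) * (t - s).
      by apply: cvgMr.
    move=> /cvgr_lt; apply; by rewrite mulrC.
  apply: filterS => n /=; rewrite subr_ge0.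
  have cl := c_le n s t s0 st.
  rewrite /z -mulrBl -natrB// => Kd.
  by rewrite -{1}(subnKC cl); apply: euler_step fd Kd.
Qed.

End Forward.

(** The past is a forward solution for the time-reversed field, glued at [t0]; derivability is then
    verified separately from the right and from the left. *)
Lemma peano f (K y t0 : R) : (forall x t, `|f x t| <= K) ->
  (forall e, 0 < e -> exists2 d, 0 < d & forall x t x' t',
    `|x - x'| < d -> `|t - t'| < d -> `|f x t - f x' t'| <= e) ->
  exists X : R -> R, [/\ X t0 = y, (forall t, is_derive t 1 X (f (X t) t)) &
    forall t, `|X t - y| <= K * `|t - t0|].
Proof.
move=> fK fU.
have [Z [Z0 ZL ZD]] := peano_forward y t0 fK fU.
pose f' x t := - f x (- t).
have fK' x t : `|f' x t| <= K by rewrite normrN.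
have fU' e : 0 < e -> exists2 d, 0 < d & forall x t x' t',
    `|x - x'| < d -> `|t - t'| < d -> `|f' x t - f' x' t'| <= e.
  move=> e0; have [d d0 H] := fU e e0; exists d => // x t x' t' xx tt.
  by rewrite /f' -opprD normrN; apply: H => //; rewrite -opprD normrN.
have [W [W0 WL WD]] := peano_forward y (- t0) fK' fU'.
have K0 : 0 <= K by exact: le_trans (fK 0 0).
have K1 : 0 < K + 1 by rewrite ltr_wpDl.
pose X t := if t0 <= t then Z (t - t0) else W (t0 - t).
have XZ t : t0 <= t -> X t = Z (t - t0) by rewrite /X => ->.
have XW t : t <= t0 -> X t = W (t0 - t).
  rewrite /X le_eqVlt => /predU1P[->|]; first by rewrite lexx subrr Z0 W0.
  by rewrite ltNge => /negbTE ->.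
have X0 : X t0 = y by rewrite XZ// subrr.
have XL s t : s <= t -> `|X t - X s| <= K * (t - s).
  move=> st; have [ts|ts] := leP t0 s.
    rewrite !XZ ?(le_trans ts)//; have := ZL (s - t0) (t - t0).
    have -> : t - t0 - (s - t0) = t - s by ring.
    by apply; lra.
  have [tt|tt] := leP t0 t; last first.
    rewrite !XW ?(ltW ts) ?(ltW tt)// distrC; have := WL (t0 - t) (t0 - s).
    have -> : t0 - s - (t0 - t) = t - s by ring.
    by apply; lra.
  have -> : X t - X s = (X t - X t0) - (X s - X t0) by ring.
  apply: le_trans (ler_normB _ _) _.
  have := ZL 0 (t - t0); rewrite Z0 -(XZ t)// subr0 X0 => /(_ (lexx _)) h1.
  have := WL 0 (t0 - s); rewrite W0 -(XW s) ?(ltW ts)// subr0 => /(_ (lexx _)) h2.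
  have {}h1 := h1 ltac:(lra); have {}h2 := h2 ltac:(lra); nra.
exists X; split => //; last first.
  move=> t; rewrite -X0; have [h|h] := leP t0 t.
    by rewrite [`|t - t0|]ger0_norm ?subr_ge0//; exact: XL.
  by rewrite distrC [`|t - t0|]distrC [`|t0 - t|]ger0_norm ?subr_ge0 ?(ltW h)//; apply: XL; exact: ltW.
have XR t e : 0 < e -> exists2 d, 0 < d & forall s, t <= s -> s - t < d ->
    `|X s - X t - (s - t) * f (X t) t| <= e * (s - t).
  move=> e0; have [h|h] := leP t0 t.
    have [d d0 H] := ZD e e0; exists d => // s ts sd; rewrite !XZ ?(le_trans h)//.
    have := H (t - t0) (s - t0); rewrite subrKC.
    have -> : s - t0 - (t - t0) = s - t by ring.
    by apply; lra.
  (* For [t < t0] the estimate of the reversed solution is based at the later point [s]; half of [e]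
     pays for replacing its velocity by the one at [t], through uniform continuity. *)
  have e2 : 0 < e / 2 by lra.
  have [d d0 H] := WD _ e2; have [d' d'0 H'] := fU _ e2.
  exists (Num.min (t0 - t) (Num.min d (d' / (K + 1)))).
    by rewrite !lt_min d0 divr_gt0// subr_gt0 h.
  move=> s ts; rewrite !lt_min => /andP[h1 /andP[h2]]; rewrite ltr_pdivlMr//.
  move=> h3; have := H (t0 - s) (t0 - t).
  have -> : - t0 + (t0 - s) = - s by ring.
  rewrite /f' opprK; have -> : t0 - t - (t0 - s) = s - t by ring.
  rewrite -!XW; [|lra|lra] => H1; have {}H1 := H1 ltac:(lra) ltac:(lra) ltac:(lra).
  have -> : X s - X t - (s - t) * f (X t) t =
     - (X t - X s - (s - t) * - f (X s) s) - (s - t) * (f (X t) t - f (X s) s) by ring.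
  apply: le_trans (ler_normB _ _) _; rewrite normrN normrM (ger0_norm (_ : 0 <= s - t)) ?subr_ge0//.
  have : `|f (X t) t - f (X s) s| <= e / 2.
    apply: H'; rewrite distrC; first by apply: le_lt_trans (XL _ _ ts) _; nra.
    by rewrite ger0_norm; nra.
  have : 0 <= s - t by lra.
  by move=> h4 h5; nra.
have XLf t e : 0 < e -> exists2 d, 0 < d & forall s, s <= t -> t - s < d ->
    `|X t - X s - (t - s) * f (X t) t| <= e * (t - s).
  move=> e0; have [h|h] := leP t t0.
    have [d d0 H] := WD e e0; exists d => // s ts sd; rewrite !XW ?(le_trans ts)//.
    have := H (t0 - t) (t0 - s).
    have -> : - t0 + (t0 - t) = - t by ring.
    rewrite /f' opprK; have -> : t0 - s - (t0 - t) = t - s by ring.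
    move=> H1; have {}H1 := H1 ltac:(lra) ltac:(lra) ltac:(lra).
    rewrite -normrN; apply: le_trans H1; rewrite le_eqVlt; apply/orP; left; apply/eqP.
    by congr (`|_|); ring.
  have e2 : 0 < e / 2 by lra.
  have [d d0 H] := ZD _ e2; have [d' d'0 H'] := fU _ e2.
  exists (Num.min (t - t0) (Num.min d (d' / (K + 1)))).
    by rewrite !lt_min d0 divr_gt0// subr_gt0 h.
  move=> s ts; rewrite !lt_min => /andP[h1 /andP[h2]]; rewrite ltr_pdivlMr//.
  move=> h3; have := H (s - t0) (t - t0); rewrite subrKC.
  have -> : t - t0 - (s - t0) = t - s by ring.
  rewrite -!XZ; [|lra|lra] => H1; have {}H1 := H1 ltac:(lra) ltac:(lra) ltac:(lra).
  have -> : X t - X s - (t - s) * f (X t) t =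
     (X t - X s - (t - s) * f (X s) s) - (t - s) * (f (X t) t - f (X s) s) by ring.
  apply: le_trans (ler_normB _ _) _; rewrite normrM (ger0_norm (_ : 0 <= t - s)) ?subr_ge0//.
  have : `|f (X t) t - f (X s) s| <= e / 2.
    apply: H'; first by apply: le_lt_trans (XL _ _ ts) _; nra.
    by rewrite ger0_norm; nra.
  have : 0 <= t - s by lra.
  by move=> h4 h5; nra.
move=> t; apply/is_derive_epsP => e e0.
have [d1 d10 H1] := XR t e e0; have [d2 d20 H2] := XLf t e e0.
exists (Num.min d1 d2); first by rewrite lt_min d10 d20.
move=> s; rewrite lt_min => /andP[h1 h2]; have [ts|st] := leP t s.
  have E : `|s - t| = s - t by rewrite ger0_norm// subr_ge0.
  by move: h1; rewrite E [f _ _ * _]mulrC; apply: H1.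
have E : `|s - t| = t - s by rewrite ltr0_norm ?subr_lt0// opprB.
move: h2; rewrite E => h2; have := H2 s (ltW st) h2; rewrite -normrN.
by have -> : - (X t - X s - (t - s) * f (X t) t) = X s - X t - f (X t) t * (s - t) by ring.
Qed.

End Peano.

(** * Characteristics *)

Section Clamp.
Context {R : realType}.
Implicit Types (a b c d z : R).

Definition clamp a b z := Num.max a (Num.min z b).

Lemma clamp_in a b z : a <= b -> a <= clamp a b z <= b.
Proof. by move=> ab; rewrite /clamp le_max lexx ge_max ab ge_min lexx orbT. Qed.

Lemma clamp_id a b z : a <= z <= b -> clamp a b z = z.
Proof. by move=> /andP[h1 h2]; rewrite /clamp (min_idPl h2) (max_idPr h1). Qed.

Lemma clamp_lip a b c d : `|clamp a b c - clamp a b d| <= `|c - d|.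
Proof.
wlog cd : c d / c <= d.
  move=> H; have [/H//|/ltW dc] := leP c d.
  by rewrite distrC (distrC c); exact: H.
rewrite distrC (distrC c) (ger0_norm (_ : 0 <= d - c)) ?subr_ge0//.
have /andP[h1 h2] : 0 <= clamp a b d - clamp a b c <= d - c.
  rewrite /clamp; have [h1|h1] := leP d b; have [h2|h2] := leP c b.
  - by have [h3|h3] := leP a d; have [h4|h4] := leP a c; lra.
  - by lra.
  - by have [h3|h3] := leP a b; have [h4|h4] := leP a c; lra.
  - by have [h3|h3] := leP a b; lra.
by rewrite ger0_norm.
Qed.

End Clamp.

Section Flow.
Context {R : realType}.
Local Notation mu := (@lebesgue_measure R).
Implicit Types (u w : R -> R -> R) (x y z : R -> R) (a b s t : R).

(** The continuous functions [y / (y ^+ 2 + m.+1%:R^-1)] tend to [y^-1] everywhere, at [y = 0] too,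
    because [0^-1 = 0]. *)
Lemma measurable_fun_inv (D : set R) (f : R -> R) : measurable D -> measurable_fun D f ->
  measurable_fun D (fun r : R => (f r)^-1).
Proof.
move=> mD mf.
pose h (m : nat) (y : R) := y * (y ^+ 2 + m.+1%:R^-1)^-1.
have dpos m (y : R) : 0 < y ^+ 2 + m.+1%:R^-1 by rewrite ltr_wpDl ?sqr_ge0 ?invr_gt0.
apply: (@measurable_fun_cvg _ _ _ _ (fun m (r : R) => h m (f r))) => [m|x _].
  apply: measurableT_comp mf; apply: continuous_measurable_fun => y.
  apply: cvgM; first exact: cvg_id.
  apply: cvgV; first by rewrite gt_eqF.
  apply: cvgD; last exact: cvg_cst.
  by apply: cvgM; exact: cvg_id.
have [->|fx] := eqVneq (f x) 0.
  by rewrite invr0 (_ : h^~ 0 = fun=> 0); [exact: cvg_cst|apply/funext => m; rewrite /h mul0r].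
rewrite -[X in _ --> X]/((f x)^-1) (_ : (f x)^-1 = f x * (f x ^+ 2 + 0)^-1); last first.
  by rewrite addr0; field.
apply: cvgMr; apply: cvgV; first by rewrite addr0 sqrf_eq0.
by apply: cvgD; [exact: cvg_cst|exact: cvg_harmonic].
Qed.

Lemma measurable_cont_itv a b (f : R -> R) :
  (forall t, a <= t <= b -> {for t, continuous f}) -> measurable_fun `[a, b] f.
Proof.
move=> fc; apply: subspace_continuous_measurable_fun => //.
apply: continuous_in_subspaceT => t; rewrite inE /= in_itv/=; exact: fc.
Qed.

Lemma sum_sqint (C : R) (f g : R -> R) (N : nat) (p : nat -> R) : finite_energy C f g ->
  (forall k, (k < N)%N -> p k <= p k.+1) ->
  p 0%N <= p N /\ \sum_(k < N) sqint g (p k) (p k.+1) = sqint g (p 0%N) (p N).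
Proof.
move=> fg; elim: N => [|N IH] pm.
  by rewrite big_ord0 /sqint Rintegral_point.
have [h1 h2] := IH (fun k kN => pm k (ltnW kN)).
have h3 := pm N (ltnSn N); split; first exact: le_trans h3.
by rewrite big_ord_recr/= h2 -(sqint_split fg).
Qed.

(** Asked for every real time, negative ones included, so that all continuity statements are on the
    plane; weak solutions are brought into this form by [extend]. *)
Definition finite_energy_flow (C : R) u w :=
  continuous (fun p : R * R => u p.1 p.2) /\
  forall t, finite_energy C (u ^~ t) (w ^~ t).

Lemma cont2_comp u x t : continuous (fun p : R * R => u p.1 p.2) ->
  {for t, continuous x} -> {for t, continuous (fun s => u (x s) s)}.
Proof.
move=> uc xc; apply: (@continuous_comp _ _ _ (fun s => (x s, s)) (fun p => u p.1 p.2)); last exact: uc.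
exact: (cvg_pair xc cvg_id).
Qed.

(** [w] is measurable in space at each fixed time, so measurability in time has to come from [u]: by
    [variance_cvg] the integral is the limit, over equal subdivisions of [[x t, y t]], of sums of
    squared increments of [u] divided by lengths, and each such sum is measurable in [t]. *)
Lemma measurable_sqint C u w a b x y : finite_energy_flow C u w ->
  (forall t, a <= t <= b -> {for t, continuous x}) ->
  (forall t, a <= t <= b -> {for t, continuous y}) ->
  (forall t, a <= t <= b -> x t <= y t) ->
  measurable_fun `[a, b] (fun t => sqint (w ^~ t) (x t) (y t)).
Proof.
move=> [uc uw] xc yc xy.
pose X (n k : nat) t := x t + (y t - x t) * (k%:R / n.+1%:R).
have X0 n t : X n 0%N t = x t by rewrite /X mul0r mulr0 addr0.
have Xn n t : X n n.+1 t = y t by rewrite /X divff ?pnatr_eq0// mulr1 subrKC.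
have Xd n k t : X n k.+1 t - X n k t = (y t - x t) / n.+1%:R.
  by rewrite /X -natr1; field; rewrite addrC natr1 pnatr_eq0.
have Xc n k t : a <= t <= b -> {for t, continuous (X n k)}.
  move=> tab; apply: cvgD; first exact: xc.
  by apply: cvgMl; apply: cvgB; [exact: yc|exact: xc].
apply: (@measurable_fun_cvg _ _ _ _ (fun n t => \sum_(k < n.+1)
    (u (X n k.+1 t) t - u (X n k t) t) ^+ 2 / (X n k.+1 t - X n k t))) => [n|t tab].
  apply: measurable_sum => k; apply: measurable_funM.
    apply: measurable_funX; apply: measurable_cont_itv => t tab.
    by apply: cvgB; apply: (cont2_comp uc); exact: Xc.
  apply: measurable_fun_inv => //; apply: measurable_cont_itv => t tab.
  by apply: cvgB; exact: Xc.
have {}tab : a <= t <= b by move: tab; rewrite /= in_itv.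
have := @variance_cvg _ _ _ _ (uw t) (fun n => n.+1) (fun n k => X n k t) (fun _ _ => true)
  (fun n => (y t - x t) * n.+1%:R^-1).
move=> /(_ _ _ _)H; have {}H := H _ _ _.
have tel n : \sum_(k < n.+1) sqint (w^~ t) (X n k t) (X n k.+1 t) = sqint (w^~ t) (x t) (y t).
  rewrite -[in RHS](X0 n t) -(Xn n t).
  apply: (@sum_sqint C (u^~ t) _ n.+1 (fun k => X n k t) (uw t) _).2 => k _.
  by rewrite -subr_ge0 Xd divr_ge0// subr_ge0 xy.
have E n : \sum_(k < n.+1) (u (X n k.+1 t) t - u (X n k t) t) ^+ 2 / (X n k.+1 t - X n k t) =
    sqint (w^~ t) (x t) (y t) - \sum_(k < n.+1 | true) (sqint (w^~ t) (X n k t) (X n k.+1 t) -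
     (u (X n k.+1 t) t - u (X n k t) t) ^+ 2 / (X n k.+1 t - X n k t)).
  by rewrite sumrB tel opprB addrC subrK.
rewrite (_ : (fun n => _) = fun n => sqint (w^~ t) (x t) (y t) - \sum_(k < n.+1 | true)
    (sqint (w^~ t) (X n k t) (X n k.+1 t) -
     (u (X n k.+1 t) t - u (X n k t) t) ^+ 2 / (X n k.+1 t - X n k t))); last exact/funext.
rewrite -[X in _ --> X]subr0; apply: cvgB; first exact: cvg_cst.
apply: H.
- by move=> n k _; rewrite -subr_ge0 Xd divr_ge0// subr_ge0 xy.
- by move=> n k _ _; rewrite Xd.
- rewrite -[X in _ --> X](mulr0 (y t - x t)); apply: cvgMr; exact: cvg_harmonic.
Qed.

(** The derivative is two-sided at [a] and [b] as well, so characteristics restrict to subintervals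
    without any change of notion. *)
Definition charac u a b x := forall t, a <= t <= b -> is_derive t 1 x (u (x t) t).

Lemma is_derive_cont x t (l : R) : is_derive t 1 x l -> {for t, continuous x}.
Proof. by move=> [dx _]; apply: differentiable_continuous; exact/derivable1_diffP. Qed.

Lemma charac_cont u a b x : charac u a b x -> forall t, a <= t <= b -> {for t, continuous x}.
Proof. by move=> cx t /cx; exact: is_derive_cont. Qed.

Lemma charac_sub u a b c d x : a <= c -> d <= b -> charac u a b x -> charac u c d x.
Proof. by move=> ac db cx t /andP[ct td]; apply: cx; rewrite (le_trans ac) ?(le_trans td). Qed.

(** Where [x] and [y] meet they have the same velocity, so either choice has the right derivative;
    where they differ, continuity keeps [z] on one of them for a while. This is what allows crossing
    characteristics to be reordered. *)
Lemma charac_choice u a b x y z : charac u a b x -> charac u a b y ->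
  (forall t, a <= t <= b -> {for t, continuous z}) ->
  (forall t, z t = x t \/ z t = y t) -> charac u a b z.
Proof.
move=> cx cy zc zxy t tab.
have key x' y' : charac u a b x' -> charac u a b y' -> (forall t, z t = x' t \/ z t = y' t) ->
    z t = x' t -> is_derive t 1 z (u (z t) t).
  move=> cx' cy' zxy' zx; rewrite zx; apply/is_derive_epsP => e e0.
  have /is_derive_epsP/(_ e e0)[r1 r10 H1] := cx' t tab.
  have [xye|xyn] := eqVneq (x' t) (y' t).
    have /is_derive_epsP/(_ e e0)[r2 r20 H2] := cy' t tab.
    exists (Num.min r1 r2); first by rewrite lt_min r10 r20.
    move=> s; rewrite lt_min => /andP[h1 h2].
    by rewrite zx; case: (zxy' s) => ->; [exact: H1|rewrite {1 2}xye; exact: H2].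
  have d0 : 0 < `|x' t - y' t| / 2 by rewrite divr_gt0// normr_gt0 subr_eq0.
  have /cvgrPdist_lt/(_ _ d0)[r2/= r20 H2] := zc t tab.
  have /cvgrPdist_lt/(_ _ d0)[r3/= r30 H3] := charac_cont cy' tab.
  exists (Num.min r1 (Num.min r2 r3)); first by rewrite !lt_min r10 r20.
  move=> s; rewrite !lt_min => /andP[h1 /andP[h2 h3]].
  rewrite zx; case: (zxy' s) => zs; first by rewrite zs; exact: H1.
  have {}H2 : `|z t - z s| < `|x' t - y' t| / 2 by apply: H2; rewrite /= distrC.
  have {}H3 : `|y' t - y' s| < `|x' t - y' t| / 2 by apply: H3; rewrite /= distrC.
  exfalso; move: H2; rewrite zx zs => H2.
  have := ler_normB (x' t - y' s) (y' t - y' s).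
  have -> : x' t - y' s - (y' t - y' s) = x' t - y' t by ring.
  by move: H2 H3; set A := `|x' t - y' t|; lra.
case: (zxy t) => h; first exact: (key x y).
by apply: (key y x) => // s; case: (zxy s); [right|left].
Qed.

Lemma cont_max x y t : {for t, continuous x} -> {for t, continuous y} ->
  {for t, continuous (fun s => Num.max (x s) (y s))}.
Proof.
move=> xc yc.
have -> : (fun s => Num.max (x s) (y s)) = fun s => (x s + y s + `|x s - y s|) / 2.
  by apply/funext => s; rewrite maxr_absE.
apply: cvgMl; apply: cvgD; first exact: cvgD.
by apply: cvg_norm; exact: cvgB.
Qed.

Lemma cont_min x y t : {for t, continuous x} -> {for t, continuous y} ->
  {for t, continuous (fun s => Num.min (x s) (y s))}.
Proof.
move=> xc yc.
have -> : (fun s => Num.min (x s) (y s)) = fun s => (x s + y s - `|x s - y s|) / 2.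
  by apply/funext => s; rewrite minr_absE.
apply: cvgMl; apply: cvgB; first exact: cvgD.
by apply: cvg_norm; exact: cvgB.
Qed.

Lemma charac_max u a b x y : charac u a b x -> charac u a b y ->
  charac u a b (fun t => Num.max (x t) (y t)).
Proof.
move=> cx cy; apply: (charac_choice cx cy) => [t tab|t].
  by apply: cont_max; [exact: charac_cont cx _ tab|exact: charac_cont cy _ tab].
by case: (leP (x t) (y t)); [right|left].
Qed.

Lemma charac_min u a b x y : charac u a b x -> charac u a b y ->
  charac u a b (fun t => Num.min (x t) (y t)).
Proof.
move=> cx cy; apply: (charac_choice cx cy) => [t tab|t].
  by apply: cont_min; [exact: charac_cont cx _ tab|exact: charac_cont cy _ tab].
by case: (leP (x t) (y t)); [left|right].
Qed.

(** [normr_Rintegral_le_sqr] with [K = l] bounds the increment from [0] by [l * |r| + l^-1 * C]. The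
    growth rate [l] can be taken small compared with [1 / T], which prevents blow-up of
    characteristics. *)
Lemma flow_sublinear C u w (T l : R) : finite_energy_flow C u w -> 0 <= T -> 0 < l ->
  exists A, 0 <= A /\ forall (r : R) t, 0 <= t <= T -> `|u r t| <= A + l * `|r|.
Proof.
move=> [uc uw] T0 l0.
have [c _ Hc] : exists2 c : R, c \in `[0, T] & forall t : R, t \in `[0, T] -> `|u 0 t| <= `|u 0 c|.
  apply: (@EVT_max R (fun t => `|u 0 t|)) => //; apply: continuous_subspaceT => t.
  apply: cvg_norm; apply: (@cont2_comp u (fun=> 0)) => //; exact: cvg_cst.
have C0 : 0 <= C by exact: finite_energy_ge0 (uw 0).
exists (`|u 0 c| + l^-1 * C); split; first by rewrite addr_ge0// mulr_ge0// invr_ge0 ltW.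
move=> x t tT; have -> : u x t = u 0 t + (u x t - u 0 t) by ring.
apply: le_trans (ler_normD _ _) _; rewrite -addrA lerD//.
  by apply: Hc; rewrite in_itv.
have key a b : a <= b -> `|u b t - u a t| <= l * (b - a) + l^-1 * C.
  move=> ab; rewrite -(finite_energy_FTC (uw t) ab).
  apply: le_trans (normr_Rintegral_le_sqr (uw t) ab l0) _.
  rewrite lerD2l ler_pM2l ?invr_gt0//; exact: (finite_energy_Rintegral_le (uw t)).
rewrite [l^-1 * C + _]addrC; have [x0|x0] := leP 0 x; first by have := key 0 x x0; rewrite subr0 (ger0_norm x0).
by rewrite distrC; have := key x 0 (ltW x0); rewrite sub0r (ltr0_norm x0).
Qed.

(** Peano's theorem is applied to the velocity frozen outside a box; the a priori bound shows that
    the solution never leaves the box. The bound [M] is common to all starting points of size at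
    most [L]. *)
Lemma charac_exists C u w (T L : R) : finite_energy_flow C u w -> 0 <= T -> 0 <= L ->
  exists M : R, forall t0 y0 : R, 0 <= t0 <= T -> `|y0| <= L ->
    exists x, [/\ x t0 = y0, charac u 0 T x & forall t, 0 <= t <= T -> `|x t| <= M].
Proof.
move=> uw T0 L0.
(* This growth rate makes a speed bounded on the box of size [M] contribute at most [T * A + M / 4]
   to the displacement, so that [L + T * K <= M]. *)
have l0 : 0 < (4 * (T + 1))^-1 by rewrite invr_gt0 mulr_gt0// ltr_wpDl.
have [A [A0 HA]] := flow_sublinear uw T0 l0.
pose M := 2 * (L + T * A) + 1.
have TA : 0 <= T * A by rewrite mulr_ge0.
have M0 : 0 <= M by rewrite /M; lra.
pose cl r := @clamp R (- r) r.
pose ct := @clamp R 0 T.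
pose f (x t : R) := u (cl M x) (ct t).
pose K := A + (4 * (T + 1))^-1 * M.
have fK (x t : R) : `|f x t| <= K.
  apply: le_trans (HA _ _ (clamp_in _ T0)) _; rewrite lerD2l ler_pM2l//.
  by rewrite ler_norml clamp_in//; lra.
have fU e : 0 < e -> exists2 d, 0 < d & forall x t x' t' : R,
    `|x - x'| < d -> `|t - t'| < d -> `|f x t - f x' t'| <= e.
  move=> e0; have [d d0 H] := @unif_cont_rectangle R u (- M) M 0 T uw.1 e e0.
  exists d => // x t x' t' xx tt; apply: H; [by apply: clamp_in; lra|exact: clamp_in| |].
    exact: le_lt_trans (clamp_lip _ _ _ _) xx.
  exact: le_lt_trans (clamp_lip _ _ _ _) tt.
have TK : L + T * K <= M.
  have h : T * ((4 * (T + 1))^-1 * M) <= M / 4.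
    rewrite mulrA [M / 4]mulrC ler_wpM2r// ler_pdivrMr ?mulr_gt0 ?ltr_wpDl//; lra.
  by rewrite /K mulrDr; move: h; rewrite /M; lra.
exists M => t0 y0 /andP[t00 t0T] y0L.
have [X [X0 XD XL]] := peano y0 t0 fK fU.
have XM t : 0 <= t <= T -> `|X t| <= M.
  move=> /andP[t1 t2]; apply: le_trans TK; have -> : X t = y0 + (X t - y0) by ring.
  apply: le_trans (ler_normD _ _) _; apply: lerD => //; apply: le_trans (XL t) _.
  rewrite mulrC ler_wpM2r//; first exact: le_trans (fK 0 0).
  by rewrite ler_norml; apply/andP; split; lra.
exists X; split => // t tT; have := XD t; rewrite /f /cl /ct !clamp_id//.
by rewrite -ler_norml XM.
Qed.

End Flow.

(** * Mean value theorem, fundamental theorem and integration by parts in time *)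

Section TimeCalculus.
Context {R : realType}.
Local Notation mu := (@lebesgue_measure R).
Implicit Types (f df p q E h e : R -> R) (a b c s t : R).

Lemma bounded_cont_itv f a b : (forall t, a <= t <= b -> {for t, continuous f}) ->
  exists M, 0 <= M /\ forall t, a <= t <= b -> `|f t| <= M.
Proof.
move=> fc; have [ab|ba] := leP a b; last first.
  by exists 0; split => // t tab; exfalso; move: tab; lra.
have [|c _ Hc] := @EVT_max R (fun t => `|f t|) a b ab.
  apply: continuous_in_subspaceT => t; rewrite inE /= in_itv/= => tab.
  by apply: cvg_norm; exact: fc.
by exists `|f c|; split => // t tab; apply: Hc; rewrite in_itv.
Qed.

Lemma mvt_closed f df a b : a <= b -> (forall t, a <= t <= b -> is_derive t 1 f (df t)) ->
  exists c, a <= c <= b /\ f b - f a = df c * (b - a).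
Proof.
rewrite le_eqVlt => /predU1P[->|ab] fd.
  by exists b; rewrite lexx !subrr mulr0.
have [||c] := @MVT R f df a b ab.
- by move=> t; rewrite in_itv/= => /andP[h1 h2]; apply: fd; rewrite !ltW.
- apply: continuous_in_subspaceT => t; rewrite inE /= in_itv/= => /fd; exact: is_derive_cont.
by rewrite in_itv/= => /andP[h1 h2] H; exists c; rewrite !ltW.
Qed.

Lemma C1_FTC f df a b : a <= b -> (forall t, a <= t <= b -> is_derive t 1 f (df t)) ->
  (forall t, a <= t <= b -> {for t, continuous df}) ->
  \int[mu]_(t in `[a, b]) df t = f b - f a.
Proof.
rewrite le_eqVlt => /predU1P[->|ab] fd dfc.
  by rewrite subrr Rintegral_point.
have fc t : a <= t <= b -> {for t, continuous f} by move/fd; exact: is_derive_cont.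
rewrite /Rintegral (@continuous_FTC2 R df f a b ab)//.
- by apply: continuous_in_subspaceT => t; rewrite inE /= in_itv/=; exact: dfc.
- split.
  + by move=> t; rewrite in_itv/= => /andP[h1 h2]; have [] := fd t; rewrite ?ltW.
  + by apply: cvg_at_right_filter; apply: fc; rewrite lexx ltW.
  + by apply: cvg_at_left_filter; apply: fc; rewrite lexx ltW.
- move=> t; rewrite in_itv/= => /andP[h1 h2].
  by rewrite derive1E; have [|_ ->//] := fd t; rewrite !ltW.
Qed.

(* Integration by parts when [p] is only the primitive of a bounded measurable function: the
   difference of the two sides has quadratically small increments. *)
Lemma AC_integration_by_parts p E q dq a b M : a <= b -> measurable_fun `[a, b] E ->
  (forall t, a <= t <= b -> `|E t| <= M) ->
  (forall t, a <= t <= b -> {for t, continuous p}) ->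
  (forall s t, a <= s -> s <= t -> t <= b -> p t - p s = \int[mu]_(r in `[s, t]) E r) ->
  (forall t, a <= t <= b -> is_derive t 1 q (dq t)) ->
  (forall t, a <= t <= b -> {for t, continuous dq}) ->
  mu.-integrable `[a, b] (EFin \o (fun t => E t * q t + p t * dq t)) /\
  p b * q b - p a * q a = \int[mu]_(t in `[a, b]) (E t * q t + p t * dq t).
Proof.
move=> ab mE EM pc pE qd dqc.
have qc t : a <= t <= b -> {for t, continuous q} by move/qd; exact: is_derive_cont.
have M0 : 0 <= M by apply: le_trans (EM a _) => //; rewrite lexx.
have [Mq [Mq0 HMq]] := bounded_cont_itv dqc.
have Ei : mu.-integrable `[a, b] (EFin \o E) by exact: integrable_bounded mE EM.
have mq := measurable_cont_itv qc; have mp := measurable_cont_itv pc.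
have mdq := measurable_cont_itv dqc.
have dqi : mu.-integrable `[a, b] (EFin \o dq) by exact: integrable_bounded mdq HMq.
have [Bq [_ HBq]] := bounded_cont_itv qc; have [Bp [_ HBp]] := bounded_cont_itv pc.
have i1 : mu.-integrable `[a, b] (EFin \o (fun t => E t * q t)).
  rewrite (_ : (fun t => _) = fun t => q t * E t); last by apply/funext => t; rewrite mulrC.
  by apply: (@integrable_mul_bounded _ _ _ _ Bq) => // t; rewrite /= in_itv/=; exact: HBq.
have i2 : mu.-integrable `[a, b] (EFin \o (fun t => p t * dq t)).
  by apply: (@integrable_mul_bounded _ _ _ _ Bp) => // t; rewrite /= in_itv/=; exact: HBp.
have i3 : mu.-integrable `[a, b] (EFin \o (fun t => E t * q t + p t * dq t)).
  exact: integrable_add.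
split => //.
pose Z t := p t * q t - \int[mu]_(r in `[a, t]) (E r * q r + p r * dq r).
suff : Z b = Z a by rewrite /Z Rintegral_point subr0 => <-; rewrite subKr.
have dq_lip s t : a <= s -> s <= t -> t <= b -> `|q t - q s| <= Mq * (t - s).
  move=> as_ st tb; have [|c [/andP[c1 c2] ->]] := @mvt_closed q dq s t st.
    by move=> r /andP[h1 h2]; apply: qd; rewrite (le_trans as_) ?(le_trans h2).
  rewrite normrM (ger0_norm (_ : 0 <= t - s)) ?subr_ge0// ler_wpM2r ?subr_ge0//.
  by apply: HMq; rewrite (le_trans as_) ?(le_trans c2).
have p_lip s t : a <= s -> s <= t -> t <= b -> `|p t - p s| <= M * (t - s).
  move=> as_ st tb; rewrite pE//; apply: normr_Rintegral_le => //.
    exact: integrable_sub_itv Ei as_ tb.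
  by move=> r /andP[h1 h2]; apply: EM; rewrite (le_trans as_) ?(le_trans h2).
apply: const_of_small_increments => // e e0.
have k0 : 0 < 2 * M * Mq + 1 by rewrite ltr_wpDl// !mulr_ge0.
exists (e / (2 * M * Mq + 1)); first exact: divr_gt0.
move=> s t as_ st tb; rewrite ltr_pdivlMr// => tse.
have sub f' : mu.-integrable `[a, b] (EFin \o f') -> mu.-integrable `[s, t] (EFin \o f').
  by move=> fi; exact: integrable_sub_itv fi as_ tb.
(* Both differences [q s - q r] and [p t - p r] are of order [t - s], so the integral is of order
   [(t - s) ^+ 2]. *)
have -> : Z t - Z s = \int[mu]_(r in `[s, t])
    (E r * (q s - q r) + (p t - p r) * dq r).
  rewrite /Z (@Rintegral_split _ _ a s t)//; last exact: integrable_sub_itv i3 (lexx a) tb.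
  transitivity (q s * (p t - p s) + p t * (q t - q s) -
      \int[mu]_(r in `[s, t]) (E r * q r + p r * dq r)).
    by move: (\int[mu]_(_ in `[a, s]) _) (\int[mu]_(_ in `[s, t]) _) => A B; ring.
  rewrite pE//.
  have <- : \int[mu]_(r in `[s, t]) dq r = q t - q s.
    apply: C1_FTC => //.
    by move=> r /andP[h1 h2]; apply: qd; rewrite (le_trans as_) ?(le_trans h2).
    by move=> r /andP[h1 h2]; apply: dqc; rewrite (le_trans as_) ?(le_trans h2).
  rewrite -RintegralZl//; last exact: sub.
  rewrite -RintegralZl//; last exact: sub.
  rewrite -RintegralD//; [|by apply: integrable_scale => //; exact: sub..].
  rewrite -RintegralB//; last 2 first.
  - by apply: integrable_add => //; apply: integrable_scale => //; exact: sub.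
  - exact: sub.
  by apply: eq_Rintegral => r _; ring.
apply: le_trans (@normr_Rintegral_le _ _ s t (2 * M * Mq * (t - s)) st _ _) _.
- rewrite (_ : (fun r => _) = fun r => (q s * E r + p t * dq r) - (E r * q r + p r * dq r)); last first.
    by apply/funext => r; ring.
  apply: integrable_sub => //; last exact: sub.
  by apply: integrable_add => //; apply: integrable_scale => //; exact: sub.
- move=> r /andP[sr rt].
  have ar := le_trans as_ sr; have rb := le_trans rt tb.
  apply: le_trans (ler_normD _ _) _; rewrite !normrM.
  have h1 : `|E r| <= M by apply: EM; rewrite ar rb.
  have h2 : `|dq r| <= Mq by apply: HMq; rewrite ar rb.
  have h3 : `|q s - q r| <= Mq * (t - s).
    rewrite distrC; apply: le_trans (dq_lip _ _ as_ sr rb) _; rewrite ler_wpM2l//; lra.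
  have h4 : `|p t - p r| <= M * (t - s).
    apply: le_trans (p_lip _ _ ar rt tb) _; rewrite ler_wpM2l//; lra.
  have h5 := ler_pM (normr_ge0 _) (normr_ge0 _) h1 h3.
  have h6 := ler_pM (normr_ge0 _) (normr_ge0 _) h4 h2.
  by move: (lerD h5 h6); rewrite (_ : M * (Mq * (t - s)) + M * (t - s) * Mq = 2 * M * Mq * (t - s))//; ring.
- rewrite ler_wpM2r ?subr_ge0//.
  have : 0 <= t - s by lra.
  by move: tse; set k := 2 * M * Mq; nra.
Qed.

End TimeCalculus.

(** * The distance between two characteristics *)

Section PairODE.
Context {R : realType}.
Local Notation mu := (@lebesgue_measure R).
Variables (h p e : R -> R) (a b C : R).
Hypothesis ab : a <= b.
Hypothesis hd : forall t, a <= t <= b -> is_derive t 1 h (p t).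
Hypothesis pc : forall t, a <= t <= b -> {for t, continuous p}.
Hypothesis em : measurable_fun `[a, b] e.
Hypothesis eC : forall t, a <= t <= b -> 0 <= e t <= C.
Hypothesis pe : forall s t, a <= s -> s <= t -> t <= b ->
  p t - p s = \int[mu]_(r in `[s, t]) (2^-1 * e r).
Hypothesis h0 : forall t, a <= t <= b -> 0 <= h t.
Hypothesis CS : forall t, a <= t <= b -> p t ^+ 2 <= h t * e t.
Implicit Types (s t d eta kappa M : R).

(* Twice the derivative of [Num.sqrt (h + d)]; a positive [d] keeps it defined where [h] vanishes. *)
Definition sqrt_speed d t := p t / Num.sqrt (h t + d).
Local Notation g d t := (Num.sqrt (h t + d)).

Let g_pos d t : a <= t <= b -> 0 < h t + d -> 0 < g d t.
Proof. by move=> _; rewrite sqrtr_gt0. Qed.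

Let g_sq d t : 0 < h t + d -> g d t ^+ 2 = h t + d.
Proof. by move=> h1; rewrite sqr_sqrtr// ltW. Qed.

Let g_der d t : a <= t <= b -> 0 < h t + d ->
  is_derive t 1 (fun t => g d t) (2^-1 * sqrt_speed d t).
Proof.
move=> tab hpos.
have h1 : is_derive t 1 (fun t => h t + d) (p t).
  have := hd tab => hdt.
  have := @is_deriveD R R^o R^o h (fun=> d) t 1 (p t) 0 hdt (is_derive_cst d t 1).
  by rewrite addr0.
have := @is_derive1_comp R Num.sqrt (fun t => h t + d) t _ _ (is_derive1_sqrt hpos) h1.
rewrite /sqrt_speed (_ : _^-1 * p t = 2^-1 * (p t / g d t))//.
by field; rewrite gt_eqF// sqrtr_gt0.
Qed.

(** The product rule for [p] and the inverse of [Num.sqrt (h + d)], with derivative [e / 2] for [p]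
    and [p] for [h]. For [d = 0] the integrand is the variance term over [2 * Num.sqrt h]. *)
Lemma sqrt_speed_incr d s t : a <= s -> s <= t -> t <= b ->
  (forall r, a <= r <= b -> 0 < h r + d) ->
  mu.-integrable `[s, t] (EFin \o (fun r => (e r - p r ^+ 2 / (h r + d)) / (2 * g d r))) /\
  sqrt_speed d t - sqrt_speed d s =
    \int[mu]_(r in `[s, t]) ((e r - p r ^+ 2 / (h r + d)) / (2 * g d r)).
Proof.
move=> as_ st tb hpos.
have sub r : s <= r <= t -> a <= r <= b.
  by move=> /andP[h1 h2]; rewrite (le_trans as_) ?(le_trans h2).
pose q r := (g d r)^-1.
pose dq r := - (2^-1 * sqrt_speed d r * (g d r)^-1 ^+ 2).
have gn0 r : a <= r <= b -> g d r != 0 by move=> rab; rewrite gt_eqF// g_pos// hpos.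
have qd r : a <= r <= b -> is_derive r 1 q (dq r).
  move=> rab; have gd := g_der rab (hpos r rab).
  have := @is_deriveV R (fun t => g d t) r (2^-1 * sqrt_speed d r) 1 (gn0 r rab) gd.
  rewrite (_ : _ *: _ = dq r)// /dq /GRing.scale/=.
  by field; exact: gn0.
have gc r : a <= r <= b -> {for r, continuous (fun t => g d t)}.
  by move=> rab; exact: is_derive_cont (g_der rab (hpos r rab)).
have dqc r : a <= r <= b -> {for r, continuous dq}.
  move=> rab; have gVc : {for r, continuous q} by exact: is_derive_cont (qd r rab).
  apply: cvgN; apply: cvgM.
    by apply: cvgM; [exact: cvg_cst|apply: cvgM; [exact: pc|exact: gVc]].
  by apply: cvgM; exact: gVc.
have mE : measurable_fun `[s, t] (fun r => 2^-1 * e r).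
  apply: measurable_funM; first exact: measurable_cst.
  apply: (@measurable_funS _ _ _ _ `[a, b]%classic) em; [exact: measurable_itv|exact: sub].
have C0 : 0 <= C by have /andP[h1 h2] := eC (t := a) ltac:(rewrite lexx ab//); exact: le_trans h2.
have [] := @AC_integration_by_parts R p (fun r => 2^-1 * e r) q dq s t C st mE.
- move=> r /sub rab; have /andP[e0 e1] := eC rab.
  by rewrite ger0_norm ?mulr_ge0//; lra.
- by move=> r /sub; exact: pc.
- by move=> r1 r2 h1 h2 h3; apply: pe => //; [exact: le_trans h1|exact: le_trans tb].
- by move=> r /sub; exact: qd.
- by move=> r /sub; exact: dqc.
have E r : r \in `[s, t]%classic -> 2^-1 * e r * q r + p r * dq r =
    (e r - p r ^+ 2 / (h r + d)) / (2 * g d r).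
  rewrite inE /= in_itv/= => /sub rab.
  have G := g_sq (hpos r rab); have kn := gn0 r rab.
  by rewrite /q /dq /sqrt_speed; set k := g d r in G kn *; rewrite -G; field.
move=> i1 i2; split.
  by apply: eq_integrable i1 => // r rst; rewrite /= E.
by rewrite -(eq_Rintegral mu E) -i2.
Qed.

Let integrand_ge0 d r : 0 <= d -> a <= r <= b -> 0 < h r + d ->
  0 <= (e r - p r ^+ 2 / (h r + d)) / (2 * g d r).
Proof.
move=> d0 rab hpos; have /andP[e0 _] := eC rab.
apply: divr_ge0; last by rewrite mulr_ge0// sqrtr_ge0.
rewrite subr_ge0 ler_pdivrMr//; apply: le_trans (CS rab) _.
by rewrite mulrC ler_wpM2l// lerDl.
Qed.

Let sqrt_speed_nd d s t : 0 <= d -> (forall r, a <= r <= b -> 0 < h r + d) ->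
  a <= s -> s <= t -> t <= b -> sqrt_speed d s <= sqrt_speed d t.
Proof.
move=> d0 hpos as_ st tb; rewrite -subr_ge0.
have [_ ->] := sqrt_speed_incr as_ st tb hpos.
apply: Rintegral_ge0 => r; rewrite /= in_itv/= => /andP[h1 h2].
by apply: integrand_ge0 => //; [|apply: hpos]; rewrite (le_trans as_) ?(le_trans h2).
Qed.

(** Convexity: Cauchy-Schwarz makes the integrand of [sqrt_speed_incr] nonnegative, so the
    derivative of [Num.sqrt (h + d)] is nondecreasing. *)
Lemma sqrt_height_bounds d s t : 0 <= d -> (forall r, a <= r <= b -> 0 < h r + d) ->
  a <= s -> s <= t -> t <= b ->
  2^-1 * sqrt_speed d s * (t - s) <= g d t - g d s <= 2^-1 * sqrt_speed d t * (t - s).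
Proof.
move=> d0 hpos as_ st tb.
have [|c [/andP[sc ct] ->]] := @mvt_closed R (fun t => g d t) (fun t => 2^-1 * sqrt_speed d t) s t st.
  by move=> r /andP[h1 h2]; apply: g_der; [|apply: hpos]; rewrite (le_trans as_) ?(le_trans h2).
have ts : 0 <= t - s by lra.
rewrite !ler_wpM2r// ler_pM2l//; apply: sqrt_speed_nd => //.
  exact: le_trans sc.
exact: le_trans ct tb.
Qed.

(** Convexity of [Num.sqrt (h + 1)]. As a consequence, cells that are narrow at both end times are
    narrow throughout, as needed to apply [variance_cvg] at every intermediate time. *)
Lemma height_le_max t : a <= t <= b -> h t <= Num.max (h a) (h b).
Proof.
move=> tab; have /andP[at_ tb] := tab.
have hpos r : a <= r <= b -> 0 < h r + 1 by move=> /h0 hr; rewrite ltr_wpDl.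
have aab : a <= a <= b by rewrite lexx ab.
have bab : a <= b <= b by rewrite lexx ab.
rewrite le_max; have [pt|pt] := leP 0 (p t).
  apply/orP; right.
  have /andP[h1 _] := @sqrt_height_bounds 1 t b ler01 hpos at_ tb (lexx b).
  have : g 1 t <= g 1 b.
    rewrite -subr_ge0; apply: le_trans h1.
    by rewrite mulr_ge0 ?subr_ge0// mulr_ge0// divr_ge0// sqrtr_ge0.
  by rewrite ler_sqrt ?lerD2r//; apply: ltW; exact: hpos.
apply/orP; left.
have /andP[_ h1] := @sqrt_height_bounds 1 a t ler01 hpos (lexx a) at_ tb.
have : g 1 t <= g 1 a.
  rewrite -subr_le0; apply: (le_trans h1).
  have h2 : 0 <= t - a by lra.
  have h3 : 0 < (g 1 t)^-1 by rewrite invr_gt0 g_pos// hpos.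
  have h4 : sqrt_speed 1 t <= 0 by rewrite /sqrt_speed pmulr_lle0// ltW.
  by rewrite mulr_le0_ge0// mulr_ge0_le0.
by rewrite ler_sqrt ?lerD2r//; apply: ltW; exact: hpos.
Qed.

(** The variance of [w] between the two characteristics, times their distance; where [h t = 0] it is
    [e t], because [0^-1 = 0]. *)
Definition gap t := e t - p t ^+ 2 / h t.

Lemma gap_bounds t : a <= t <= b -> 0 <= gap t <= C.
Proof.
move=> tab; have /andP[e0 e1] := eC tab; have ht := h0 tab; have cs := CS tab.
have q0 : 0 <= p t ^+ 2 / h t by rewrite divr_ge0// sqr_ge0.
rewrite /gap; apply/andP; split; last by lra.
move: ht; rewrite le_eqVlt => /predU1P[<-|ht]; first by rewrite invr0 mulr0 subr0.
by rewrite subr_ge0 ler_pdivrMr// mulrC.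
Qed.

Lemma gap_integrable : mu.-integrable `[a, b] (EFin \o gap).
Proof.
apply: (@integrable_bounded _ _ _ _ C); last first.
  by move=> t /gap_bounds/andP[h1 h2]; rewrite ger0_norm.
apply: measurable_funB; first exact: em.
apply: measurable_funM; first by apply: measurable_funX; exact: measurable_cont_itv.
apply: measurable_fun_inv => //; apply: measurable_cont_itv => t tab.
exact: is_derive_cont (hd tab).
Qed.

Let V := \int[mu]_(t in `[a, b]) gap t.

Let V0 : 0 <= V.
Proof. by apply: Rintegral_ge0 => t; rewrite /= in_itv/= => /gap_bounds/andP[]. Qed.

Let speed_gain k : 0 < k -> (forall t, a <= t <= b -> k ^+ 2 <= h t) ->
  0 <= sqrt_speed 0 b - sqrt_speed 0 a <= V / (2 * k).
Proof.
move=> k0 hk.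
have hpos r : a <= r <= b -> 0 < h r + 0.
  by move=> /hk; rewrite addr0; apply: lt_le_trans; rewrite exprn_gt0.
rewrite subr_ge0 sqrt_speed_nd//=.
have [i1 ->] := sqrt_speed_incr (lexx a) ab (lexx b) hpos.
rewrite mulrC -RintegralZl//; last exact: gap_integrable.
apply: le_Rintegral => //; first by apply: integrable_scale => //; exact: gap_integrable.
move=> t; rewrite /= in_itv/= => tab; rewrite addr0 -/(gap t) mulrC.
have /andP[v0 _] := gap_bounds tab; rewrite ler_wpM2r//.
rewrite lef_pV2 ?posrE ?mulr_gt0//; last first.
  by rewrite sqrtr_gt0; move: (hpos t tab); rewrite addr0.
rewrite ler_pM2l//.
have <- : Num.sqrt (k ^+ 2) = k by rewrite sqrtr_sqr gtr0_norm.
rewrite ler_sqrt; first exact: hk.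
by move: (hpos t tab); rewrite addr0 => /ltW.
Qed.

Let speed_sqr t : 0 < h t -> sqrt_speed 0 t ^+ 2 = p t ^+ 2 / h t.
Proof. by move=> ht; rewrite /sqrt_speed addr0 expr_div_n sqr_sqrtr// ltW. Qed.

Let speed_slope t : 0 < h t -> sqrt_speed 0 t = Num.sqrt (h t) * (p t / h t).
Proof.
move=> ht; have G := sqr_sqrtr (ltW ht); have k0 : 0 < Num.sqrt (h t) by rewrite sqrtr_gt0.
rewrite /sqrt_speed addr0; set k := Num.sqrt (h t) in G k0 *; rewrite -G; field.
by rewrite gt_eqF.
Qed.

(* [kappa ^+ 2] bounds [h b / h a] from below, by convexity of [Num.sqrt h]. *)
Lemma pair_lower kappa : a < b -> 0 < h a -> 0 < kappa <= 1 ->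
  kappa <= 1 + (b - a) / 2 * (p a / h a) ->
  p a ^+ 2 / h a <= e b + 2 / ((b - a) * kappa) * V.
Proof.
move=> altb ha /andP[k0 k1] hk.
have aab : a <= a <= b by rewrite lexx ab.
have bab : a <= b <= b by rewrite lexx ab.
have sa0 : 0 < Num.sqrt (h a) by rewrite sqrtr_gt0.
have slope t : a <= t <= b -> kappa <= 1 + (t - a) / 2 * (p a / h a).
  move=> /andP[at_ tb]; have [w0|w0] := leP 0 (p a / h a).
    by apply: le_trans k1 _; rewrite lerDl mulr_ge0// divr_ge0// subr_ge0.
  apply: le_trans hk _; by rewrite lerD2l ler_wnM2r ?(ltW w0)// ler_pM2r// lerD2r.
(* The convex function lies above its tangent line at [a]. Positivity of [h] after [a] is not known
   yet, so the bound is proved for [h + d n] and [d n] tends to [0]. *)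
have low t : a <= t <= b -> Num.sqrt (h a) * (1 + (t - a) / 2 * (p a / h a)) <= Num.sqrt (h t).
  move=> tab; have /andP[at_ tb] := tab; rewrite -subr_ge0.
  pose d n : R := n.+1%:R^-1.
  have d0 n : 0 < d n by rewrite invr_gt0.
  have sc s : (fun n => Num.sqrt (h s + d n)) @ \oo --> Num.sqrt (h s).
    have H : (fun n => h s + d n) @ \oo --> h s.
      by rewrite -[X in _ --> X]addr0; apply: cvgD; [exact: cvg_cst|exact: cvg_harmonic].
    exact: (cvg_comp _ _ H (@sqrt_continuous R (h s))).
  have E : Num.sqrt (h a) * (1 + (t - a) / 2 * (p a / h a)) =
      Num.sqrt (h a) + 2^-1 * (p a * (Num.sqrt (h a))^-1) * (t - a).
    have G := sqr_sqrtr (ltW ha).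
    by set k := Num.sqrt (h a) in G sa0 *; rewrite -G; field; rewrite gt_eqF.
  rewrite E.
  apply: (@cvg_to_ge0 _ _ \oo _ (fun n => g (d n) t - (g (d n) a +
      2^-1 * (p a * (g (d n) a)^-1) * (t - a)))).
    apply: cvgB; first exact: sc.
    apply: cvgD; first exact: sc.
    apply: cvgMl; apply: cvgMr; apply: cvgMr; apply: cvgV; [by rewrite gt_eqF|exact: sc].
  apply: nearW => n; rewrite subr_ge0 -lerBrDl.
  have hpos r : a <= r <= b -> 0 < h r + d n by move=> /h0 hr; rewrite ltr_wpDl.
  by have /andP[] := sqrt_height_bounds (ltW (d0 n)) hpos (lexx a) at_ tb.
have hk2 t : a <= t <= b -> (kappa * Num.sqrt (h a)) ^+ 2 <= h t.
  move=> tab; have l1 := low t tab; have l2 := slope t tab.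
  have l3 : kappa * Num.sqrt (h a) <= Num.sqrt (h t).
    by apply: le_trans l1; rewrite mulrC ler_pM2l.
  rewrite -[leRHS](sqr_sqrtr (h0 tab)) ler_sqr// ?nnegrE ?sqrtr_ge0//.
  by rewrite mulr_ge0// ltW.
have ksa : 0 < kappa * Num.sqrt (h a) by rewrite mulr_gt0.
have hb : 0 < h b by apply: lt_le_trans (hk2 b bab); rewrite exprn_gt0.
have /andP[D0 DV] := speed_gain ksa hk2.
have rb : sqrt_speed 0 b ^+ 2 <= e b.
  by rewrite speed_sqr// ler_pdivrMr// mulrC; exact: CS.
rewrite -speed_sqr//.
set ra := sqrt_speed 0 a in D0 DV *; set rb' := sqrt_speed 0 b in D0 DV rb *.
have ba : 0 < b - a by rewrite subr_gt0.
have cV : 0 <= 2 / ((b - a) * kappa) * V by rewrite mulr_ge0// divr_ge0// mulr_ge0// ltW.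
have [ra0|ra0] := leP 0 ra.
  by have : ra ^+ 2 <= rb' ^+ 2; [rewrite ler_sqr ?nnegrE//; lra|lra].
(* Positivity of [kappa] forces the slope [p a / h a] above [- 2 / (b - a)]. *)
have nra : - ra <= 2 * Num.sqrt (h a) / (b - a).
  rewrite /ra speed_slope// -mulrN ler_pdivlMr//.
  have : - (p a / h a) * (b - a) <= 2 by move: hk k0; set w := p a / h a; lra.
  by move: sa0; set sa := Num.sqrt (h a); set w := p a / h a => h1 h2; nra.
have h1 : (rb' - ra) * - ra <= V / (2 * (kappa * Num.sqrt (h a))) * (2 * Num.sqrt (h a) / (b - a)).
  by apply: ler_pM => //; lra.
have h2 : V / (2 * (kappa * Num.sqrt (h a))) * (2 * Num.sqrt (h a) / (b - a)) =
    V / ((b - a) * kappa).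
  by field; rewrite !gt_eqF.
have h3 : 2 / ((b - a) * kappa) * V = 2 * (V / ((b - a) * kappa)) by ring.
(* Uses [ra ^+ 2 - rb' ^+ 2 <= 2 * (rb' - ra) * - ra], the difference of the two sides being
   [(rb' - ra) ^+ 2]. *)
move: h1; rewrite h2 h3; set W := V / _; nra.
Qed.

(** By Gronwall the one-sided bound gives [h t >= kappa ^+ 2 * h b] on all of [[a, b]], which
    controls the growth of [sqrt_speed 0] by [V]. If the slope at [a] is at or below
    [- 2 / (b - a)], the tangent line of [Num.sqrt h] reaches zero by time [b], and all of [h b] is
    due to that growth. *)
Lemma pair_upper M : a < b -> 0 < h b -> 0 <= M -> (forall t, a <= t <= b -> p t <= M * h t) ->
  let kappa := expR (- M * (b - a) / 2) in
  [/\ 0 < h a, p b ^+ 2 / h b <= p a ^+ 2 / h a + M / kappa * V &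
    - (2 / (b - a)) < p a / h a \/ h b <= (b - a) / (4 * kappa) * V].
Proof.
move=> altb hb M0 pM kappa.
have k0 : 0 < kappa by exact: expR_gt0.
have aab : a <= a <= b by rewrite lexx ab.
have bab : a <= b <= b by rewrite lexx ab.
have ba : 0 < b - a by rewrite subr_gt0.
have sb0 : 0 < Num.sqrt (h b) by rewrite sqrtr_gt0.
have hk t : a <= t <= b -> (kappa * Num.sqrt (h b)) ^+ 2 <= h t.
  move=> tab; have /andP[at_ tb] := tab.
  (* Nonincreasing, since its derivative is [p - M * h] times a positive factor. *)
  pose z s := h s * expR (- M * s).
  have zd s : a <= s <= b -> is_derive s 1 z ((p s - M * h s) * expR (- M * s)).
    move=> sab; have hds := hd sab.
    have e1 : is_derive s 1 (fun s => - M * s) (- M).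
      have := @is_deriveZ R R^o R^o (fun s => s) (- M) s 1 1 (is_derive_id _ _).
      by rewrite /GRing.scale/= mulr1.
    have e2 := @is_derive1_comp R expR (fun s => - M * s) s _ _ (is_derive_expR _) e1.
    have := is_deriveM hds e2.
    rewrite (_ : _ *: _ + _ *: _ = (p s - M * h s) * expR (- M * s))//.
    by rewrite /GRing.scale/=; ring.
  have [|c [/andP[tc cb] zc]] := @mvt_closed R z (fun s => (p s - M * h s) * expR (- M * s)) t b tb.
    by move=> s /andP[h1 h2]; apply: zd; rewrite (le_trans at_).
  have : z b <= z t.
    rewrite -subr_le0 zc; apply: mulr_le0_ge0; last by rewrite subr_ge0.
    apply: mulr_le0_ge0; last exact: expR_ge0.
    by rewrite subr_le0; apply: pM; rewrite (le_trans at_).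
  have -> : z b = h b * expR (- M * (b - t)) * expR (- M * t).
    by rewrite /z -mulrA -expRD; congr (_ * expR _); ring.
  rewrite ler_pM2r ?expR_gt0// => hbt; apply: le_trans hbt.
  rewrite exprMn sqr_sqrtr ?(ltW hb)// mulrC ler_wpM2l ?(ltW hb)//.
  rewrite expr2 /kappa -expRD ler_expR -splitr ler_wnM2l ?oppr_le0//; lra.
have ksb : 0 < kappa * Num.sqrt (h b) by rewrite mulr_gt0.
have ha : 0 < h a by apply: lt_le_trans (hk a aab); rewrite exprn_gt0.
have /andP[D0 DV] := speed_gain ksb hk.
have hpos r : a <= r <= b -> 0 < h r + 0.
  by move=> /hk; rewrite addr0; apply: lt_le_trans; rewrite exprn_gt0.
split => //.
- rewrite -!speed_sqr//.
  have rbM : sqrt_speed 0 b <= M * Num.sqrt (h b).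
    rewrite /sqrt_speed addr0 ler_pdivrMr// -mulrA -expr2 sqr_sqrtr ?(ltW hb)//.
    exact: pM.
  set ra := sqrt_speed 0 a in D0 DV *; set rb := sqrt_speed 0 b in D0 DV rbM *.
  have Ms : 0 <= M * Num.sqrt (h b) by rewrite mulr_ge0// ltW.
  have h1 : (rb - ra) * (M * Num.sqrt (h b)) <=
      V / (2 * (kappa * Num.sqrt (h b))) * (M * Num.sqrt (h b)).
    by rewrite ler_wpM2r.
  have h2 : V / (2 * (kappa * Num.sqrt (h b))) * (M * Num.sqrt (h b)) = 2^-1 * (M / kappa * V).
    by field; rewrite !gt_eqF.
  move: h1; rewrite h2; set W := M / kappa * V; set m := M * _ in Ms rbM * => h1.
  nra.
- have [hs|hs] := ltP (- (2 / (b - a))) (p a / h a); first by left.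
  right; have /andP[_ gb] := sqrt_height_bounds (lexx 0) hpos (lexx a) ab (lexx b).
  move: gb; rewrite !addr0 => gb.
  (* The tangent line at [a] is at most [0] at time [b]; with [gb] this leaves for [Num.sqrt (h b)]
     only the gain of [sqrt_speed 0]. *)
  have ra : 2^-1 * sqrt_speed 0 a * (b - a) <= - Num.sqrt (h a).
    rewrite speed_slope//; have sa0 : 0 < Num.sqrt (h a) by rewrite sqrtr_gt0.
    have : (p a / h a) * (b - a) <= - 2 by rewrite -ler_pdivlMr// mulNr.
    by move: sa0; set sa := Num.sqrt (h a); set w := p a / h a => h1 h2; nra.
  have h1 : Num.sqrt (h b) <= 2^-1 * (b - a) * (sqrt_speed 0 b - sqrt_speed 0 a) by lra.
  have h2 : Num.sqrt (h b) <= 2^-1 * (b - a) * (V / (2 * (kappa * Num.sqrt (h b)))).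
    by apply: (le_trans h1); rewrite ler_wpM2l// mulr_ge0// ltW.
  have h3 : 2^-1 * (b - a) * (V / (2 * (kappa * Num.sqrt (h b)))) =
      (b - a) / (4 * kappa) * V / Num.sqrt (h b) by field; rewrite !gt_eqF.
  move: h2; rewrite h3 ler_pdivlMr// -expr2 sqr_sqrtr//; exact: ltW.
Qed.

End PairODE.

(** * The equation along characteristics *)

Section Smooth.
Context {R : realType}.
Implicit Types (f g : R -> R) (x c k l y : R).

Fixpoint smoothn (n : nat) f : Prop :=
  if n is n'.+1 then (forall x, derivable f x 1) /\ smoothn n' (derive1 f) else True.

Definition smooth f := forall n, smoothn n f.

Lemma is_derive1_derive f x c : is_derive x 1 f c -> (derive1 f) x = c.
Proof. by move=> [_ <-]; rewrite derive1E. Qed.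

Lemma derivable_is_derive f x : derivable f x 1 -> is_derive x 1 f ((derive1 f) x).
Proof. by move=> fd; rewrite derive1E; split. Qed.

Lemma smoothnS n f g : (forall x, is_derive x 1 f (g x)) -> smoothn n g -> smoothn n.+1 f.
Proof.
move=> fg sg; have E : (derive1 f) = g by apply/funext => x; exact: is_derive1_derive.
by split; [move=> x; case: (fg x)|rewrite E].
Qed.

Lemma smoothn_pred n f : smoothn n.+1 f -> smoothn n f.
Proof. by elim: n f => [//|n IH] f [fd /IH]. Qed.

Lemma smooth_is_derive f x : smooth f -> is_derive x 1 f ((derive1 f) x).
Proof. by move=> sf; apply: derivable_is_derive; have [] := sf 1%N. Qed.

Lemma smooth_derive f : smooth f -> smooth (derive1 f).
Proof. by move=> sf n; have [] := sf n.+1. Qed.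

Lemma smooth_cont f : smooth f -> continuous f.
Proof. by move=> sf x; exact: is_derive_cont (smooth_is_derive x sf). Qed.

Lemma is_derive_add f g x a b : is_derive x 1 f a -> is_derive x 1 g b ->
  is_derive x 1 (fun y => f y + g y) (a + b).
Proof. by move=> fa gb; exact: is_deriveD. Qed.

Lemma is_derive_mul f g x a b : is_derive x 1 f a -> is_derive x 1 g b ->
  is_derive x 1 (fun y => f y * g y) (a * g x + f x * b).
Proof.
move=> fa gb; have := is_deriveM fa gb.
by rewrite /GRing.scale/= addrC [g x * _]mulrC.
Qed.

Lemma is_derive_scale c f x a : is_derive x 1 f a -> is_derive x 1 (fun y => c * f y) (c * a).
Proof.
move=> fa; have := is_derive_mul (is_derive_cst c x 1) fa.
by rewrite mul0r add0r.
Qed.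

Lemma smoothn_add n f g : smoothn n f -> smoothn n g -> smoothn n (fun x => f x + g x).
Proof.
elim: n f g => [//|n IH] f g [fd sf] [gd sg].
apply: (@smoothnS _ _ (fun x => (derive1 f) x + (derive1 g) x)); last exact: IH.
by move=> x; apply: is_derive_add; exact: derivable_is_derive.
Qed.

Lemma smoothn_scale n c f : smoothn n f -> smoothn n (fun x => c * f x).
Proof.
elim: n f => [//|n IH] f [fd sf].
apply: (@smoothnS _ _ (fun x => c * (derive1 f) x)); last exact: IH.
by move=> x; apply: is_derive_scale; exact: derivable_is_derive.
Qed.

Lemma smoothn_mul n f g : smoothn n f -> smoothn n g -> smoothn n (fun x => f x * g x).
Proof.
elim: n f g => [//|n IH] f g sf sg; have [fd sf'] := sf; have [gd sg'] := sg.
apply: (smoothnS (g := fun x => derive1 f x * g x + f x * derive1 g x)).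
  by move=> x; apply: is_derive_mul; exact: derivable_is_derive.
by apply: smoothn_add; apply: IH => //; exact: smoothn_pred.
Qed.

Lemma is_derive_affine f x c k a : is_derive (c * x + k) 1 f a ->
  is_derive x 1 (fun y => f (c * y + k)) (c * a).
Proof.
move=> fa; rewrite mulrC; apply: (@is_derive1_comp R f (fun y => c * y + k)) => //.
have := is_derive_add (is_derive_scale c (is_derive_id x 1)) (is_derive_cst k x 1).
by rewrite mulr1 addr0.
Qed.

Lemma smoothn_affine n f c k : smoothn n f -> smoothn n (fun x => f (c * x + k)).
Proof.
elim: n f => [//|n IH] f [fd sf].
apply: (@smoothnS _ _ (fun x => c * (derive1 f) (c * x + k))).
  by move=> x; apply: is_derive_affine; exact: derivable_is_derive.
by apply: smoothn_scale; exact: (IH (derive1 f)).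
Qed.

(* The derivative of [flat n] is a combination of [flat n.+2] and [flat n.+1], so all are smooth. *)
Definition flat (n : nat) x : R := if 0 < x then x^-1 ^+ n * expR (- x^-1) else 0.

(** From [expR y >= (y / N) ^+ N] at [y = x^-1], with [N = n.+2] to leave a factor [x ^+ 2]; a
    quadratic bound makes the derivative at [0] vanish. *)
Lemma flat_le n x : `|flat n x| <= n.+2%:R ^+ n.+2 * x ^+ 2.
Proof.
rewrite /flat; case: ifPn => [x0|_]; last first.
  by rewrite normr0; apply: mulr_ge0; [exact: exprn_ge0|exact: sqr_ge0].
have y0 : 0 < x^-1 by rewrite invr_gt0.
have N0 : (0 : R) < n.+2%:R by [].
rewrite ger0_norm; last by rewrite mulr_ge0 ?expR_ge0// exprn_ge0// ltW.
have h1 : (x^-1 / n.+2%:R) ^+ n.+2 <= expR x^-1.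
  have -> : expR x^-1 = expR (x^-1 / n.+2%:R) ^+ n.+2.
    by rewrite -expRM_natl -mulr_natl mulrC divfK// gt_eqF.
  rewrite ler_pXn2r ?nnegrE ?expR_ge0// ?divr_ge0 ?(ltW y0)//.
  by apply: le_trans (expR_ge1Dx _); rewrite lerDr.
have e0 := expR_gt0 x^-1.
rewrite expRN ler_pdivrMr//.
have h2 : n.+2%:R ^+ n.+2 * x ^+ 2 * (x^-1 / n.+2%:R) ^+ n.+2 = x^-1 ^+ n.
  rewrite expr_div_n [x^-1 ^+ n.+2]exprS [x^-1 ^+ n.+1]exprS; field.
  by rewrite ?gt_eqF// expf_eq0 gt_eqF.
rewrite -{1}h2 ler_pM2l//.
by rewrite mulr_gt0// exprn_gt0.
Qed.

Lemma flat_le0 n x : x <= 0 -> flat n x = 0.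
Proof. by move=> x0; rewrite /flat ltNge x0. Qed.

Lemma flat_gt0 n x : 0 < x -> flat n x = x^-1 ^+ n * expR (- x^-1).
Proof. by move=> x0; rewrite /flat x0. Qed.

Lemma flat_derive n x : is_derive x 1 (flat n) (flat n.+2 x + (- n%:R) * flat n.+1 x).
Proof.
have [x0|x0|x0] := ltgtP x 0.
- rewrite (flat_le0 n.+1 (ltW x0)) (flat_le0 n.+2 (ltW x0)) mulr0 addr0; apply/is_derive_epsP => e e0.
  exists (- x); first by rewrite oppr_gt0.
  move=> y; rewrite ltr_norml => /andP[_ yx].
  rewrite (flat_le0 n (ltW x0)) flat_le0; last by lra.
  by rewrite mul0r subrr subr0 normr0 mulr_ge0// ltW.
- have xV : is_derive x 1 (fun y => y^-1) (- (x^-1 ^+ 2)).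
    have xn0 : x != 0 by rewrite gt_eqF.
    have := @is_deriveV R id x 1 1 xn0 (is_derive_id x 1).
    by rewrite /GRing.scale/= mulr1 exprVn.
  have xP : is_derive x 1 (fun y => y^-1 ^+ n) (- n%:R * x^-1 ^+ n.+1).
    elim: n => [|m IH].
      by rewrite oppr0 mul0r; exact: is_derive_cst.
    have := is_derive_mul xV IH.
    rewrite (_ : _ + _ = - m.+1%:R * x^-1 ^+ m.+2).
      by under eq_fun do rewrite -exprS.
    by rewrite -natr1 !exprS; ring.
  have xE : is_derive x 1 (fun y => expR (- y^-1)) (expR (- x^-1) * x^-1 ^+ 2).
    apply: (@is_derive1_comp R expR (fun y => - y^-1)).
    by have := is_derive_scale (-1) xV; rewrite mulrN mulN1r opprK; under eq_fun do rewrite mulN1r.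
  have /is_derive_epsP H := is_derive_mul xP xE.
  apply/is_derive_epsP => e e0; have [r r0 Hr] := H e e0.
  exists (Num.min r x); first by rewrite lt_min r0 x0.
  move=> y; rewrite lt_min => /andP[yr]; rewrite ltr_norml => /andP[yx _].
  have y0 : 0 < y by lra.
  have := Hr y yr; rewrite !flat_gt0//.
  rewrite (_ : - n%:R * x^-1 ^+ n.+1 * expR (- x^-1) + x^-1 ^+ n * (expR (- x^-1) * x^-1 ^+ 2) =
    x^-1 ^+ n.+2 * expR (- x^-1) + - n%:R * (x^-1 ^+ n.+1 * expR (- x^-1)))//.
  by rewrite !exprS; ring.
- rewrite x0 (flat_le0 n.+1 (lexx 0)) (flat_le0 n.+2 (lexx 0)) mulr0 addr0; apply/is_derive_epsP => e e0.
  have N0 : (0 : R) < n.+2%:R ^+ n.+2 by rewrite exprn_gt0.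
  exists (e / n.+2%:R ^+ n.+2); first exact: divr_gt0.
  move=> y; rewrite subr0 ltr_pdivlMr// => ye; rewrite (flat_le0 n (lexx 0)) mul0r !subr0.
  apply: le_trans (flat_le n y) _.
  rewrite -[y ^+ 2]real_normK ?num_real// expr2 mulrA ler_wpM2r// mulrC; exact: ltW.
Qed.

Lemma smooth_flat n : smooth (flat n).
Proof.
move=> k; elim: k n => [//|k IH] n.
apply: (smoothnS (flat_derive n)); apply: smoothn_add; first exact: IH.
by apply: smoothn_scale; exact: IH.
Qed.

Definition bump x := flat 0 x * flat 0 (1 - x).

Lemma smooth_bump : smooth bump.
Proof.
move=> n; apply: smoothn_mul; first exact: smooth_flat.
have -> : (fun x => flat 0 (1 - x)) = fun x => flat 0 (- 1 * x + 1).
  by apply/funext => x; rewrite mulN1r addrC.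
exact: smoothn_affine (smooth_flat 0 n).
Qed.

Lemma flat0_ge0 x : 0 <= flat 0 x.
Proof. by rewrite /flat; case: ifP => // _; rewrite mul1r expR_ge0. Qed.

Lemma bump_ge0 x : 0 <= bump x. Proof. by rewrite mulr_ge0// flat0_ge0. Qed.

Lemma bump_out x : x <= 0 \/ 1 <= x -> bump x = 0.
Proof.
rewrite /bump /flat => -[x0|x1].
  by rewrite ltNge x0/= mul0r.
by rewrite subr_gt0 [x < 1]ltNge x1/= mulr0.
Qed.

Lemma bump_low x : 1 / 4 <= x <= 3 / 4 -> expR (- 8) <= bump x.
Proof.
move=> /andP[h1 h2]; rewrite /bump /flat !expr0 !mul1r subr_gt0.
have x0 : 0 < x by lra. have x1 : x < 1 by lra.
rewrite x0 x1 -expRD ler_expR.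
have : x^-1 <= 4 by rewrite -[4]invrK lef_pV2 ?posrE//; lra.
have : (1 - x)^-1 <= 4 by rewrite -[4]invrK lef_pV2 ?posrE//; lra.
lra.
Qed.

Lemma derive_out f a b x : (forall z, z < a \/ b < z -> f z = 0) -> x < a \/ b < x ->
  is_derive x 1 f ((derive1 f) x) -> (derive1 f) x = 0.
Proof.
move=> f0 xab fd; apply: (is_derive_unique fd).
apply/is_derive_epsP => e e0; case: xab => h.
- exists (a - x); first by rewrite subr_gt0.
  move=> y; rewrite ltr_norml => /andP[_ yx]; rewrite !f0; [|by left|by left; lra].
  by rewrite mul0r !subrr normr0 mulr_ge0// ltW.
- exists (x - b); first by rewrite subr_gt0.
  move=> y; rewrite ltr_norml => /andP[yx _]; rewrite !f0; [|by right|by right; lra].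
  by rewrite mul0r !subrr normr0 mulr_ge0// ltW.
Qed.

Lemma smooth_out f a b x : smooth f -> (forall z, z < a \/ b < z -> f z = 0) ->
  x < a \/ b < x -> (derive1 f) x = 0.
Proof. by move=> sf f0 h; apply: derive_out h _ => //; exact: smooth_is_derive. Qed.

Lemma smooth_bounded f a b : smooth f -> (forall z, z < a \/ b < z -> f z = 0) ->
  exists M, 0 <= M /\ forall x, `|f x| <= M.
Proof.
move=> sf f0; have [M [M0 HM]] := @bounded_cont_itv R f a b (fun t _ => smooth_cont sf (x := t)).
exists M; split => // x; have [h|h] := boolP (a <= x <= b); first exact: HM.
rewrite f0 ?normr0//; move: h; rewrite negb_and -!ltNge => /orP[]; [by left|by right].
Qed.

(** Every iterated partial derivative of a product of a function of [x] and a function of [t] is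
    again such a product of smooth functions. *)
Lemma smooth_test_fun f g a b : smooth f -> smooth g ->
  (forall z, z < a \/ b < z -> f z = 0) -> (forall z, z < a \/ b < z -> g z = 0) ->
  test_fun (fun x t => f x * g t).
Proof.
move=> sf sg f0 g0.
have key (l : seq bool) : exists f' g', [/\ smooth f', smooth g' & pdiff l (fun x t => f x * g t) = fun x t => f' x * g' t].
  elim: l => [|d l [f' [g' [sf' sg' E]]]]; first by exists f, g.
  rewrite /= E; case: d.
    exists (derive1 f'), g'; split => //; first exact: smooth_derive.
    apply/funext => x; apply/funext => t; apply: is_derive1_derive.
    have := is_derive_mul (smooth_is_derive x sf') (is_derive_cst (g' t) x 1).
    by rewrite mulr0 addr0.
  exists f', (derive1 g'); split => //; first exact: smooth_derive.
  apply/funext => x; apply/funext => t; apply: is_derive1_derive.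
  exact: is_derive_scale (smooth_is_derive t sg').
split; [|split].
- move=> l' x t; have [f' [g' [sf' sg' ->]]] := key l'; split.
    by have [] := is_derive_mul (smooth_is_derive x sf') (is_derive_cst (g' t) x 1).
  by have [] := is_derive_scale (f' x) (smooth_is_derive t sg').
- move=> l'; have [f' [g' [sf' sg' ->]]] := key l' => p.
  apply: cvgM.
    by apply: (@cvg_comp _ _ _ fst f' _ (nbhs p.1)); [exact: cvg_fst|exact: smooth_cont].
  by apply: (@cvg_comp _ _ _ snd g' _ (nbhs p.2)); [exact: cvg_snd|exact: smooth_cont].
- exists (Num.max `|a| `|b|) => x t.
  have out z : Num.max `|a| `|b| < `|z| -> z < a \/ b < z.
    rewrite gt_max => /andP[h1 h2]; have [z0|z0] := leP 0 z.
      by right; move: h2; rewrite (ger0_norm z0); exact: le_lt_trans (ler_norm b).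
    left; move: h1; rewrite (ltr0_norm z0) ltrNr => h1.
    by apply: lt_le_trans h1 _; rewrite lerNl -normrN; exact: ler_norm.
  by case=> /out h; [rewrite f0// mul0r|rewrite g0// mulr0].
Qed.

End Smooth.

(** * The source term: continuity in space, measurability in time *)

Section Source.
Context {R : realType}.
Local Notation mu := (@lebesgue_measure R).
Implicit Types (u w : R -> R -> R) (f g : R -> R) (a b c d s t x y z l : R).

Lemma Rintegral_supp f (D : set R) a b : measurable D -> `[a, b]%classic `<=` D ->
  (forall x, ~ (a <= x <= b) -> f x = 0) ->
  \int[mu]_(x in D) f x = \int[mu]_(x in `[a, b]) f x.
Proof.
move=> mD abD f0; rewrite Rintegral_mkcond [RHS]Rintegral_mkcond; apply: eq_Rintegral => x _.
rewrite !patchE; have [xab|xab] := boolP (a <= x <= b).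
  have xI : `[a, b]%classic x by rewrite /= in_itv.
  by rewrite (mem_set xI) (mem_set (abD _ xI)).
have -> : f x = 0 by apply: f0; exact/negP.
by case: ifP; case: ifP.
Qed.

(** Left end point sums, by uniform continuity. They show that the space integral of a function
    continuous in space and measurable in time is measurable in time. *)
Lemma riemann_sum_cvg g a b : a <= b -> continuous g ->
  \sum_(k < n.+1) g (a + (b - a) / n.+1%:R * k%:R) * ((b - a) / n.+1%:R) @[n --> \oo] -->
  \int[mu]_(x in `[a, b]) g x.
Proof.
move=> ab gc; apply/cvgrPdist_le => e e0.
have k0 : 0 < b - a + 1 by rewrite ltr_wpDl// subr_ge0.
have e1 : 0 < e / (b - a + 1) by exact: divr_gt0.
have gc2 : continuous (fun p : R * R => g p.1).
  by move=> p; apply: (@cvg_comp _ _ _ fst g _ (nbhs p.1)); [exact: cvg_fst|exact: gc].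
have [d d0 Hd] := @unif_cont_rectangle R (fun x _ => g x) a b 0 0 gc2 _ e1.
have hcv : (b - a) * n.+1%:R^-1 @[n --> \oo] --> (0 : R).
  by rewrite -[X in _ --> X](mulr0 (b - a)); apply: cvgMr; exact: cvg_harmonic.
have gi c1 d1 : mu.-integrable `[c1, d1] (EFin \o g).
  have [M [_ HM]] := @bounded_cont_itv R g c1 d1 (fun t _ => gc t).
  by apply: integrable_bounded HM; apply: measurable_cont_itv => t _; exact: gc.
move/cvgrPdist_lt : hcv => /(_ _ d0); apply: filterS => n; rewrite sub0r normrN.
set h := (b - a) / n.+1%:R; have h0 : 0 <= h by rewrite divr_ge0// subr_ge0.
rewrite ger0_norm// => hd.
have nh : h * n.+1%:R = b - a by rewrite /h divfK.
have cell p q : p <= q -> q - p < d -> a <= p <= b ->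
    `|\int[mu]_(x in `[p, q]) g x - g p * (q - p)| <= e / (b - a + 1) * (q - p).
  move=> pq qpd pab; rewrite -Rintegral_cst_itv// -RintegralB//; last exact: integrable_cst_itv.
  apply: normr_Rintegral_le => //.
    by apply: integrable_sub => //; exact: integrable_cst_itv.
  move=> x /andP[x1 x2]; rewrite distrC; apply: (Hd _ 0 _ 0) => //.
  - by rewrite lexx.
  - by rewrite distrC ger0_norm; lra.
  - by rewrite subrr normr0.
have step (m : nat) : (m <= n.+1)%N ->
    `|\int[mu]_(x in `[a, a + h * m%:R]) g x - \sum_(k < m) g (a + h * k%:R) * h| <=
     e / (b - a + 1) * (h * m%:R).
  elim: m => [_|m IH mn].
    by rewrite mulr0 addr0 Rintegral_point big_ord0 subrr normr0 mulr0.
  have {}IH := IH (ltnW mn).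
  have m0 : 0 <= h * m%:R by rewrite mulr_ge0.
  have E1 : h * m.+1%:R = h * m%:R + h by rewrite -natr1 mulrDr mulr1.
  rewrite E1 (@Rintegral_split _ _ a (a + h * m%:R) (a + (h * m%:R + h)))//; last 2 first.
  - by rewrite lerDl.
  - by rewrite lerD2l lerDl.
  rewrite big_ord_recr/= mulrDr.
  have {}cell : `|\int[mu]_(x in `[a + h * m%:R, a + (h * m%:R + h)]) g x - g (a + h * m%:R) * h|
      <= e / (b - a + 1) * h.
    have := cell (a + h * m%:R) (a + (h * m%:R + h)).
    have -> : a + (h * m%:R + h) - (a + h * m%:R) = h by ring.
    apply => //; first by rewrite lerD2l lerDl.
    rewrite lerDl m0/=; have : h * m%:R <= h * n.+1%:R by rewrite ler_wpM2l// ler_nat ltnW.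
    by rewrite nh; lra.
  apply: le_trans (lerD IH cell); apply: le_trans (ler_normD _ _).
  by rewrite le_eqVlt opprD addrACA eqxx.
have := step n.+1 (leqnn _); rewrite nh subrKC => /le_trans; apply.
by rewrite -mulrA ler_piMr ?(ltW e0)// mulrC ler_pdivrMr// mul1r; lra.
Qed.

Lemma Rintegral_indic f (D : set R) : \int[mu]_(x in D) f x = \int[mu]_x (\1_D x * f x).
Proof.
rewrite Rintegral_mkcond; apply: eq_Rintegral => x _.
by rewrite patchE indicE; case: (_ \in _); rewrite ?mul1r ?mul0r.
Qed.

Lemma cvg_ray f x : mu.-integrable setT (EFin \o f) ->
  \int[mu]_(y in `[x - n%:R, x]) f y @[n --> \oo] --> \int[mu]_(y in `]-oo, x]) f y.
Proof.
move=> fi; have mf := integrable_measurable fi.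
under eq_fun do rewrite Rintegral_indic.
rewrite Rintegral_indic.
apply: (@Rintegral_dominated _ _ _ _ (fun y => `|f y|)) => //.
- by move=> n; apply: measurable_funM => //; apply: measurable_indic; exact: measurable_itv.
- by apply: measurable_funM => //; apply: measurable_indic; exact: measurable_itv.
- exact: (integrable_norm fi).
- apply: aeW => y _; apply: cvg_near_cst.
  exists (Num.bound (x - y)) => // n /= hn; rewrite !indicE; congr ((nat_of_bool _)%:R * _).
  apply/idP/idP => /set_mem/=; rewrite in_itv/= => yx; apply/mem_set; rewrite /= in_itv/=.
    by case/andP: yx.
  have xy : 0 <= x - y by rewrite subr_ge0.
  have := archi_boundP xy; have : (Num.bound (x - y))%:R <= n%:R :> R by rewrite ler_nat.
  by rewrite yx andbT; lra.
- move=> n y _; rewrite normrM ler_piMl// indicE; case: (_ \in _); rewrite ?normr1 ?normr0//.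
Qed.

Section OneTime.
Variables (C : R) (f g : R -> R).
Hypothesis fg : finite_energy C f g.

(** A point carries no energy. The lopsided window contains [[y, y + n.+1%:R^-1]] whenever [y] is
    within [n.+1%:R^-1] of [x]: it covers a bump that lags slightly behind the characteristic. *)
Lemma sqint_shrink x : sqint g (x - n.+1%:R^-1) (x + 2 * n.+1%:R^-1) @[n --> \oo] --> 0.
Proof.
under eq_fun do rewrite /sqint Rintegral_indic.
have <- : \int[mu]_y (\1_[set x] y * g y ^+ 2) = 0.
  by rewrite -(Rintegral_indic (fun y => g y ^+ 2)) Rintegral_set1.
have i2 := finite_energy_sqr_integrableT fg.
have mg2 := integrable_measurable i2.
apply: (Rintegral_dominated _ _ _ i2) => //.
- by move=> n; apply: measurable_funM => //; apply: measurable_indic; exact: measurable_itv.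
- by apply: measurable_funM => //; apply: measurable_indic; exact: measurable_set1.
- apply: aeW => y _; have [->|yx] := eqVneq y x.
    rewrite (_ : (fun n => _) = fun n => \1_[set x] x * g x ^+ 2); first exact: cvg_cst.
    apply/funext => n; rewrite !indicE !mem_set//= in_itv/=.
    have : 0 < n.+1%:R^-1 :> R by rewrite invr_gt0.
    by move: (n.+1%:R^-1) => q q0; apply/andP; split; lra.
  rewrite indicE memNset ?mul0r; last by move=> /= h; move: yx; rewrite h eqxx.
  have d0 : 0 < `|y - x| / 2 by rewrite divr_gt0// normr_gt0 subr_eq0.
  have H : n.+1%:R^-1 @[n --> \oo] --> (0 : R) by exact: cvg_harmonic.
  apply: cvg_near_cst.
  move/cvgrPdist_lt : H => /(_ _ d0); apply: filterS => n; rewrite sub0r normrN ger0_norm// => h.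
  rewrite indicE memNset ?mul0r//= in_itv/= => /andP[h1 h2].
  have n0 : 0 < n.+1%:R^-1 :> R by rewrite invr_gt0.
  move: h h1 h2 n0; move: (n.+1%:R^-1) => q h h1 h2 q0; move: d0 h.
  by have [xy|xy] := leP 0 (y - x); [rewrite ger0_norm//; lra|rewrite ltr0_norm//; lra].
- move=> n y _; rewrite ger0_norm; last by rewrite mulr_ge0// sqr_ge0.
  by rewrite ler_piMl ?sqr_ge0// indicE; case: (_ \in _).
Qed.

Lemma sqint_ray x : sqint g (x - n%:R) x @[n --> \oo] --> \int[mu]_(y in `]-oo, x]) g y ^+ 2.
Proof. exact: (@cvg_ray (fun y => g y ^+ 2) x (finite_energy_sqr_integrableT fg)). Qed.

Lemma ray_split a b : a <= b -> \int[mu]_(y in `]-oo, b]) g y ^+ 2 =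
  \int[mu]_(y in `]-oo, a]) g y ^+ 2 + sqint g a b.
Proof.
move=> ab; have i2 D mD := @finite_energy_sqr_integrable _ _ _ _ fg D mD.
rewrite /sqint -(@Rintegral_itv_obnd_cbnd _ a (BRight b)); last by apply: i2.
by rewrite -(@Rintegral_itvB _ (fun y => g y ^+ 2) -oo%O (BRight b) a)//; [ring|apply: i2].
Qed.

End OneTime.

Section FlowSource.
Variables (C : R) (u w : R -> R -> R).
Hypothesis uw : finite_energy_flow C u w.

Lemma HS_source_diff a b t : a <= b ->
  HS_source w b t - HS_source w a t = 2^-1 * sqint (w ^~ t) a b.
Proof. by move=> ab; rewrite /HS_source (ray_split (uw.2 t) ab); ring. Qed.

Lemma HS_source_bounds x t : 0 <= HS_source w x t <= C.
Proof.
have h1 := sqr_Rintegral_ge0 `]-oo, x] (w ^~ t).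
have h2 := finite_energy_Rintegral_le (uw.2 t) (measurable_itv `]-oo, x]).
by rewrite /HS_source; apply/andP; split; lra.
Qed.

Lemma HS_source_cont t : continuous (HS_source w ^~ t).
Proof.
move=> x; apply/cvgrPdist_le => e e0.
have /cvgrPdist_lt/(_ _ e0)[N _ HN] := sqint_shrink (uw.2 t) x.
have {HN} := HN N (leqnn N); rewrite sub0r normrN ger0_norm ?sqint_ge0// => HN.
have N0 : 0 < N.+1%:R^-1 :> R by rewrite invr_gt0.
exists N.+1%:R^-1 => // y /=; rewrite ltr_norml => /andP[h1 h2].
set q := N.+1%:R^-1 in N0 HN h1 h2.
have mono a b c d : a <= b -> b <= c -> c <= d -> sqint (w^~ t) b c <= sqint (w^~ t) a d.
  move=> ab bc cd; rewrite (sqint_split (uw.2 t) ab (le_trans bc cd)) (sqint_split (uw.2 t) bc cd).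
  by have := sqint_ge0 (w^~ t) a b; have := sqint_ge0 (w^~ t) c d; lra.
have [xy|yx] := leP x y.
  rewrite distrC HS_source_diff// ger0_norm ?mulr_ge0 ?sqint_ge0//.
  have := mono (x - q) x y (x + 2 * q); have := sqint_ge0 (w^~ t) x y.
  by move=> H0 H; have {}H := H ltac:(lra) xy ltac:(lra); lra.
rewrite HS_source_diff ?(ltW yx)// ger0_norm ?mulr_ge0 ?sqint_ge0//.
have := mono (x - q) y x (x + 2 * q); have := sqint_ge0 (w^~ t) y x.
by move=> H0 H; have {}H := H ltac:(lra) (ltW yx) ltac:(lra); lra.
Qed.

Lemma measurable_HS_source (X : R -> R) a b : (forall t, a <= t <= b -> {for t, continuous X}) ->
  measurable_fun `[a, b] (fun t => HS_source w (X t) t).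
Proof.
move=> Xc; apply: measurable_funM => //.
apply: (@measurable_fun_cvg _ _ _ _ (fun n t => sqint (w ^~ t) (X t - n%:R) (X t))) => [n|t _].
  apply: (measurable_sqint uw) => //.
    by move=> t tab; apply: cvgB; [exact: Xc|exact: cvg_cst].
  by move=> t _; rewrite gerBl.
exact: sqint_ray (uw.2 t) _.
Qed.

End FlowSource.
End Source.

(** * Rescaled bumps as test functions in space and in time *)

Section BumpMass.
Context {R : realType}.
Local Notation mu := (@lebesgue_measure R).
Implicit Types (f df n v : R -> R) (a b e c d s t x y z l : R).

Lemma mvt_between f df x y : (forall t, is_derive t 1 f (df t)) ->
  exists c, `|c - x| <= `|y - x| /\ f y - f x = df c * (y - x).
Proof.
move=> fd; have [xy|/ltW yx] := leP x y.
  have [c [/andP[h1 h2] E]] := mvt_closed xy (fun t _ => fd t).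
  by exists c; split => //; rewrite !ger0_norm; lra.
have [c [/andP[h1 h2] E]] := mvt_closed yx (fun t _ => fd t).
exists c; split; last by rewrite -opprB E; ring.
by rewrite distrC [leRHS]distrC !ger0_norm; lra.
Qed.

Lemma smooth_taylor f a b : smooth f -> (forall z, z < a \/ b < z -> f z = 0) ->
  exists M, 0 <= M /\ forall x y, `|f y - f x - derive1 f x * (y - x)| <= M * (y - x) ^+ 2.
Proof.
move=> sf f0; have sf1 := smooth_derive sf.
have [M [M0 HM]] := smooth_bounded (smooth_derive sf1)
  (fun z hz => smooth_out sf1 (fun z' hz' => smooth_out sf f0 hz') hz).
exists M; split => // x y.
have [c [cx ->]] := mvt_between x y (fun t => smooth_is_derive t sf).
have [c' [_ E]] := mvt_between x c (fun t => smooth_is_derive t sf1).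
rewrite -mulrBl E !normrM -(real_normK (num_real (y - x))) expr2 mulrA.
by rewrite ler_wpM2r// ler_pM.
Qed.

Lemma continuous_integrable f a b : continuous f -> mu.-integrable `[a, b] (EFin \o f).
Proof.
move=> fc; have [M [_ HM]] := @bounded_cont_itv R f a b (fun t _ => fc t).
by apply: integrable_bounded HM; apply: measurable_cont_itv => t _; exact: fc.
Qed.

Lemma Rintegral_derive_primitive f x c : continuous f -> c < x ->
  is_derive x 1 (fun y => \int[mu]_(z in `[c, y]) f z) (f x).
Proof.
move=> fc cx; have fi p q := @continuous_integrable f p q fc.
have small y z (r : R) : y <= z -> (forall s, y <= s <= z -> `|f s - f x| <= r) ->
    `|\int[mu]_(s in `[y, z]) f s - f x * (z - y)| <= r * (z - y).
  move=> yz H; rewrite -Rintegral_cst_itv// -RintegralB//; last exact: integrable_cst_itv.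
  by apply: normr_Rintegral_le => //; apply: integrable_sub => //; exact: integrable_cst_itv.
apply/is_derive_epsP => e e0.
have /cvgrPdist_lt/(_ _ e0)[r /= r0 Hr] := fc x.
exists (Num.min r (x - c)); first by rewrite lt_min r0 subr_gt0.
move=> y; rewrite lt_min => /andP[yr yc].
have near s : `|s - x| <= `|y - x| -> `|f s - f x| <= e.
  by move=> h; rewrite distrC; apply/ltW/Hr; rewrite /= distrC; apply: le_lt_trans h yr.
have cy : c < y by move: yc; rewrite ltr_norml => /andP[h _]; lra.
have [xy|/ltW yx] := leP x y.
  rewrite (@Rintegral_split _ f c x y)// ?(ltW cx)//.
  set A := (X in X + _ - X); set B := (X in A + X - A).
  rewrite (_ : A + B - A = B); last by ring.
  rewrite [X in e * X]ger0_norm ?subr_ge0//; apply: small => // s /andP[h1 h2].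
  by apply: near; rewrite !ger0_norm; lra.
rewrite (@Rintegral_split _ f c y x)// ?(ltW cy)//.
set A := (X in X - (X + _)); set B := (X in A - (A + X)).
rewrite (_ : A - (A + B) - f x * (y - x) = - (B - f x * (x - y))); last by ring.
rewrite normrN [`|y - x|]distrC [X in _ <= e * X]ger0_norm ?subr_ge0//; apply: small => // s /andP[h1 h2].
by apply: near; rewrite distrC [leRHS]distrC !ger0_norm; lra.
Qed.

Definition bump_mass : R := \int[mu]_(z in `[0, 1]) bump z.

Lemma bump_mass_gt0 : 0 < bump_mass.
Proof.
have bi p q : mu.-integrable `[p, q] (EFin \o @bump R).
  by apply: continuous_integrable; exact: smooth_cont (@smooth_bump R).
have bge p q : 0 <= \int[mu]_(z in `[p, q]) bump z.
  by apply: Rintegral_ge0 => z _; exact: bump_ge0.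
rewrite /bump_mass (@Rintegral_split _ _ 0 (1 / 4) 1)//; try lra.
rewrite (@Rintegral_split _ _ (1 / 4) (3 / 4) 1)//; try lra.
have h1 := bge 0 (1 / 4); have h2 := bge (3 / 4) 1.
apply: ltr_wpDl => //; apply: ltr_pwDl => //.
apply: (@lt_le_trans _ _ (expR (- 8) * (3 / 4 - 1 / 4))).
  by rewrite mulr_gt0 ?expR_gt0//; lra.
rewrite -Rintegral_cst_itv; last by lra.
apply: le_Rintegral => //; first exact: integrable_cst_itv.
by move=> z /=; rewrite in_itv/=; exact: bump_low.
Qed.

(** Lives on [[x, x + l^-1]], to the right of [x], with height independent of [l] and mass
    [l^-1 * bump_mass]. Used in time, it vanishes at the initial time whenever [0 <= x]. *)
Definition bump_at l x z := bump (l * z - l * x).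

Lemma smooth_bump_at l x : smooth (bump_at l x).
Proof. by move=> n; exact: smoothn_affine (@smooth_bump R n). Qed.

Lemma bump_at_derive l x z : is_derive z 1 (bump_at l x) (l * derive1 bump (l * z - l * x)).
Proof. by apply: is_derive_affine; exact: smooth_is_derive (@smooth_bump R). Qed.

Lemma bump_at_derive1 l x : derive1 (bump_at l x) = fun z => l * derive1 bump (l * z - l * x).
Proof. by apply/funext => z; apply: is_derive1_derive; exact: bump_at_derive. Qed.

Lemma bump_at_out l x z : 0 < l -> z < x \/ x + l^-1 < z -> bump_at l x z = 0.
Proof.
move=> l0 h; apply: bump_out; rewrite -mulrBr.
case: h => h; [left|right].
  by rewrite pmulr_rle0// subr_le0 ltW.
by rewrite -(divff (lt0r_neq0 l0)) ler_pM2l// lerBrDl ltW.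
Qed.

Lemma bump_at_mass l x : 0 < l -> \int[mu]_(z in `[x, x + l^-1]) bump_at l x z = l^-1 * bump_mass.
Proof.
move=> l0; have bc : continuous (@bump R) by exact: smooth_cont (@smooth_bump R).
have ln : l != 0 by rewrite gt_eqF.
pose B y := \int[mu]_(z in `[-1, y]) @bump R z.
have V0 : 0 < l^-1 by rewrite invr_gt0.
have <- : l^-1 * B (l * (x + l^-1) - l * x) - l^-1 * B (l * x - l * x) = l^-1 * bump_mass.
  rewrite (_ : l * (x + l^-1) - l * x = 1); last by rewrite mulrDr divff// addrAC subrr add0r.
  rewrite -mulrBr subrr /B.
  rewrite (@Rintegral_split _ _ (-1) 0 1) ?lerN10 ?ler01//; last exact: continuous_integrable.
  by rewrite /bump_mass; congr (_ * _); ring.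
apply: (@C1_FTC _ (fun z => l^-1 * B (l * z - l * x))).
- by rewrite lerDl ltW.
- move=> z /andP[h1 _].
  have -> : bump_at l x z = l^-1 * (l * bump (l * z - l * x)) by rewrite mulKf.
  apply: is_derive_scale; apply: is_derive_affine; apply: Rintegral_derive_primitive => //.
  rewrite -mulrBr; apply: (@lt_le_trans _ _ 0); first by rewrite ltrN10.
  by rewrite mulr_ge0 ?(ltW l0)// subr_ge0.
- by move=> z _; exact: smooth_cont (smooth_bump_at l x) _.
Qed.

Lemma bump_at_average v l y e : 0 < l -> continuous v ->
  (forall z, y <= z <= y + l^-1 -> `|v z - v y| <= e) ->
  `|\int[mu]_(z in `[y, y + l^-1]) (v z * bump_at l y z) - v y * (l^-1 * bump_mass)| <=
    e * (l^-1 * bump_mass).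
Proof.
move=> l0 vc ve; rewrite -(bump_at_mass y l0).
have bc : continuous (bump_at l y) by exact: smooth_cont (smooth_bump_at l y).
have i1 : mu.-integrable `[y, y + l^-1] (EFin \o (bump_at l y)) by exact: continuous_integrable.
have i2 : mu.-integrable `[y, y + l^-1] (EFin \o (fun z => v z * bump_at l y z)).
  by apply: continuous_integrable => z; apply: cvgM; [exact: vc|exact: bc].
rewrite -RintegralZl// -RintegralB//; last exact: integrable_scale.
rewrite -RintegralZl//; apply: le_trans (le_normr_Rintegral _ _) _ => //.
  by apply: integrable_sub => //; exact: integrable_scale.
apply: le_Rintegral => //; [|exact: integrable_scale|].
  apply: continuous_integrable => z; apply: cvg_norm; apply: cvgB; apply: cvgM;
    by [exact: vc|exact: bc|exact: cvg_cst].
move=> z /=; rewrite in_itv/= => zy; rewrite -mulrBl normrM.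
by rewrite (ger0_norm (bump_ge0 _)) ler_wpM2r ?bump_ge0// ve.
Qed.

Lemma bump_at_derive_mass l x : 0 < l ->
  \int[mu]_(z in `[x, x + l^-1]) (l * derive1 bump (l * z - l * x)) = 0.
Proof.
move=> l0; have V0 : 0 < l^-1 by rewrite invr_gt0.
have ln : l != 0 by rewrite gt_eqF.
have <- : bump_at l x (x + l^-1) - bump_at l x x = 0.
  by rewrite /bump_at mulrDr divff// addrAC subrr add0r !bump_out ?subrr//; [left|right].
apply: C1_FTC.
- by rewrite lerDl ltW.
- by move=> z _; exact: bump_at_derive.
- move=> z _; have := smooth_cont (smooth_derive (smooth_bump_at l x)) (x := z).
  by rewrite bump_at_derive1.
Qed.

(** Taylor expansion in the position of the bump; [M] depends on [l] but not on the three points,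
    since the second derivative of [bump] is bounded. *)
Lemma bump_at_shift l : 0 < l -> exists M, 0 <= M /\ forall x y z,
  `|bump_at l y z - bump_at l x z + (y - x) * (l * derive1 bump (l * z - l * x))| <= M * (y - x) ^+ 2.
Proof.
move=> l0; have out (z : R) : z < 0 \/ 1 < z -> bump z = 0.
  by case=> h; apply: bump_out; [left|right]; exact: ltW.
have [M [M0 HM]] := smooth_taylor (@smooth_bump R) out.
exists (M * l ^+ 2); split => [|x y z]; first by rewrite mulr_ge0// sqr_ge0.
have := HM (l * z - l * x) (l * z - l * y).
rewrite (_ : l * z - l * y - (l * z - l * x) = - (l * (y - x))); last by ring.
rewrite /bump_at sqrrN exprMn mulrN opprK -[M * l ^+ 2 * _]mulrA; move: (derive1 _ _ : R) => D.
by rewrite (_ : (y - x) * (l * D) = D * (l * (y - x)))//; ring.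
Qed.

(** Translating a bump changes its average of [n], to first order, by the average against the
    derivative of the bump, which is zero. Averages over all translates of one bump thus agree, and
    they tend to point values as the bump shrinks. *)
Lemma du_bois_reymond n : (forall t, 0 <= t -> {for t, continuous n}) ->
  (forall l s, 0 < l -> 0 <= s ->
     \int[mu]_(t in `[s, s + l^-1]) (n t * (l * derive1 bump (l * t - l * s))) = 0) ->
  forall s t, 0 <= s -> s <= t -> n s = n t.
Proof.
move=> nc n0 s t s0 st.
(* Continuous on the whole line, and equal to [n] at the nonnegative times. *)
pose m r := n (Num.max 0 r).
have mn r : 0 <= r -> m r = n r by move=> r0; rewrite /m; congr n; apply/max_idPr.
have mc : continuous m.
  move=> r; apply: continuous_comp; last by apply: nc; rewrite le_max lexx.
  by apply: cont_max; [exact: cvg_cst|exact: cvg_id].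
have mean l : 0 < l -> \int[mu]_(r in `[s, s + l^-1]) (m r * bump_at l s r) =
    \int[mu]_(r in `[t, t + l^-1]) (m r * bump_at l t r).
  move=> l0; have V0 : 0 < l^-1 by rewrite invr_gt0.
  have [M [M0 HM]] := bump_at_shift l0.
  have [Bm [Bm0 HB]] := @bounded_cont_itv R m 0 (t + l^-1) (fun r _ => mc r).
  have ci f g : continuous f -> continuous g -> mu.-integrable `[0, t + l^-1] (EFin \o (fun r => f r * g r)).
    by move=> fc gc; apply: continuous_integrable => r; apply: cvgM; [exact: fc|exact: gc].
  have bc y : continuous (bump_at l y) by exact: smooth_cont (smooth_bump_at l y).
  have dc y : continuous (fun r => l * derive1 bump (l * r - l * y)).
    by rewrite -bump_at_derive1; exact: smooth_cont (smooth_derive (smooth_bump_at l y)).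
  have ext y : 0 <= y -> y <= t -> \int[mu]_(r in `[y, y + l^-1]) (m r * bump_at l y r) =
      \int[mu]_(r in `[0, t + l^-1]) (m r * bump_at l y r).
    move=> y0 yt; rewrite (@Rintegral_supp _ _ `[0, t + l^-1] y (y + l^-1))//.
      by move=> r; rewrite /= !in_itv/= => /andP[h1 h2]; apply/andP; split; lra.
    move=> r /negP; rewrite negb_and -!ltNge => h; rewrite bump_at_out ?mulr0//; exact/orP.
  have extd y : 0 <= y -> y <= t -> \int[mu]_(r in `[0, t + l^-1]) (m r * (l * derive1 bump (l * r - l * y))) = 0.
    move=> y0 yt; rewrite (@Rintegral_supp _ _ `[0, t + l^-1] y (y + l^-1))//.
    - rewrite -[RHS](n0 l y l0 y0); apply: eq_Rintegral => r /set_mem/=; rewrite in_itv/= => /andP[h1 h2].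
      by rewrite mn// (le_trans y0).
    - by move=> r; rewrite /= !in_itv/= => /andP[h1 h2]; apply/andP; split; lra.
    - move=> r /negP; rewrite negb_and -!ltNge => /orP h.
      have := smooth_out (smooth_bump_at l y) (fun z => @bump_at_out l y z l0) h.
      by rewrite bump_at_derive1 => ->; rewrite mulr0.
  rewrite (ext s s0 st) (ext t (le_trans s0 st) (lexx t)).
  apply/esym; apply: (@const_of_small_increments R (fun y => \int[mu]_(r in `[0, t + l^-1]) (m r * bump_at l y r)) s t st).
  move=> e e0; pose K := Bm * M * (t + l^-1).
  have K0 : 0 <= K by rewrite !mulr_ge0//; lra.
  exists (e / (K + 1)); first by rewrite divr_gt0//; lra.
  move=> p q sp pq qt; rewrite ltr_pdivlMr; last by lra.
  move=> pqe.
  have -> : \int[mu]_(r in `[0, t + l^-1]) (m r * bump_at l q r) -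
     \int[mu]_(r in `[0, t + l^-1]) (m r * bump_at l p r) =
     \int[mu]_(r in `[0, t + l^-1]) (m r * (bump_at l q r - bump_at l p r +
          (q - p) * (l * derive1 bump (l * r - l * p)))).
    transitivity (\int[mu]_(r in `[0, t + l^-1]) (m r * bump_at l q r) -
     \int[mu]_(r in `[0, t + l^-1]) (m r * bump_at l p r) +
      (q - p) * \int[mu]_(r in `[0, t + l^-1]) (m r * (l * derive1 bump (l * r - l * p)))).
      by rewrite extd ?mulr0 ?addr0//; [exact: le_trans sp|exact: le_trans qt].
    rewrite -RintegralB//; [|exact: ci..].
    rewrite -RintegralZl//; last exact: ci.
    rewrite -RintegralD//; [|by apply: integrable_sub => //; exact: ci|by apply: integrable_scale => //; exact: ci].
    by apply: eq_Rintegral => r _; ring.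
  apply: le_trans (@normr_Rintegral_le _ _ _ _ (Bm * (M * (q - p) ^+ 2)) _ _ _) _.
  - by lra.
  - rewrite (_ : (fun r => _) = fun r => m r * bump_at l q r - m r * bump_at l p r +
          (q - p) * (m r * (l * derive1 bump (l * r - l * p)))); last by apply/funext => r; ring.
    apply: integrable_add => //; first by apply: integrable_sub => //; exact: ci.
    by apply: integrable_scale => //; exact: ci.
  - move=> r h; rewrite normrM; apply: ler_pM => //; exact: HB.
  - have -> : Bm * (M * (q - p) ^+ 2) * (t + l^-1 - 0) = (K * (q - p)) * (q - p) by rewrite /K; ring.
    by rewrite ler_wpM2r ?subr_ge0//; nra.
apply/eqP; rewrite -subr_eq0 -normr_le0; apply/ler_addgt0Pr => e e0; rewrite add0r.
have e2 : 0 < e / 2 by rewrite divr_gt0.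
have /cvgrPdist_lt/(_ _ e2)[d1 /= d10 H1] := mc s.
have /cvgrPdist_lt/(_ _ e2)[d2 /= d20 H2] := mc t.
pose d := Num.min d1 d2 / 2.
have d0 : 0 < d by rewrite divr_gt0// lt_min d10.
have [dd1 dd2] : d < d1 /\ d < d2.
  have : 0 < Num.min d1 d2 by rewrite lt_min d10.
  have : Num.min d1 d2 <= d1 by rewrite ge_min lexx.
  have : Num.min d1 d2 <= d2 by rewrite ge_min lexx orbT.
  by rewrite /d; move: (Num.min d1 d2) => q q1 q2 q0; split; lra.
have l0 : 0 < d^-1 by rewrite invr_gt0.
have close y d' : d < d' -> (forall r, `|y - r| < d' -> `|m y - m r| < e / 2) ->
   `|\int[mu]_(r in `[y, y + d]) (m r * bump_at d^-1 y r) - m y * (d * bump_mass)| <= e / 2 * (d * bump_mass).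
  move=> dd' H; have := @bump_at_average m d^-1 y (e / 2) l0 mc; rewrite invrK; apply.
  move=> z /andP[z1 z2]; rewrite distrC; apply/ltW/H.
  by rewrite distrC ger0_norm; lra.
have K0 : 0 < d * bump_mass by rewrite mulr_gt0// bump_mass_gt0.
have := close s d1 dd1 H1; have := close t d2 dd2 H2.
have := mean d^-1 l0; rewrite invrK => ->; rewrite !mn//; last exact: le_trans st.
set I := \int[mu]_(_ in _) _ => h1 h2.
rewrite -(ler_pM2r K0) -{1}(ger0_norm (ltW K0)) -normrM.
have -> : (n s - n t) * (d * bump_mass) = (I - n t * (d * bump_mass)) - (I - n s * (d * bump_mass)) by ring.
by apply: le_trans (ler_normB _ _) _; lra.
Qed.

End BumpMass.

(** * The equation integrated against a fixed weight in space *)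

Section TestedEquation.
Context {R : realType}.
Local Notation mu := (@lebesgue_measure R).
Implicit Types (u w : R -> R -> R) (f g al : R -> R) (a b c d s t x y z l : R).

Lemma rectangle_bounded u a b c d : continuous (fun p : R * R => u p.1 p.2) ->
  exists M, 0 <= M /\ forall x t, a <= x <= b -> c <= t <= d -> `|u x t| <= M.
Proof.
move=> uc.
have cK : compact (`[a, b]%classic `*` `[c, d]%classic) by apply: compact_setX; exact: segment_compact.
have /compact_bounded[M0 [_ HM]] := continuous_compact (continuous_subspaceT uc) cK.
exists (Num.max 0 (M0 + 1)); split; first by rewrite le_max lexx.
move=> x t xab tcd; apply: (HM (Num.max 0 (M0 + 1))); first by rewrite lt_max ltrDl ltr01 orbT.
by exists (x, t) => //=; split; rewrite /= in_itv.
Qed.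

Lemma cont_sqr f t : {for t, continuous f} -> {for t, continuous (fun s => f s ^+ 2)}.
Proof. by move=> fc; exact: (cvgM fc fc). Qed.

(** For test functions that vanish at time [0] the initial term disappears from the weak
    formulation; the initial values are then reached through continuity in time. *)
Definition source_identity u w := forall phi, test_fun phi -> (forall x, phi x 0 = 0) ->
  \int[mu]_(t in `[0, +oo[)
    (\int[mu]_x (u x t * dt phi x t + 2^-1 * u x t ^+ 2 * dx phi x t + HS_source w x t * phi x t)) = 0.

Variables (C : R) (u w : R -> R -> R).
Hypothesis uw : finite_energy_flow C u w.

Lemma flow_cont_space t : continuous (u ^~ t).
Proof.
move=> x; apply: (@continuous_comp _ _ _ (fun s => (s, t)) (fun p => u p.1 p.2)); last exact: uw.1.
exact: (cvg_pair cvg_id (cvg_cst t)).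
Qed.

Section OneWeight.
Variables (al : R -> R) (a b : R).
Hypotheses (ab : a <= b) (sal : smooth al).
Hypothesis al0 : forall z, z < a \/ b < z -> al z = 0.

(** Its space integral is the rate of change in time of the average of [u] with weight [al]. *)
Definition tested_flux r x := 2^-1 * u x r ^+ 2 * derive1 al x + HS_source w x r * al x.

Lemma tested_flux_cont r : continuous (tested_flux r).
Proof.
move=> x; apply: cvgD; apply: cvgM.
- by apply: cvgM; [exact: cvg_cst|apply: cont_sqr; exact: flow_cont_space].
- exact: smooth_cont (smooth_derive sal) x.
- exact: (HS_source_cont uw).
- exact: smooth_cont sal x.
Qed.

Lemma measurable_tested_flux c d :
  measurable_fun `[c, d] (fun r => \int[mu]_(x in `[a, b]) tested_flux r x).
Proof.
apply: (@measurable_fun_cvg _ _ _ _ (fun n r =>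
   \sum_(k < n.+1) tested_flux r (a + (b - a) / n.+1%:R * k%:R) * ((b - a) / n.+1%:R))) => [n|r _]; last first.
  by apply: riemann_sum_cvg => //; exact: tested_flux_cont.
apply: measurable_sum => k; apply: measurable_funM => //; apply: measurable_funD.
  apply: measurable_cont_itv => t _; apply: cvgM; last exact: cvg_cst.
  apply: cvgM; first exact: cvg_cst.
  by apply: cont_sqr; apply: (cont2_comp uw.1 (x := fun=> _)); exact: cvg_cst.
apply: measurable_funM => //.
by apply: (measurable_HS_source uw (X := fun=> _)) => t _; exact: cvg_cst.
Qed.

Lemma tested_flux_bounded c d : exists M, 0 <= M /\
  forall r, c <= r <= d -> `|\int[mu]_(x in `[a, b]) tested_flux r x| <= M.
Proof.
have [Mu [Mu0 HMu]] := rectangle_bounded a b c d uw.1.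
have [M1 [M10 HM1]] := smooth_bounded (smooth_derive sal) (fun z => smooth_out sal al0 (x := z)).
have [M2 [M20 HM2]] := smooth_bounded sal al0.
have C0 := finite_energy_ge0 (uw.2 0).
exists ((2^-1 * Mu ^+ 2 * M1 + C * M2) * (b - a)); split.
  by rewrite mulr_ge0 ?subr_ge0// addr_ge0 ?mulr_ge0// sqr_ge0.
move=> r rcd; apply: normr_Rintegral_le => //.
  by apply: continuous_integrable; exact: tested_flux_cont.
move=> x xab; apply: le_trans (ler_normD _ _) _; apply: lerD; rewrite normrM; apply: ler_pM => //.
  rewrite normrM ger0_norm// ler_pM2l// normrX; apply: lerXn2r; rewrite ?nnegrE//; exact: HMu.
by have /andP[h1 h2] := HS_source_bounds uw x r; rewrite ger0_norm.
Qed.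

Lemma mollified_cont t : {for t, continuous (fun r => \int[mu]_(x in `[a, b]) (u x r * al x))}.
Proof.
have [M [M0 HM]] := smooth_bounded sal al0.
apply/cvgrPdist_le => e e0.
pose K := M * (b - a) + 1.
have K0 : 0 < K by rewrite ltr_wpDl// mulr_ge0// subr_ge0.
have ek : 0 < e / K by exact: divr_gt0.
have [r r0 Hr] := @unif_cont_rectangle R u a b t t uw.1 _ ek.
exists r => // s /= ts.
have ci q : mu.-integrable `[a, b] (EFin \o (fun x => u x q * al x)).
  by apply: continuous_integrable => x; apply: cvgM; [exact: flow_cont_space|exact: smooth_cont sal x].
rewrite -RintegralB//; apply: le_trans (@normr_Rintegral_le _ _ a b (e / K * M) ab _ _) _.
- exact: integrable_sub.
- move=> x xab; rewrite -mulrBl normrM; apply: ler_pM => //.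
  by apply: Hr => //; rewrite ?lexx// subrr normr0.
- have -> : e / K * M * (b - a) = (e * (M * (b - a))) / K by ring.
  by rewrite ler_pdivrMr// ler_wpM2l ?(ltW e0)// lerDl ler01.
Qed.

Hypothesis weak : source_identity u w.

(** Testing with [al x * be t], for bumps [be] in time, shows that the average of [u] minus the
    primitive of the tested flux has zero distributional derivative; both are continuous, so
    [du_bois_reymond] applies. *)
Lemma mollified_increment s t : 0 <= s -> s <= t ->
  \int[mu]_(x in `[a, b]) (u x t * al x) - \int[mu]_(x in `[a, b]) (u x s * al x) =
  \int[mu]_(r in `[s, t]) \int[mu]_(x in `[a, b]) tested_flux r x.
Proof.
move=> s0 st.
pose m r := \int[mu]_(x in `[a, b]) (u x r * al x).
pose D r := \int[mu]_(x in `[a, b]) tested_flux r x.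
(* The base point [-1] makes time [0] interior, where two-sided continuity of [P] is needed. *)
pose P r := \int[mu]_(q in `[-1, r]) D q.
have Di c d : mu.-integrable `[c, d] (EFin \o D).
  have [M [_ HM]] := tested_flux_bounded c d.
  by apply: (@integrable_bounded R D c d M _ HM); exact: measurable_tested_flux.
have PD p q : -1 <= p -> p <= q -> P q - P p = \int[mu]_(r in `[p, q]) D r.
  move=> p1 pq; rewrite /P (@Rintegral_split _ _ (-1) p q)//; ring.
have Pc r : 0 <= r -> {for r, continuous P}.
  move=> r0; have [M [M0 HM]] := tested_flux_bounded (-1) (r + 1).
  have lip p q : -1 <= p -> p <= q -> q <= r + 1 -> `|P q - P p| <= M * (q - p).
    move=> p1 pq qr; rewrite PD//; apply: normr_Rintegral_le => // x /andP[h1 h2].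
    by apply: HM; rewrite (le_trans p1) ?(le_trans h2).
  apply/cvgrPdist_le => e e0.
  have M1 : 0 < M + 1 by lra.
  exists (Num.min 1 (e / (M + 1))); first by rewrite /= lt_min ltr01 divr_gt0.
  move=> q /=; rewrite lt_min => /andP[q1 q2].
  have q3 : M * `|r - q| <= e.
    apply: ltW; move: q2; rewrite ltr_pdivlMr// => q2; apply: le_lt_trans q2.
    rewrite mulrDr mulr1 mulrC; have := normr_ge0 (r - q); lra.
  move: q1; rewrite ltr_norml => /andP[h1 h2].
  have [rq|qr] := leP r q.
    rewrite distrC; apply: le_trans (lip _ _ _ rq _) _; [lra|lra|].
    by move: q3; rewrite distrC ger0_norm ?subr_ge0.
  apply: le_trans (lip _ _ _ (ltW qr) _) _; [lra|lra|].
  by move: q3; rewrite ger0_norm// subr_ge0 ltW.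
suff H : m s - P s = m t - P t.
  by rewrite -/(m t) -/(m s) -PD//; [move: H; lra|lra].
apply: (@du_bois_reymond R (fun r => m r - P r)) s0 st.
  by move=> r r0; apply: cvgB; [exact: mollified_cont|exact: Pc].
move=> l q l0 q0; have V0 : 0 < l^-1 by rewrite invr_gt0.
have qq : q <= q + l^-1 by rewrite lerDl ltW.
pose be := bump_at l q; pose dbe r := l * derive1 bump (l * r - l * q).
have dbeE : derive1 be = dbe by exact: bump_at_derive1.
have be0 z := @bump_at_out R l q z l0.
have dbe0 r : r < q \/ q + l^-1 < r -> dbe r = 0.
  by rewrite -dbeE; exact: smooth_out (smooth_bump_at l q) be0.
have sbe := @smooth_bump_at R l q.
have beq : be q = 0 by apply: bump_out; left; rewrite subrr.
have beq' : be (q + l^-1) = 0.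
  by apply: bump_out; right; rewrite mulrDr divff ?gt_eqF// addrAC subrr add0r.
have dbc : continuous dbe by rewrite -dbeE; exact: smooth_cont (smooth_derive sbe).
have bec : continuous be by exact: smooth_cont sbe.
have [M [M0 HM]] := tested_flux_bounded q (q + l^-1).
(* As [be] vanishes at both ends, this says that [D] is the distributional derivative of [P]. *)
have [||||||i1 E1] := @AC_integration_by_parts R P D be dbe q (q + l^-1) M qq.
- exact: measurable_tested_flux.
- exact: HM.
- by move=> r /andP[h _]; apply: Pc; exact: le_trans h.
- by move=> p r h1 h2 _; apply: PD => //; apply: le_trans h1; apply: le_trans q0; exact: lerN10.
- by move=> r _; exact: bump_at_derive.
- by move=> r _; exact: dbc.
pose phi x r := al x * be r.
have tphi : test_fun phi.
  apply: (@smooth_test_fun R al be (Num.min a q) (Num.max b (q + l^-1))) => // z h.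
    apply: al0; case: h; rewrite ?lt_min ?gt_max => /andP[h1 h2]; [by left|by right].
  apply: be0; case: h; rewrite ?lt_min ?gt_max => /andP[h1 h2]; [by left|by right].
have phi0 x : phi x 0 = 0.
  by rewrite /phi /be /bump_at bump_out ?mulr0//; left; rewrite sub0r oppr_le0 mulr_ge0// ltW.
have inner r : \int[mu]_x (u x r * dt phi x r + 2^-1 * u x r ^+ 2 * dx phi x r + HS_source w x r * phi x r)
   = dbe r * m r + be r * D r.
  have Edt x : dt phi x r = al x * dbe r.
    by apply: is_derive1_derive; apply: is_derive_scale; exact: bump_at_derive.
  have Edx x : dx phi x r = derive1 al x * be r.
    apply: is_derive1_derive.
    by have := is_derive_mul (smooth_is_derive x sal) (is_derive_cst (be r) x 1); rewrite mulr0 addr0.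
  rewrite (@Rintegral_supp R _ setT a b)//; last first.
    move=> x /negP; rewrite negb_and -!ltNge => /orP h.
    by rewrite Edt Edx /phi al0// (smooth_out sal al0 h) !(mul0r, mulr0, addr0).
  have ci1 : mu.-integrable `[a, b] (EFin \o (fun x => u x r * al x)).
    by apply: continuous_integrable => x; apply: cvgM; [exact: flow_cont_space|exact: smooth_cont sal x].
  have ci2 : mu.-integrable `[a, b] (EFin \o tested_flux r).
    by apply: continuous_integrable; exact: tested_flux_cont.
  rewrite /m /D -RintegralZl// -[X in _ + X]RintegralZl//.
  rewrite -RintegralD//; [|exact: integrable_scale..].
  by apply: eq_Rintegral => x _; rewrite Edt Edx /tested_flux /phi; ring.
have W : \int[mu]_(r in `[0, +oo[) (dbe r * m r + be r * D r) = 0.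
  by rewrite -[RHS](weak tphi phi0); apply: eq_Rintegral => r _; rewrite inner.
move: W.
rewrite (@Rintegral_supp R _ `[0, +oo[ q (q + l^-1))//; last 2 first.
- by move=> r; rewrite /= !in_itv/= andbT => /andP[h _]; exact: le_trans h.
- by move=> r /negP; rewrite negb_and -!ltNge => /orP h; rewrite (be0 r h : be r = 0) dbe0// !mul0r addr0.
move: E1; rewrite beq beq' !mulr0 subrr => E1 E2.
have mc : continuous m by exact: mollified_cont.
have ci3 : mu.-integrable `[q, q + l^-1] (EFin \o (fun r => dbe r * m r + be r * D r)).
  apply: integrable_add => //.
    by apply: continuous_integrable => r; apply: cvgM; [exact: dbc|exact: mc].
  have [B [_ HB]] := @bounded_cont_itv R be q (q + l^-1) (fun r _ => bec r).
  apply: (@integrable_mul_bounded _ _ _ _ B) => //.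
    by apply: measurable_cont_itv => r _; exact: bec.
transitivity (\int[mu]_(r in `[q, q + l^-1]) (dbe r * m r + be r * D r) -
     \int[mu]_(r in `[q, q + l^-1]) (D r * be r + P r * dbe r)).
  by rewrite -RintegralB//; apply: eq_Rintegral => r _; rewrite /dbe; ring.
by rewrite E2 -E1 subrr.
Qed.

End OneWeight.
End TestedEquation.

(** * Speed along a characteristic is the time integral of the source *)

Section CharacteristicLaw.
Context {R : realType}.
Local Notation mu := (@lebesgue_measure R).
Implicit Types (f g v : R -> R) (a b c d r s t x y z l : R).

Lemma seg_widen X L y z : - X <= y <= X -> 0 < L -> y <= z <= y + L -> - (X + 2 * L) <= z <= X + 2 * L.
Proof. by move=> /andP[? ?] ? /andP[? ?]; apply/andP; split; lra. Qed.

Variables (C : R) (u w : R -> R -> R).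
Hypothesis uw : finite_energy_flow C u w.

Lemma sqint_mono r a b c d : a <= b -> b <= c -> c <= d -> sqint (w ^~ r) b c <= sqint (w ^~ r) a d.
Proof.
move=> ab bc cd; rewrite (sqint_split (uw.2 r) ab (le_trans bc cd)) (sqint_split (uw.2 r) bc cd).
by have := sqint_ge0 (w ^~ r) a b; have := sqint_ge0 (w ^~ r) c d; lra.
Qed.

Lemma sqr_variation_le r a b y z : a <= y <= b -> a <= z <= b ->
  (u z r - u y r) ^+ 2 <= `|z - y| * sqint (w ^~ r) a b.
Proof.
move=> /andP[ay yb] /andP[az zb]; have [yz|/ltW zy] := leP y z.
  rewrite ger0_norm ?subr_ge0//; apply: le_trans (sqr_incr_le_sqint (uw.2 r) yz) _.
  by rewrite ler_wpM2l ?subr_ge0//; exact: sqint_mono.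
rewrite -sqrrN opprB distrC ger0_norm ?subr_ge0//.
apply: le_trans (sqr_incr_le_sqint (uw.2 r) zy) _.
by rewrite ler_wpM2l ?subr_ge0//; exact: sqint_mono.
Qed.

Lemma source_variation_le r a b y z : a <= y <= b -> a <= z <= b ->
  `|HS_source w z r - HS_source w y r| <= 2^-1 * sqint (w ^~ r) a b.
Proof.
move=> /andP[ay yb] /andP[az zb]; have [yz|/ltW zy] := leP y z.
  rewrite (HS_source_diff uw)// ger0_norm ?mulr_ge0 ?sqint_ge0//.
  by rewrite ler_wpM2l//; exact: sqint_mono.
rewrite distrC (HS_source_diff uw)// ger0_norm ?mulr_ge0 ?sqint_ge0//.
by rewrite ler_wpM2l//; exact: sqint_mono.
Qed.

(* The weight [l * derive1 bump] has mean zero, so the flux may be compared with its value on the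
   characteristic after completing the square [u^2/2 - u v = (u - v)^2/2 - v^2/2]. *)
Lemma bump_flux_error (B0 B1 Bu e1 l r x y : R) v : 0 < l -> 0 <= e1 ->
  (forall z, `|bump z| <= B0) -> (forall z, `|derive1 (@bump R) z| <= B1) ->
  continuous v -> (forall z, y <= z <= y + l^-1 -> `|u z r - v z| <= e1) ->
  `|u x r| <= Bu -> `|x - y| <= l^-1 ->
  `|\int[mu]_(z in `[y, y + l^-1]) tested_flux u w (bump_at l y) r z -
    u x r * (\int[mu]_(z in `[y, y + l^-1]) (v z * (l * derive1 bump (l * z - l * y)))) -
    l^-1 * bump_mass * HS_source w x r| <=
  (B0 + 2 * B1) / 2 * l^-1 * sqint (w ^~ r) (x - l^-1) (x + 2 * l^-1) + Bu * e1 * B1.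
Proof.
move=> l0 e10 HB0 HB1 vc uv ux xy.
have V0 : 0 < l^-1 by rewrite invr_gt0.
have ln : l != 0 by rewrite gt_eqF.
have B10 : 0 <= B1 by apply: le_trans (HB1 0).
have B00 : 0 <= B0 by apply: le_trans (HB0 0).
set L := l^-1 in V0 *; set E := sqint _ _ _.
have E0 : 0 <= E by exact: sqint_ge0.
pose al z := bump_at l y z; pose dal z := l * derive1 bump (l * z - l * y).
have dalE : derive1 (bump_at l y) = dal by exact: bump_at_derive1.
have alc : continuous al by exact: smooth_cont (smooth_bump_at l y).
have dalc : continuous dal.
  by rewrite -dalE; exact: smooth_cont (smooth_derive (smooth_bump_at l y)).
have ui : continuous (u ^~ r) by exact: (flow_cont_space uw).
have fi : mu.-integrable `[y, y + L] (EFin \o tested_flux u w (bump_at l y) r).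
  by apply: continuous_integrable; apply: (tested_flux_cont uw); exact: smooth_bump_at.
have vi : mu.-integrable `[y, y + L] (EFin \o (fun z => v z * dal z)).
  by apply: continuous_integrable => z; apply: cvgM; [exact: vc|exact: dalc].
have ali : mu.-integrable `[y, y + L] (EFin \o al) by exact: continuous_integrable.
have dali : mu.-integrable `[y, y + L] (EFin \o dal) by exact: continuous_integrable.
have mass : \int[mu]_(z in `[y, y + L]) al z = L * bump_mass by exact: bump_at_mass.
have dmass : \int[mu]_(z in `[y, y + L]) dal z = 0 by exact: bump_at_derive_mass.
pose G z := tested_flux u w (bump_at l y) r z - u x r * (v z * dal z)
  - HS_source w x r * al z + 2^-1 * u x r ^+ 2 * dal z.
have Gi : mu.-integrable `[y, y + L] (EFin \o G).
  apply: integrable_add => //; last exact: integrable_scale.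
  apply: integrable_sub => //; last exact: integrable_scale.
  by apply: integrable_sub => //; exact: integrable_scale.
have -> : \int[mu]_(z in `[y, y + L]) tested_flux u w (bump_at l y) r z -
    u x r * (\int[mu]_(z in `[y, y + L]) (v z * dal z)) -
    L * bump_mass * HS_source w x r = \int[mu]_(z in `[y, y + L]) G z.
  rewrite -mass mulrC.
  transitivity (\int[mu]_(z in `[y, y + L]) tested_flux u w (bump_at l y) r z -
    u x r * (\int[mu]_(z in `[y, y + L]) (v z * dal z)) -
    HS_source w x r * (\int[mu]_(z in `[y, y + L]) al z) +
    2^-1 * u x r ^+ 2 * (\int[mu]_(z in `[y, y + L]) dal z)).
    by rewrite dmass; ring.
  rewrite -RintegralZl// -[X in _ - X + _]RintegralZl// -[X in _ + X]RintegralZl//.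
  rewrite -RintegralB//; last exact: integrable_scale.
  rewrite -RintegralB//; last exact: integrable_scale.
    rewrite -RintegralD//; last exact: integrable_scale.
    by apply: integrable_sub => //; [apply: integrable_sub => //; exact: integrable_scale|exact: integrable_scale].
  by apply: integrable_sub => //; exact: integrable_scale.
have xyB : - L <= x - y <= L by rewrite -ler_norml.
have lL : l * L = 1 by rewrite divff.
apply: le_trans (@normr_Rintegral_le _ _ _ _ (E * B1 + Bu * e1 * (l * B1) + 2^-1 * E * B0) _ Gi _) _.
- by rewrite lerDl ltW.
- move=> z zy.
  have zI : x - L <= z <= x + 2 * L by move: zy xyB => /andP[z1 z2] /andP[y1 y2]; apply/andP; split; lra.
  have xI : x - L <= x <= x + 2 * L by apply/andP; split; lra.
  have -> : G z = 2^-1 * (u z r - u x r) ^+ 2 * dal z + u x r * (u z r - v z) * dal z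
     + (HS_source w z r - HS_source w x r) * al z.
    by rewrite /G /tested_flux dalE /al; field.
  have dalB : `|dal z| <= l * B1 by rewrite /dal normrM (gtr0_norm l0) ler_pM2l.
  apply: le_trans (ler_normD _ _) _; apply: lerD; first apply: le_trans (ler_normD _ _) _; first apply: lerD.
  + rewrite normrM normrM (ger0_norm (sqr_ge0 _)) ger0_norm//.
    have h : (u z r - u x r) ^+ 2 <= 2 * L * E.
      apply: le_trans (sqr_variation_le r xI zI) _; rewrite ler_wpM2r// ler_norml.
      by move: zy xyB => /andP[z1 z2] /andP[y1 y2]; apply/andP; split; lra.
    have -> : E * B1 = 2^-1 * (2 * L * E) * (l * B1).
      by transitivity ((l * L) * (E * B1)); [rewrite lL mul1r|field].
    by apply: ler_pM => //; [rewrite mulr_ge0// sqr_ge0|rewrite ler_wpM2l].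
  + by rewrite normrM; apply: ler_pM => //; rewrite normrM; apply: ler_pM => //; exact: uv.
  + by rewrite normrM; apply: ler_pM => //; [exact: source_variation_le|exact: HB0].
- rewrite (_ : _ * (y + L - y) = (B0 + 2 * B1) / 2 * L * E + Bu * e1 * B1 * (l * L)); last by field.
  by rewrite lL mulr1.
Qed.

Hypothesis weak : source_identity u w.

Section OneCharacteristic.
Variables (x : R -> R) (t0 t1 : R).
Hypotheses (t00 : 0 <= t0) (t01 : t0 <= t1).
Hypothesis xch : charac u t0 t1 x.

Definition bump_average l t := \int[mu]_(z in `[x t, x t + l^-1]) (u z t * bump_at l (x t) z).

(** Over a short time the bump is first kept at rest while [u] evolves, then shifted to its new
    position. The first-order effect of the shift cancels the transport part of the flux, leaving
    the source and the error of [bump_flux_error]. Since [k] does not depend on [l], this error is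
    negligible against the mass of the bump as soon as the energy in the window is small. *)
Lemma bump_charac_increment : exists2 k, 0 <= k & forall l, 0 < l ->
  `|bump_average l t1 - bump_average l t0 - l^-1 * bump_mass * \int[mu]_(r in `[t0, t1]) HS_source w (x r) r| <=
    k * l^-1 * \int[mu]_(r in `[t0, t1]) sqint (w ^~ r) (x r - l^-1) (x r + 2 * l^-1).
Proof.
have bout (z : R) : z < 0 \/ 1 < z -> bump z = 0.
  by case=> h; apply: bump_out; [left|right]; exact: ltW.
have sb := @smooth_bump R.
have [B0 [B00 HB0]] := smooth_bounded sb bout.
have [B1 [B10 HB1]] := smooth_bounded (smooth_derive sb) (fun z => smooth_out sb bout (x := z)).
exists ((B0 + 2 * B1) / 2); first by rewrite divr_ge0// addr_ge0// mulr_ge0.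
move=> l l0; pose M := bump_average l; rewrite -/(M t1) -/(M t0).
have V0 : 0 < l^-1 by rewrite invr_gt0.
set k := _ / 2; set L := l^-1 in V0 *.
have xc t : t0 <= t <= t1 -> {for t, continuous x} by exact: (charac_cont xch).
have [X [X0 HX]] := bounded_cont_itv xc.
pose Y := X + 2 * L.
have [Bu [Bu0 HBu]] := rectangle_bounded (- Y) Y t0 t1 uw.1.
have [Ms [Ms0 HMs]] := bump_at_shift l0.
pose e r := sqint (w ^~ r) (x r - L) (x r + 2 * L).
have uxc t : t0 <= t <= t1 -> {for t, continuous (fun r => u (x r) r)}.
  by move=> h; apply: cont2_comp; [exact: uw.1|exact: xc].
have ei a b : t0 <= a -> b <= t1 -> mu.-integrable `[a, b] (EFin \o e).
  move=> ta bt; have inI t : a <= t <= b -> t0 <= t <= t1.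
    by move=> /andP[h1 h2]; rewrite (le_trans ta) ?(le_trans h2).
  apply: (@integrable_bounded _ _ _ _ C).
    apply: (measurable_sqint uw).
    + by move=> t h; apply: cvgB; [exact: xc (inI _ h)|exact: cvg_cst].
    + by move=> t h; apply: cvgD; [exact: xc (inI _ h)|exact: cvg_cst].
    + by move=> t _; lra.
  by move=> t _; rewrite ger0_norm ?sqint_ge0//; exact: sqint_le (uw.2 t) _ _.
have Hi a b : t0 <= a -> b <= t1 -> mu.-integrable `[a, b] (EFin \o (fun r => HS_source w (x r) r)).
  move=> ta bt; have inI t : a <= t <= b -> t0 <= t <= t1.
    by move=> /andP[h1 h2]; rewrite (le_trans ta) ?(le_trans h2).
  apply: (@integrable_bounded _ _ _ _ C).
    by apply: (measurable_HS_source uw) => t h; exact: xc (inI _ h).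
  by move=> t _; have /andP[h1 h2] := HS_source_bounds uw (x t) t; rewrite ger0_norm.
pose F t := M t - L * bump_mass * \int[mu]_(r in `[t0, t]) HS_source w (x r) r.
pose g t := k * L * \int[mu]_(r in `[t0, t]) e r.
suff : `|F t1 - F t0| <= g t1 - g t0.
  have -> : g t1 - g t0 = k * L * \int[mu]_(r in `[t0, t1]) e r by rewrite /g Rintegral_point mulr0 subr0.
  have -> : F t1 - F t0 = M t1 - M t0 - L * bump_mass * \int[mu]_(r in `[t0, t1]) HS_source w (x r) r.
    by rewrite /F Rintegral_point; move: (M t1) (M t0) => m1 m0; ring.
  exact.
apply: le_of_small_increments => // ep ep0.
(* The first two terms are the coefficients of [e1 * (t - s)] in [T1B] and [GB]; [1] makes it
   positive. *)
pose K1 := Bu * Ms * (2 * Y) * Bu ^+ 2 + Bu * B1 + 1.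
have Y0 : 0 <= Y by rewrite /Y; lra.
have K10 : 0 < K1.
  by rewrite ltr_wpDl// addr_ge0 ?mulr_ge0// ?mulr_ge0// sqr_ge0.
pose e1 := ep / K1.
have e10 : 0 < e1 by exact: divr_gt0.
have [du du0 Hdu] := @unif_cont_rectangle R u (- Y) Y t0 t1 uw.1 _ e10.
(* Respectively: [u] varies by at most [e1] in time, the squared shift is at most
   [Bu ^+ 2 * e1 * (t - s)], and the characteristic moves by at most one bump width. *)
exists (Num.min du (Num.min e1 (L / (Bu + 1)))).
  by rewrite !lt_min du0 e10 divr_gt0//; lra.
move=> s t ts st tt; rewrite !lt_min => /and3P[stu ste stl].
have sI : t0 <= s <= t1 by rewrite ts (le_trans st).
have tI : t0 <= t <= t1 by rewrite tt (le_trans ts).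
have inI r : s <= r <= t -> t0 <= r <= t1.
  by move=> /andP[h1 h2]; rewrite (le_trans ts) ?(le_trans h2).
have xY r : t0 <= r <= t1 -> - Y <= x r <= Y.
  by move=> /HX; rewrite ler_norml => h; apply: (seg_widen h V0); rewrite lexx lerDl ltW.
have xlip a b : s <= a -> a <= b -> b <= t -> `|x b - x a| <= Bu * (b - a).
  move=> sa ab bt; have [|c [/andP[c1 c2] ->]] := @mvt_closed R x (fun r => u (x r) r) a b ab.
    by move=> r /andP[h1 h2]; apply: xch; apply: inI; rewrite (le_trans sa) ?(le_trans h2).
  have cI : t0 <= c <= t1 by apply: inI; rewrite (le_trans sa) ?(le_trans c2).
  rewrite normrM (ger0_norm (_ : 0 <= b - a)) ?subr_ge0// ler_wpM2r ?subr_ge0//.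
  by apply: HBu => //; exact: xY.
have sL : Bu * (t - s) <= L.
  apply: ltW; move: stl; rewrite ltr_pdivlMr; last by lra.
  by apply: le_lt_trans; rewrite mulrC ler_wpM2l ?subr_ge0//; lra.
have xs := xlip s t (lexx s) st (lexx t).
pose dal z := l * derive1 bump (l * z - l * x s).
have dalE : derive1 (bump_at l (x s)) = dal by exact: bump_at_derive1.
have alc y : continuous (bump_at l y) by exact: smooth_cont (smooth_bump_at l y).
have dalc : continuous dal.
  by rewrite -dalE; exact: smooth_cont (smooth_derive (smooth_bump_at l _)).
have uc r : continuous (u ^~ r) by exact: (flow_cont_space uw).
have wide (f : R -> R) r : t0 <= r <= t1 -> (forall z, z < x r \/ x r + L < z -> f z = 0) ->
    \int[mu]_(z in `[x r, x r + L]) f z = \int[mu]_(z in `[- Y, Y]) f z.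
  move=> rI f0; rewrite (@Rintegral_supp _ _ `[- Y, Y] (x r) (x r + L))//.
    have := HX r rI; rewrite ler_norml => h z; rewrite /= !in_itv/=; exact: seg_widen.
  by move=> z /negP; rewrite negb_and -!ltNge => /orP h; exact: f0.
have ME r q : t0 <= r <= t1 -> \int[mu]_(z in `[x r, x r + L]) (u z q * bump_at l (x r) z) =
    \int[mu]_(z in `[- Y, Y]) (u z q * bump_at l (x r) z).
  by move=> rI; apply: wide => // z h; rewrite bump_at_out ?mulr0.
have dME : \int[mu]_(z in `[x s, x s + L]) (u z t * dal z) =
    \int[mu]_(z in `[- Y, Y]) (u z t * dal z).
  apply: wide => // z h; rewrite -dalE.
  by rewrite (smooth_out (smooth_bump_at l (x s)) (fun z' => @bump_at_out R l (x s) z' l0) h) mulr0.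
have ci q (f : R -> R) : continuous f -> mu.-integrable `[- Y, Y] (EFin \o (fun z => u z q * f z)).
  by move=> fc; apply: continuous_integrable => z; apply: cvgM; [exact: uc|exact: fc].
pose T1 := \int[mu]_(z in `[- Y, Y]) (u z t * (bump_at l (x t) z - bump_at l (x s) z + (x t - x s) * dal z)).
have T1E : T1 = M t - \int[mu]_(z in `[x s, x s + L]) (u z t * bump_at l (x s) z)
    + (x t - x s) * \int[mu]_(z in `[x s, x s + L]) (u z t * dal z).
  rewrite /M /bump_average !ME// dME -RintegralB//; [|exact: ci..].
  rewrite -RintegralZl//; last exact: ci.
  rewrite -RintegralD//; [|by apply: integrable_sub => //; exact: ci|by apply: integrable_scale => //; exact: ci].
  by apply: eq_Rintegral => z _; ring.
have T1B : `|T1| <= Bu * Ms * (2 * Y) * Bu ^+ 2 * e1 * (t - s).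
  apply: le_trans (@normr_Rintegral_le _ _ _ _ (Bu * (Ms * (x t - x s) ^+ 2)) _ _ _) _.
  - by apply: (le_trans _ Y0); rewrite oppr_le0.
  - apply: ci => z; apply: cvgD; first by apply: cvgB; exact: alc.
    by apply: cvgM; [exact: cvg_cst|exact: dalc].
  - by move=> z zY; rewrite normrM; apply: ler_pM => //; exact: HBu.
  - have h1 : (x t - x s) ^+ 2 <= Bu ^+ 2 * (e1 * (t - s)).
      rewrite -real_normK ?num_real//.
      apply: (@le_trans _ _ ((Bu * (t - s)) ^+ 2)).
        by apply: lerXn2r => //; rewrite nnegrE// mulr_ge0// subr_ge0.
      rewrite exprMn ler_wpM2l ?sqr_ge0// expr2 ler_wpM2r ?subr_ge0//; exact: ltW.
    have -> : Bu * Ms * (2 * Y) * Bu ^+ 2 * e1 * (t - s) = Bu * (Ms * (Bu ^+ 2 * (e1 * (t - s)))) * (2 * Y) by ring.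
    rewrite (_ : Y - - Y = 2 * Y); last by ring.
    by rewrite ler_wpM2r ?mulr_ge0// ler_wpM2l// ler_wpM2l.
pose D r := \int[mu]_(z in `[x s, x s + L]) tested_flux u w (bump_at l (x s)) r z.
have xsL : x s <= x s + L by rewrite lerDl ltW.
have out z := @bump_at_out R l (x s) z l0.
have sal := @smooth_bump_at R l (x s).
have T2E : \int[mu]_(z in `[x s, x s + L]) (u z t * bump_at l (x s) z) - M s = \int[mu]_(r in `[s, t]) D r.
  by apply: (mollified_increment uw xsL sal out weak) => //; exact: le_trans ts.
have Di : mu.-integrable `[s, t] (EFin \o D).
  have [MD [_ HMD]] := tested_flux_bounded uw xsL sal out s t.
  by apply: (@integrable_bounded _ D s t MD _ HMD); exact: (measurable_tested_flux uw xsL sal).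
have uxi : mu.-integrable `[s, t] (EFin \o (fun r => u (x r) r)).
  have h r : s <= r <= t -> {for r, continuous (fun r => u (x r) r)} by move/inI; exact: uxc.
  have [B [_ HB]] := bounded_cont_itv h.
  by apply: (integrable_bounded _ HB); exact: measurable_cont_itv.
have xE : x t - x s = \int[mu]_(r in `[s, t]) u (x r) r.
  by apply/esym/C1_FTC => // r /inI; [exact: xch|exact: uxc].
pose I := \int[mu]_(z in `[x s, x s + L]) (u z t * dal z).
pose G r := D r - I * u (x r) r - L * bump_mass * HS_source w (x r) r.
have Hist := Hi s t ts tt.
have Gi : mu.-integrable `[s, t] (EFin \o G).
  apply: integrable_sub => //; last exact: integrable_scale.
  by apply: integrable_sub => //; exact: integrable_scale.
have FE : F t - F s = T1 + \int[mu]_(r in `[s, t]) G r.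
  rewrite /F (@Rintegral_split _ _ t0 s t)//; last exact: Hi.
  rewrite /G RintegralB//; [|by apply: integrable_sub => //; exact: integrable_scale|exact: integrable_scale].
  rewrite RintegralB//; last exact: integrable_scale.
  have -> : \int[mu]_(r in `[s, t]) (I * u (x r) r) = I * (x t - x s) by rewrite RintegralZl// -xE.
  have -> : \int[mu]_(r in `[s, t]) (L * bump_mass * HS_source w (x r) r) =
      L * bump_mass * \int[mu]_(r in `[s, t]) HS_source w (x r) r by rewrite RintegralZl.
  rewrite -T2E T1E -/I; move: (M t) (M s) => m1 m0; ring.
have -> : g t - g s = k * L * \int[mu]_(r in `[s, t]) e r.
  rewrite /g (@Rintegral_split _ _ t0 s t)//; last exact: ei.
  by rewrite mulrDr addrC addKr.
rewrite FE; apply: le_trans (ler_normD _ _) _.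
have eist := ei s t ts tt.
have GB : `|\int[mu]_(r in `[s, t]) G r| <= k * L * \int[mu]_(r in `[s, t]) e r + Bu * e1 * B1 * (t - s).
  apply: le_trans (le_normr_Rintegral _ _) _ => //.
  rewrite -RintegralZl// -Rintegral_cst_itv// -RintegralD//; [|exact: integrable_scale|exact: integrable_cst_itv].
  apply: le_Rintegral => //.
  - exact: (integrable_norm Gi).
  - apply: integrable_add => //; [exact: integrable_scale|exact: integrable_cst_itv].
  move=> r; rewrite /= in_itv/= => rst; have rI := inI r rst.
  move: (rst) => /andP[sr rt].
  have := @bump_flux_error B0 B1 Bu e1 l r (x r) (x s) (u ^~ t) l0 (ltW e10) HB0 HB1 (uc t).
  rewrite /G /D /I -/L -/dal [X in D r - X]mulrC; apply.
  - move=> z zI; apply: Hdu => //.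
    + by have := HX s sI; rewrite ler_norml => h; exact: seg_widen zI.
    + by rewrite subrr normr0.
    + by rewrite distrC ger0_norm ?subr_ge0//; apply: le_lt_trans stu; rewrite lerD2l lerN2.
  - by apply: HBu => //; exact: xY.
  - apply: le_trans (xlip s r (lexx s) sr rt) _; apply: le_trans sL.
    by rewrite ler_wpM2l// lerD2r.
have -> : ep = e1 * K1 by rewrite /e1 divfK// gt_eqF.
have st0 : 0 <= e1 * (t - s) by rewrite mulr_ge0 ?subr_ge0// ltW.
apply: le_trans (lerD T1B GB) _; rewrite /K1.
move: st0; rewrite /=; set q := \int[mu]_(_ in _) _; set A := Bu * Ms * _ * _ => st0.
have -> : e1 * (A + Bu * B1 + 1) * (t - s) = A * e1 * (t - s) + Bu * e1 * B1 * (t - s) + e1 * (t - s) by ring.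
by rewrite addrCA lerD2l lerDl.
Qed.

(** [bump_charac_increment] divided by the mass of the bump: as [l] grows, averages tend to values
    of [u] on the characteristic, and the window energy, bounded by [C], tends to [0] at each time,
    hence in the time integral. *)
Lemma charac_source_law :
  u (x t1) t1 - u (x t0) t0 = \int[mu]_(r in `[t0, t1]) HS_source w (x r) r.
Proof.
have [k k0 Hk] := bump_charac_increment.
have K0 := @bump_mass_gt0 R.
have xc t : t0 <= t <= t1 -> {for t, continuous x} by exact: (charac_cont xch).
pose e (n : nat) r := sqint (w ^~ r) (x r - n.+1%:R^-1) (x r + 2 * n.+1%:R^-1).
have e0 : (fun n => \int[mu]_(r in `[t0, t1]) e n r) @ \oo --> (0 : R).
  have <- : \int[mu]_(r in `[t0, t1]) (0 : R) = 0 by rewrite Rintegral_cst_itv// mul0r.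
  apply: (@Rintegral_dominated _ _ _ _ (fun=> C)) => //.
  - move=> n; have n0 : 0 < n.+1%:R^-1 :> R by rewrite invr_gt0.
    apply: (measurable_sqint uw).
    + by move=> t h; apply: cvgB; [exact: xc|exact: cvg_cst].
    + by move=> t h; apply: cvgD; [exact: xc|exact: cvg_cst].
    + by move=> t _; move: (n.+1%:R^-1) n0 => q q0; lra.
  - exact: integrable_cst_itv.
  - by apply: aeW => r _; exact: sqint_shrink (uw.2 r) _.
  - by move=> n r _; rewrite ger0_norm ?sqint_ge0//; exact: sqint_le (uw.2 r) _ _.
apply/eqP; rewrite -subr_eq0 -normr_le0; apply/ler_addgt0Pr => ep ep0; rewrite add0r.
set H := \int[mu]_(r in `[t0, t1]) _.
have e3 : 0 < ep / 4 by rewrite divr_gt0.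
have k1 : 0 < k + 1 by lra.
have e4 : 0 < ep / 4 * bump_mass / (k + 1) by rewrite divr_gt0// mulr_gt0.
have c0 : {for x t0, continuous (u ^~ t0)} by exact: (flow_cont_space uw).
have c1 : {for x t1, continuous (u ^~ t1)} by exact: (flow_cont_space uw).
have /cvgrPdist_lt/(_ _ e3)[d0 /= d00 H0] := c0.
have /cvgrPdist_lt/(_ _ e3)[d1 /= d10 H1] := c1.
have hc : n.+1%:R^-1 @[n --> \oo] --> (0 : R) by exact: cvg_harmonic.
have d01 : 0 < Num.min d0 d1 by rewrite lt_min d00.
move/cvgrPdist_lt : hc => /(_ _ d01) hc.
move/cvgrPdist_lt : e0 => /(_ _ e4) e0.
have [N _ /(_ N (leqnn N)) [hN eN]] := filterI hc e0.
have l0 : 0 < N.+1%:R :> R by [].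
have V0 : 0 < N.+1%:R^-1 :> R by rewrite invr_gt0.
move: hN; rewrite sub0r normrN (ger0_norm (ltW V0)) lt_min => /andP[hN0 hN1].
have close t d : N.+1%:R^-1 < d -> (forall z, `|x t - z| < d -> `|u (x t) t - u z t| < ep / 4) ->
  `|\int[mu]_(z in `[x t, x t + N.+1%:R^-1]) (u z t * bump_at N.+1%:R (x t) z)
     - u (x t) t * (N.+1%:R^-1 * bump_mass)| <= ep / 4 * (N.+1%:R^-1 * bump_mass).
  move=> nd Hd; apply: (@bump_at_average R (u ^~ t)) => //; first exact: (flow_cont_space uw).
  move=> z /andP[h1 h2]; rewrite distrC; apply/ltW/Hd.
  by rewrite distrC ger0_norm; move: (N.+1%:R^-1) nd h2 => q nd h2; lra.
have h0 := close t0 d0 hN0 H0; have h1 := close t1 d1 hN1 H1.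
have h2 := Hk _ l0.
move: eN; rewrite sub0r normrN ger0_norm; last first.
  by apply: Rintegral_ge0 => r _; exact: sqint_ge0.
rewrite /e ltr_pdivlMr// => eN.
move: h0 h1 h2 eN; rewrite -/H /bump_average.
move: (N.+1%:R^-1) V0 => L L0.
set M0 := \int[mu]_(_ in _) _; set M1 := \int[mu]_(_ in _) _; set E := \int[mu]_(_ in _) _.
move=> h0 h1 h2 eN.
have E0 : 0 <= E by apply: Rintegral_ge0 => r _; exact: sqint_ge0.
have LK : 0 < L * bump_mass by rewrite mulr_gt0.
rewrite -(ler_pM2r LK) -{1}(ger0_norm (ltW LK)) -normrM.
have -> : (u (x t1) t1 - u (x t0) t0 - H) * (L * bump_mass) = (M1 - M0 - L * bump_mass * H)
   - (M1 - u (x t1) t1 * (L * bump_mass)) + (M0 - u (x t0) t0 * (L * bump_mass)) by ring.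
apply: le_trans (ler_normD _ _) _.
have h3 := ler_normB (M1 - M0 - L * bump_mass * H) (M1 - u (x t1) t1 * (L * bump_mass)).
have h4 : k * L * E <= ep / 4 * (L * bump_mass).
  have -> : k * L * E = (k * E) * L by ring.
  rewrite [L * bump_mass]mulrC mulrA; apply: ler_wpM2r; first exact: ltW.
  by apply: le_trans (ltW eN); rewrite mulrDr mulr1 mulrC lerDl.
move: h0 h1 h2 h3 h4; set P := L * bump_mass in LK *; set a0 := `|_ - _ * P|; set a1 := `|_ - _ * P|.
set a2 := `|_ - _ - _ * H|; set a3 := `|_ - _|; move=> h0 h1 h2 h3 h4.
have Q0 : 0 < ep / 4 * P by exact: mulr_gt0.
have -> : ep * P = 4 * (ep / 4 * P) by field.
by move: (ep / 4 * P) Q0 h0 h1 h4 => Q Q0 h0 h1 h4; lra.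
Qed.

End OneCharacteristic.
End CharacteristicLaw.

(** * Lower bound for the energy of a weak solution *)

Section CharacteristicPairs.
Context {R : realType}.
Local Notation mu := (@lebesgue_measure R).
Implicit Types (a b t kappa M : R).

Variables (C : R) (u w : R -> R -> R).
Hypothesis uw : finite_energy_flow C u w.
Hypothesis weak : source_identity u w.

(* The variance of [w ^~ t] on [[A t, B t]]; it is [0] where [A t = B t] because [0^-1 = 0]. *)
Definition charac_gap (A B : R -> R) t :=
  sqint (w ^~ t) (A t) (B t) - (u (B t) t - u (A t) t) ^+ 2 / (B t - A t).

Variables (A B : R -> R) (a b : R).
Hypotheses (a0 : 0 <= a) (ab : a <= b).
Hypotheses (Ach : charac u a b A) (Bch : charac u a b B).
Hypothesis AB : forall t, a <= t <= b -> A t <= B t.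

Local Notation h := (fun t => B t - A t).
Local Notation p := (fun t => u (B t) t - u (A t) t).
Local Notation e := (fun t => sqint (w ^~ t) (A t) (B t)).

Let hd t : a <= t <= b -> is_derive t 1 h (p t).
Proof. by move=> tab; apply: is_deriveB; [exact: Bch|exact: Ach]. Qed.

Let pc t : a <= t <= b -> {for t, continuous p}.
Proof.
move=> tab; apply: cvgB; apply: (cont2_comp uw.1).
  exact: charac_cont Bch _ tab.
exact: charac_cont Ach _ tab.
Qed.

Let em : measurable_fun `[a, b] e.
Proof. by apply: (measurable_sqint uw) => //; [exact: (charac_cont Ach)|exact: (charac_cont Bch)]. Qed.

Let eC t : a <= t <= b -> 0 <= e t <= C.
Proof. by move=> _; rewrite sqint_ge0 (sqint_le (uw.2 t)). Qed.

Let pe s t : a <= s -> s <= t -> t <= b -> p t - p s = \int[mu]_(r in `[s, t]) (2^-1 * e r).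
Proof.
move=> as_ st tb; have s0 := le_trans a0 as_.
have Hi X : charac u a b X -> mu.-integrable `[s, t] (EFin \o (fun r => HS_source w (X r) r)).
  move=> Xch; apply: (@integrable_bounded _ _ _ _ C).
    apply: (measurable_HS_source uw) => r /andP[h1 h2]; apply: charac_cont Xch _ _.
    by rewrite (le_trans as_) ?(le_trans h2).
  by move=> r _; have /andP[h1 h2] := HS_source_bounds uw (X r) r; rewrite ger0_norm.
have -> : p t - p s = (u (B t) t - u (B s) s) - (u (A t) t - u (A s) s) by ring.
rewrite (charac_source_law uw weak s0 st (charac_sub as_ tb Ach)).
rewrite (charac_source_law uw weak s0 st (charac_sub as_ tb Bch)).
rewrite -RintegralB//; [|exact: Hi..].
apply: eq_Rintegral => r /set_mem/=; rewrite in_itv/= => /andP[h1 h2].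
by rewrite (HS_source_diff uw)//; apply: AB; rewrite (le_trans as_) ?(le_trans h2).
Qed.

Let h0 t : a <= t <= b -> 0 <= h t.
Proof. by move=> tab; rewrite subr_ge0 AB. Qed.

Let CS t : a <= t <= b -> p t ^+ 2 <= h t * e t.
Proof. by move=> tab; exact: (sqr_incr_le_sqint (uw.2 t) (AB tab)). Qed.

Lemma charac_height_le_max t : a <= t <= b -> B t - A t <= Num.max (B a - A a) (B b - A b).
Proof. exact: (height_le_max ab hd pc em eC pe h0 CS). Qed.

Lemma charac_gap_bounds t : a <= t <= b -> 0 <= charac_gap A B t <= C.
Proof. exact: (gap_bounds eC h0 CS). Qed.

Lemma charac_gap_integrable : mu.-integrable `[a, b] (EFin \o charac_gap A B).
Proof. exact: (gap_integrable hd pc em eC h0 CS). Qed.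

Lemma charac_pair_lower kappa : a < b -> A a < B a -> 0 < kappa <= 1 ->
  kappa <= 1 + (b - a) / 2 * ((u (B a) a - u (A a) a) / (B a - A a)) ->
  (u (B a) a - u (A a) a) ^+ 2 / (B a - A a) <= sqint (w ^~ b) (A b) (B b) +
    2 / ((b - a) * kappa) * \int[mu]_(t in `[a, b]) charac_gap A B t.
Proof. by move=> ab' AB' k1 k2; apply: (pair_lower ab hd pc em eC pe h0 CS) => //; rewrite subr_gt0. Qed.

Lemma charac_pair_upper M : a < b -> A b < B b -> 0 <= M ->
  (forall t, a <= t <= b -> u (B t) t - u (A t) t <= M * (B t - A t)) ->
  let kappa := expR (- M * (b - a) / 2) in
  [/\ A a < B a, (u (B b) b - u (A b) b) ^+ 2 / (B b - A b) <=
      (u (B a) a - u (A a) a) ^+ 2 / (B a - A a) +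
      M / kappa * \int[mu]_(t in `[a, b]) charac_gap A B t &
    - (2 / (b - a)) < (u (B a) a - u (A a) a) / (B a - A a) \/
    B b - A b <= (b - a) / (4 * kappa) * \int[mu]_(t in `[a, b]) charac_gap A B t].
Proof.
move=> ab' AB' M0 HM kappa; have hb0 : 0 < h b by rewrite subr_gt0.
by have [] := pair_upper ab hd pc em eC pe h0 CS ab' hb0 M0 HM; rewrite subr_gt0.
Qed.

End CharacteristicPairs.

(** * Initial energy above a slope threshold, and small unions of cells *)

Section TruncatedSquare.
Context {R : realType}.
Local Notation mu := (@lebesgue_measure R).
Implicit Types (f g : R -> R) (a b c d x y z : R).

(** With [c = 2 / T] and [y] the initial slope, this is the energy density that survives up to time
    [T]. *)
Definition tsq c y : R := if - c < y then y ^+ 2 else 0.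

Lemma tsq_ge0 c y : 0 <= tsq c y. Proof. by rewrite /tsq; case: ifP => // _; exact: sqr_ge0. Qed.

Lemma tsq_le c y : tsq c y <= y ^+ 2.
Proof. by rewrite /tsq; case: ifP => // _; exact: sqr_ge0. Qed.

(** [tsq] jumps at its cut, so it is compared with a looser cut: if [y] passes the cut at [c] and
    [z] fails the one at [d], then [y - z >= d - c], and the square of the difference pays for
    [y ^+ 2]. *)
Lemma tsq_compare c d al : 0 < c -> c < d -> 0 < al -> exists2 K, 0 <= K &
  forall y z, tsq c y <= (1 + al) * tsq d z + K * (y - z) ^+ 2.
Proof.
move=> c0 cd al0; pose k := c / (d - c).
have dc : 0 < d - c by rewrite subr_gt0.
have k0 : 0 < k by exact: divr_gt0.
have kE : k * (d - c) = c by rewrite /k divfK// gt_eqF.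
have V0 : 0 < al^-1 by rewrite invr_gt0.
(* [1 + al^-1] is Young's constant when both pass; [k ^+ 2] serves when [z] fails and [y] is
   negative, since then [- y < c = k * (d - c) <= k * (y - z)]. *)
exists (1 + al^-1 + k ^+ 2) => [|y z]; first by rewrite !addr_ge0 ?sqr_ge0// ltW.
have q0 := sqr_ge0 (y - z).
rewrite /tsq; case: ifPn => [cy|_]; last first.
  rewrite addr_ge0//; last by rewrite mulr_ge0// !addr_ge0 ?sqr_ge0// ltW.
  by rewrite mulr_ge0//; [lra|case: ifP => // _; exact: sqr_ge0].
case: ifPn => [dz|]; last first.
  rewrite -leNgt => zd; rewrite mulr0 add0r.
  have [y0|y0] := leP 0 y.
    apply: (@le_trans _ _ ((y - z) ^+ 2)); first by apply: lerXn2r; rewrite ?nnegrE; lra.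
    by rewrite ler_peMl//; have := sqr_ge0 k; lra.
  have h1 : d - c <= y - z by lra.
  have h2 : y ^+ 2 <= (k * (y - z)) ^+ 2.
    rewrite -sqrrN; apply: lerXn2r; rewrite ?nnegrE; [lra|by rewrite mulr_ge0 ?(ltW k0)//; lra|].
    by apply: (@le_trans _ _ c); [lra|rewrite -{1}kE ler_pM2l].
  by rewrite exprMn in h2; apply: le_trans h2 _; rewrite ler_wpM2r//; lra.
have h1 : y ^+ 2 <= (1 + al) * z ^+ 2 + (1 + al^-1) * (y - z) ^+ 2.
  have H r : (z + r) ^+ 2 <= (1 + al) * z ^+ 2 + (1 + al^-1) * r ^+ 2.
    have : 0 <= al^-1 * (al * z - r) ^+ 2 by rewrite mulr_ge0 ?sqr_ge0// ltW.
    have -> : al^-1 * (al * z - r) ^+ 2 = al * z ^+ 2 - 2 * z * r + al^-1 * r ^+ 2.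
      by field; rewrite gt_eqF.
    by move: (al^-1) => q; nra.
  by have := H (y - z); rewrite addrC subrK.
apply: le_trans h1 _; rewrite lerD2l ler_wpM2r//; have := sqr_ge0 k; lra.
Qed.

Lemma measurable_tsq c : measurable_fun setT (tsq c).
Proof.
have -> : tsq c = fun y => y ^+ 2 * \1_(`]- c, +oo[) y.
  apply/funext => y; rewrite /tsq indicE.
  have -> : (y \in `]- c, +oo[%classic) = (- c < y).
    by apply/idP/idP => [/set_mem|h]; [rewrite /= in_itv/= andbT|apply/mem_set; rewrite /= in_itv/= andbT].
  by case: ifP; rewrite ?mulr1 ?mulr0.
apply: measurable_funM; first by apply: measurable_funX; exact: measurable_id.
by apply: measurable_indic; exact: measurable_itv.
Qed.

Lemma cvg_coray f x : mu.-integrable setT (EFin \o f) ->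
  \int[mu]_(y in `[x, x + n%:R]) f y @[n --> \oo] -->
  \int[mu]_y f y - \int[mu]_(y in `]-oo, x]) f y.
Proof.
move=> fi; have mf := integrable_measurable fi.
have i1 (D : set R) : measurable D -> mu.-integrable setT (EFin \o (fun y => \1_D y * f y)).
  move=> mD; apply: (@integrable_mul_bounded _ _ _ _ 1) => //.
  by move=> y _; rewrite indicE; case: (_ \in _); rewrite ?normr1 ?normr0.
have n1 n : \int[mu]_(y in `[x, x + n%:R]) f y = \int[mu]_(y in `]x, x + n%:R]) f y.
  rewrite -(@Rintegral_itv_obnd_cbnd _ x (BRight (x + n%:R)))//.
  by apply: (integrableS _ _ _ fi) => //; exact: measurable_itv.
under eq_fun do rewrite n1 Rintegral_indic.
rewrite [X in _ - X]Rintegral_indic -RintegralB//; last by apply: i1; exact: measurable_itv.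
apply: (@Rintegral_dominated _ _ _ _ (fun y => `|f y|)) => //.
- by move=> n; apply: measurable_funM => //; apply: measurable_indic; exact: measurable_itv.
- apply: measurable_funB => //; apply: measurable_funM => //; apply: measurable_indic; exact: measurable_itv.
- exact: (integrable_norm fi).
- apply: aeW => y _; apply: cvg_near_cst.
  exists (Num.bound (`|y - x|)) => // n /= hn; rewrite !indicE.
  have [yx|xy] := leP y x.
    rewrite memNset/= ?in_itv/= ?mul0r; last by rewrite ltNge yx.
    by rewrite mem_set/= ?in_itv//= mul1r subrr.
  rewrite [in RHS]memNset/= ?in_itv/= ?mul0r ?subr0; last by rewrite leNgt xy.
  rewrite mem_set ?mul1r//= in_itv/= xy/=.
  have := archi_boundP (normr_ge0 (y - x)); have : (Num.bound `|y - x|)%:R <= n%:R :> R by rewrite ler_nat.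
  by rewrite ger0_norm; lra.
- move=> n y _; rewrite normrM ler_piMl// indicE; case: (_ \in _); rewrite ?normr1 ?normr0//.
Qed.

Variables (C : R) (f g : R -> R).
Hypothesis fg : finite_energy C f g.

Lemma measurable_tsq_comp c : measurable_fun setT (fun x => tsq c (g x)).
Proof. by have [_ mg _] := fg; exact: measurableT_comp (measurable_tsq c) mg. Qed.

Lemma tsq_integrable c (D : set R) : measurable D -> mu.-integrable D (EFin \o (fun x => tsq c (g x))).
Proof.
move=> mD; apply: (integrable_le mD _ (finite_energy_sqr_integrable fg mD)).
  by apply: (measurable_funS measurableT) => //; exact: measurable_tsq_comp.
by move=> x _; rewrite ger0_norm ?tsq_ge0// tsq_le.
Qed.

(** The strict inequality in [tsq] makes it left continuous in the cut, so cuts increasing to [d]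
    from strictly below converge pointwise under the majorant [g ^+ 2]. *)
Lemma tsq_cvg_cut (c : nat -> R) d (D : set R) : measurable D -> c n @[n --> \oo] --> d ->
  (forall n, c n < d) ->
  \int[mu]_(x in D) tsq (c n) (g x) @[n --> \oo] --> \int[mu]_(x in D) tsq d (g x).
Proof.
move=> mD cd clt; apply: (Rintegral_dominated mD _ _ (finite_energy_sqr_integrable fg mD)).
- by move=> n; apply: (measurable_funS measurableT) => //; exact: measurable_tsq_comp.
- by apply: (measurable_funS measurableT) => //; exact: measurable_tsq_comp.
- apply: aeW => x _; apply: cvg_near_cst; rewrite /tsq.
  have [dg|gd] := ltP (- d) (g x); last first.
    by apply: nearW => n; rewrite ltNge (le_trans gd)// lerN2 ltW.
  have /cvgrPdist_lt/(_ _ (_ : 0 < g x + d)) := cd.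
  move=> H; have {}H := H ltac:(lra); move: H; apply: filterS => n.
  by rewrite ltr_norml => /andP[h1 h2]; rewrite ifT//; lra.
- by move=> n x _; rewrite ger0_norm ?tsq_ge0// tsq_le.
Qed.

(** Absolute continuity of the integral of [g ^+ 2]: cut at height [n] it contributes at most [n]
    times the total length, and the part above [n] has small integral. The bound [d] is uniform over
    meshes and selections. *)
Lemma small_cells ep : 0 < ep -> exists2 d, 0 < d & forall N (p : nat -> R) (G : pred nat),
  (forall k, (k < N)%N -> p k <= p k.+1) ->
  \sum_(k < N | G k) (p k.+1 - p k) < d ->
  \sum_(k < N | G k) sqint g (p k) (p k.+1) <= ep.
Proof.
move=> e0; have i2 := finite_energy_sqr_integrableT fg.
have mg2 := integrable_measurable i2.
pose tail (n : nat) x := g x ^+ 2 - Num.min (g x ^+ 2) n%:R.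
have mn x n : Num.min (g x ^+ 2) n%:R <= g x ^+ 2 by rewrite ge_min lexx.
have mn0 x n : 0 <= Num.min (g x ^+ 2) (n%:R : R) by rewrite le_min sqr_ge0 ler0n.
have tail0 n x : 0 <= tail n x by rewrite subr_ge0.
have mmin n : measurable_fun setT (fun x => Num.min (g x ^+ 2) n%:R).
  by apply: measurable_minr => //; exact: measurable_cst.
have mtail n : measurable_fun setT (tail n) by apply: measurable_funB.
have taili n : mu.-integrable setT (EFin \o tail n).
  apply: (integrable_le _ _ i2) => // x _; rewrite ger0_norm// /tail; have := mn0 x n; lra.
have : \int[mu]_x tail n x @[n --> \oo] --> (0 : R).
  have <- : \int[mu]_x (0 : R) = 0 by rewrite /Rintegral integral0.
  apply: (Rintegral_dominated _ _ _ i2) => //.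
  - apply: aeW => x _; apply: cvg_near_cst.
    exists (Num.bound (g x ^+ 2)) => // n /= hn; apply/eqP; rewrite subr_eq0 eq_sym; apply/eqP/min_idPl.
    have := archi_boundP (sqr_ge0 (g x)); have : (Num.bound (g x ^+ 2))%:R <= n%:R :> R by rewrite ler_nat.
    by move=> h1 h2; apply: le_trans (ltW h2) h1.
  - by move=> n x _; rewrite ger0_norm// /tail; have := mn0 x n; lra.
have e2 : 0 < ep / 2 by rewrite divr_gt0.
move/cvgrPdist_lt/(_ _ e2) => [n _ /(_ n (leqnn n))]; rewrite sub0r normrN => Hn.
have n1 : 0 < n%:R + 1 :> R by rewrite ltr_wpDl.
exists (ep / 2 / (n%:R + 1)); first exact: divr_gt0.
move=> N p G pm; rewrite ltr_pdivlMr// => pd.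
have mono i j : (i <= j)%N -> (j <= N)%N -> p i <= p j.
  elim: j => [|j IH]; first by rewrite leqn0 => /eqP->.
  rewrite leq_eqVlt => /predU1P[->//|]; rewrite ltnS => ij jN.
  by apply: le_trans (IH ij (ltnW jN)) _; exact: pm.
have sub a b : mu.-integrable `[a, b] (EFin \o tail n) /\ mu.-integrable `[a, b] (EFin \o (fun x => Num.min (g x ^+ 2) n%:R)).
  split; first by apply: (integrableS _ _ _ (taili n)) => //; exact: measurable_itv.
  apply: (@integrable_bounded _ _ _ _ n%:R).
    by apply: (measurable_funS measurableT) => //; exact: mmin.
  by move=> x _; rewrite ger0_norm// ge_min lexx orbT.
apply: (@le_trans _ _ (\sum_(k < N | G k) (n%:R * (p k.+1 - p k)) +
    \sum_(k < N | G k) \int[mu]_(x in `[p k, p k.+1]) tail n x)).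
  rewrite -big_split/=; apply: ler_sum => k _.
  have [t1 t2] := sub (p k) (p k.+1).
  have -> : sqint g (p k) (p k.+1) = \int[mu]_(x in `[p k, p k.+1]) Num.min (g x ^+ 2) n%:R
     + \int[mu]_(x in `[p k, p k.+1]) tail n x.
    rewrite -RintegralD//; apply: eq_Rintegral => x _; rewrite /tail; ring.
  rewrite lerD2r; apply: le_Rintegral_cst => //; first exact: pm.
  by move=> x _; rewrite ge_min lexx orbT.
have h1 : \sum_(k < N | G k) \int[mu]_(x in `[p k, p k.+1]) tail n x <= \int[mu]_x tail n x.
  apply: le_trans (sum_Rintegral_disjoint (n := N) (s := p) (t := fun k => p k.+1) (tail0 n) (taili n) _).
    rewrite [leRHS](bigID (fun k : 'I_N => G k))/= lerDl; apply: sumr_ge0 => k _.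
    by apply: Rintegral_ge0.
  move=> i j iN jN /eqP; rewrite neq_ltn => /orP[ij|ij]; [left|right]; apply: mono => //; exact: ltnW.
rewrite -mulr_sumr.
have S0 : 0 <= \sum_(k < N | G k) (p k.+1 - p k).
  by apply: sumr_ge0 => k _; rewrite subr_ge0 pm.
move: pd h1; set S := \sum_(_ < N | _) _; set S' := \sum_(_ < N | _) _ => pd h1.
have h2 : \int[mu]_x tail n x <= ep / 2 by apply: le_trans (ler_norm _) (ltW Hn).
have h3 : n%:R * S <= ep / 2 by apply: le_trans (ltW pd); rewrite mulrDr mulr1 mulrC lerDl.
by apply: le_trans (lerD h3 (le_trans h1 h2)) _; rewrite -splitr.
Qed.

End TruncatedSquare.

(** * Meshes of ordered characteristics *)

Section OrderedFamilies.
Context {R : realType}.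
Local Notation mu := (@lebesgue_measure R).
Implicit Types (a b c d t x y z al ep : R).

Lemma le_of_scaled_error k x y : 0 <= k -> (forall e, 0 < e -> x <= y + k * e) -> x <= y.
Proof.
move=> k0 H; apply/ler_addgt0Pr => e e0.
have k1 : 0 < k + 1 by rewrite ltr_wpDl.
apply: (le_trans (H _ (divr_gt0 e0 k1))); rewrite lerD2l mulrA ler_pdivrMr// mulrC.
by rewrite ler_wpM2l ?(ltW e0)// lerDl.
Qed.

Lemma telescope_ord (x : nat -> R) N : \sum_(k < N) (x k.+1 - x k) = x N - x 0%N.
Proof. by rewrite -(big_mkord xpredT (fun k => x k.+1 - x k)) telescope_sumr. Qed.

(** Markov's inequality: at most [D / ep] cells are wider than [ep], and each counts [eta], its
    length at the time when the mesh is equal. *)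
Lemma bad_cells_length N (h : nat -> R) eta ep D : 0 < ep -> 0 <= eta ->
  (forall k, (k < N)%N -> 0 <= h k) -> \sum_(k < N) h k <= D ->
  \sum_(k < N | ~~ (h k <= ep)) eta <= eta * D / ep.
Proof.
move=> e0 eta0 h0 hD; apply: (@le_trans _ _ (\sum_(k < N | ~~ (h k <= ep)) (eta / ep * h k))).
  apply: ler_sum => k; rewrite -ltNge => /ltW hk.
  by rewrite mulrAC ler_pdivlMr// ler_wpM2l.
rewrite -mulr_sumr [leRHS]mulrAC ler_wpM2l ?divr_ge0 ?(ltW e0)//; apply: le_trans hD.
by rewrite [leRHS](bigID (fun k : 'I_N => ~~ (h k <= ep)))/= lerDl sumr_ge0// => k _; exact: h0.
Qed.

(** Turns characteristics that may cross into a family ordered at all times, without changing it at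
    a time when it is already ordered. *)
Fixpoint running_max (Z : nat -> R -> R) k : R -> R :=
  if k is k'.+1 then fun t => Num.max (running_max Z k' t) (Z k t) else Z 0%N.

Lemma charac_running_max u a b Z k : (forall k, charac u a b (Z k)) ->
  charac u a b (running_max Z k).
Proof. by move=> H; elim: k => [|k IH] //=; exact: charac_max. Qed.

Lemma running_max_le Z k t : running_max Z k t <= running_max Z k.+1 t.
Proof. by rewrite /= le_max lexx. Qed.

Lemma running_max_mono Z k t : (forall k, Z k t <= Z k.+1 t) -> running_max Z k t = Z k t.
Proof. by move=> H; elim: k => [|k IH] //=; rewrite IH; apply/max_idPr. Qed.

Lemma running_max_bounded Z k t M : (forall k, `|Z k t| <= M) -> `|running_max Z k t| <= M.
Proof. by move=> H; elim: k => [|k IH] //=; case: (leP (running_max Z k t) (Z k.+1 t)). Qed.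

Variables (C : R) (u w : R -> R -> R).
Hypothesis uw : finite_energy_flow C u w.
Hypothesis weak : source_identity u w.

Section Gaps.
Variables (a b : R) (N : nat -> nat) (X : nat -> nat -> R -> R) (G : nat -> pred nat) (eps : nat -> R).
Hypotheses (a0 : 0 <= a) (ab : a <= b).
Hypothesis Xch : forall n k, charac u a b (X n k).
Hypothesis Xle : forall n k t, a <= t <= b -> X n k t <= X n k.+1 t.
Hypothesis Gle : forall n k, (k < N n)%N -> G n k ->
  X n k.+1 a - X n k a <= eps n /\ X n k.+1 b - X n k b <= eps n.
Hypothesis eps0 : eps @ \oo --> 0.

Lemma gap_sum_cvg t : a <= t <= b ->
  \sum_(k < N n | G n k) charac_gap u w (X n k) (X n k.+1) t @[n --> \oo] --> 0.
Proof.
move=> tab; apply: (variance_cvg (uw.2 t) (x := fun n k => X n k t) (eps := eps)) => //.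
  by move=> n k _; exact: Xle.
move=> n k kN Gk; have [h1 h2] := Gle kN Gk.
apply: le_trans (charac_height_le_max uw weak a0 ab (Xch n k) (Xch n k.+1) (fun t => Xle n k (t := t)) tab) _.
by rewrite ge_max h1 h2.
Qed.

Let gapi n k : mu.-integrable `[a, b] (EFin \o charac_gap u w (X n k) (X n k.+1)).
Proof. exact: (charac_gap_integrable uw (Xch n k) (Xch n k.+1) (fun t => Xle n k (t := t))). Qed.

(** Dominated convergence in time: at each time the gaps add up to at most the energy between the
    outermost characteristics, hence to at most [C]. *)
Lemma gap_integral_sum_cvg :
  \sum_(k < N n | G n k) \int[mu]_(t in `[a, b]) charac_gap u w (X n k) (X n k.+1) t @[n --> \oo] --> 0.
Proof.
have S n := Rintegral_sum (index_enum ('I_(N n))) (fun k => G n k) (measurable_itv `[a, b])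
  (fun k : 'I_(N n) => gapi n k).
have E0 : \int[mu]_(t in `[a, b]) (0 : R) = 0 by rewrite Rintegral_cst_itv// mul0r.
suff : \int[mu]_(t in `[a, b]) (\sum_(k < N n | G n k) charac_gap u w (X n k) (X n k.+1) t)
    @[n --> \oo] --> \int[mu]_(t in `[a, b]) (0 : R).
  by rewrite E0; under eq_fun do rewrite (S _).2.
apply: (@Rintegral_dominated _ _ _ _ (fun=> C)) => //.
- by move=> n; exact: integrable_measurable (S n).1.
- exact: integrable_cst_itv.
- by apply: aeW => t; rewrite /= in_itv/=; exact: gap_sum_cvg.
- move=> n t; rewrite /= in_itv/= => tab.
  have g0 k : 0 <= charac_gap u w (X n k) (X n k.+1) t.
    by have /andP[] := charac_gap_bounds uw (fun t => Xle n k (t := t)) tab.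
  rewrite ger0_norm; last exact: sumr_ge0.
  have [_ E] := sum_sqint (N := N n) (p := fun k => X n k t) (uw.2 t) (fun k _ => Xle n k tab).
  apply: (@le_trans _ _ (\sum_(k < N n) sqint (w ^~ t) (X n k t) (X n k.+1 t))); last first.
    by rewrite E; exact: sqint_le (uw.2 t) _ _.
  apply: (@le_trans _ _ (\sum_(k < N n) charac_gap u w (X n k) (X n k.+1) t)).
    by rewrite [leRHS](bigID (fun k : 'I_(N n) => G n k))/= lerDl sumr_ge0.
  apply: ler_sum => k _; rewrite /charac_gap gerBl mulr_ge0 ?sqr_ge0// invr_ge0 subr_ge0; exact: Xle.
Qed.

End Gaps.

Lemma charac_flow_exists T : 0 <= T -> exists Z : R -> R -> R, forall y, Z y 0 = y /\ charac u 0 T (Z y).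
Proof.
move=> T0; have H y : exists x : R -> R, x 0 = y /\ charac u 0 T x.
  have [M HM] := charac_exists uw T0 (normr_ge0 y).
  have T00 : 0 <= (0 : R) <= T by rewrite lexx.
  by have [x [h1 h2 _]] := HM 0 y T00 (lexx _); exists x.
by have [Z HZ] := choice H; exists Z.
Qed.

(** There are [n.+1 ^ 2] cells because narrow will mean at most [(b - a) / n.+1]: the mesh size is
    [n.+1] times smaller, so cells that are wide at the other time have total mesh length of order
    [1 / n.+1]. *)
Definition mesh a b (n k : nat) := a + (b - a) / (n.+1 ^ 2)%:R * k%:R.

Lemma meshS a b n k : mesh a b n k.+1 - mesh a b n k = (b - a) / (n.+1 ^ 2)%:R.
Proof. by rewrite /mesh -natr1; ring. Qed.

Lemma mesh_le a b n k : a <= b -> mesh a b n k <= mesh a b n k.+1.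
Proof. by move=> ab; rewrite -subr_ge0 meshS divr_ge0// subr_ge0. Qed.

Lemma mesh0 a b n : mesh a b n 0 = a. Proof. by rewrite /mesh mulr0 addr0. Qed.

Lemma meshN a b n : mesh a b n (n.+1 ^ 2) = b.
Proof. by rewrite /mesh divfK ?subrKC// pnatr_eq0 expn_eq0. Qed.

Lemma mesh_bounds a b n k : a <= b -> (k <= n.+1 ^ 2)%N -> a <= mesh a b n k <= b.
Proof.
move=> ab kN; have h : 0 <= (b - a) / (n.+1 ^ 2)%:R by rewrite divr_ge0// subr_ge0.
apply/andP; split; first by rewrite /mesh lerDl mulr_ge0.
by rewrite -[leRHS](meshN a b n) /mesh lerD2l ler_wpM2l// ler_nat.
Qed.

(* Cells of an equal mesh at time [0] are good if they are still narrow at time [T]; since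
   the mesh size is negligible against [eps], the other cells have small total length. *)
Lemma energy_lower_cut T c d (A B : R -> R) : 0 < T -> 0 < c -> c < d -> d < 2 / T ->
  charac u 0 T A -> charac u 0 T B -> (forall t, 0 <= t <= T -> A t <= B t) -> A 0 < B 0 ->
  \int[mu]_(x in `[A 0, B 0]) tsq c (w x 0) <= sqint (w ^~ T) (A T) (B T).
Proof.
move=> T0 c0 cd dT Ach Bch AB AB0.
set a := A 0 in AB0 *; set b := B 0 in AB0 *.
have ab := ltW AB0; have T0' := ltW T0.
have I0 : 0 <= (0 : R) <= T by rewrite lexx.
have IT : 0 <= T <= T by rewrite lexx T0'.
have [Z HZ] := charac_flow_exists T0'.
pose N n := (n.+1 ^ 2)%N.
(* Clamping keeps the cells between [A] and [B], so at time [T] their energies add up to at most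
   that of [[A T, B T]]. *)
pose X n k t := Num.min (B t) (Num.max (A t) (running_max (fun k => Z (mesh a b n k)) k t)).
have Xch n k : charac u 0 T (X n k).
  apply: charac_min => //; apply: charac_max => //; apply: charac_running_max => j.
  by have [] := HZ (mesh a b n j).
have Xle n k t : 0 <= t <= T -> X n k t <= X n k.+1 t.
  move=> _; rewrite /X; apply: le_min2 => //; apply: le_max2 => //; exact: running_max_le.
have X0 n k : (k <= N n)%N -> X n k 0 = mesh a b n k.
  move=> kN; have /andP[h1 h2] := mesh_bounds ab kN.
  rewrite /X -/a -/b running_max_mono => [|j]; last by rewrite !(HZ _).1; exact: mesh_le.
  by rewrite (HZ _).1 (max_idPr h1) (min_idPr h2).
have XAB n k t : 0 <= t <= T -> A t <= X n k t <= B t.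
  by move=> tI; rewrite /X le_min AB//= le_max lexx/= ge_min lexx.
pose eps n := (b - a) * n.+1%:R^-1.
pose eta n := (b - a) / (N n)%:R.
pose hT n k := X n k.+1 T - X n k T.
pose G n k := hT n k <= eps n.
have ba : 0 < b - a by rewrite subr_gt0.
have N0 n : 0 < (N n)%:R :> R by rewrite ltr0n expn_gt0.
have eta0 n : 0 < eta n by exact: divr_gt0.
have eps_gt0 n : 0 < eps n by rewrite mulr_gt0// invr_gt0.
have etaE n : eta n = eps n * n.+1%:R^-1.
  by rewrite /eta /eps /N natrX -exprVn expr2 mulrA.
have V1 n : n.+1%:R^-1 <= 1 :> R by rewrite invf_le1// ler1n.
have eta_eps n : eta n <= eps n by rewrite etaE ler_piMr// ltW.
have h0E n k : (k < N n)%N -> X n k.+1 0 - X n k 0 = eta n.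
  by move=> kN; rewrite !X0//; [rewrite meshS|exact: ltnW].
have Gle n k : (k < N n)%N -> G n k -> X n k.+1 0 - X n k 0 <= eps n /\ X n k.+1 T - X n k T <= eps n.
  by move=> kN Gk; rewrite h0E.
have eps0 : eps @ \oo --> 0.
  by rewrite -[X in _ --> X](mulr0 (b - a)); apply: cvgMr; exact: cvg_harmonic.
have Vc := gap_integral_sum_cvg (lexx 0) T0' Xch Xle Gle eps0.
have Gc := gap_sum_cvg (lexx 0) T0' Xch Xle Gle eps0 I0.
(* The lower bound required by [charac_pair_lower] for slopes above [- d]; it is positive because
   [d < 2 / T]. *)
pose kappa := 1 - T / 2 * d.
have dT2 : T / 2 * d < 1 by move: dT; rewrite ltr_pdivlMr// mulrC => h; nra.
have kap0 : 0 < kappa <= 1.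
  by rewrite /kappa subr_gt0 dT2/= gerBl mulr_ge0//; [rewrite divr_ge0|lra].
have kk : 0 < T * kappa by rewrite mulr_gt0//; case/andP: kap0.
pose S := sqint (w ^~ T) (A T) (B T).
have S0 : 0 <= S by exact: sqint_ge0.
rewrite -/S; apply: (le_of_scaled_error S0) => al al0.
have [K K0 HK] := tsq_compare c0 cd al0.
have al1 : 0 <= 1 + al by lra.
pose k1 := (1 + al) * (2 / (T * kappa)) + K + 1.
have k10 : 0 <= k1 by rewrite !addr_ge0// mulr_ge0// divr_ge0// ltW.
apply: (le_of_scaled_error k10) => ep ep0.
have [dl dl0 Hdl] := small_cells (uw.2 0) ep0.
pose H := B T - A T.
have H0 : 0 <= H by rewrite subr_ge0 AB.
have bad0 : H * n.+1%:R^-1 @[n --> \oo] --> (0 : R).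
  by rewrite -[X in _ --> X](mulr0 H); apply: cvgMr; exact: cvg_harmonic.
move/cvgrPdist_lt : Vc => /(_ _ ep0) Vc; move/cvgrPdist_lt : Gc => /(_ _ ep0) Gc.
move/cvgrPdist_lt : bad0 => /(_ _ dl0) bad0.
have [n _ /(_ n (leqnn n)) [[]]] := filterI (filterI Vc Gc) bad0.
rewrite !sub0r !normrN => {}Vc {}Gc {}bad0.
have hT0 k : 0 <= hT n k by rewrite subr_ge0 Xle.
have XTle k : X n k T <= X n k.+1 T by exact: Xle.
have bad : \sum_(k < N n | ~~ G n k) sqint (w ^~ 0) (X n k 0) (X n k.+1 0) <= ep.
  apply: (Hdl (N n) (fun k => X n k 0) (fun k => ~~ G n k)); first by move=> k _; exact: Xle.
  rewrite (eq_bigr (fun=> eta n)); last by move=> k _; exact: h0E.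
  apply: le_lt_trans (le_lt_trans (ler_norm _) bad0).
  have hD : \sum_(k < N n) hT n k <= H.
    rewrite (telescope_ord (fun k => X n k T)).
    by have /andP[_ h1] := XAB n (N n) T IT; have /andP[h2 _] := XAB n 0%N T IT; rewrite /H; lra.
  apply: le_trans (bad_cells_length (eps_gt0 n) (ltW (eta0 n)) (fun k _ => hT0 k) hD) _.
  rewrite etaE; have := eps_gt0 n; move: (eps n) (n.+1%:R^-1) => e v e0.
  by rewrite (_ : e * v * H / e = H * v)//; field; rewrite gt_eqF.
pose om k := (u (X n k.+1 0) 0 - u (X n k 0) 0) / (X n k.+1 0 - X n k 0).
have gap0 k : 0 <= charac_gap u w (X n k) (X n k.+1) 0.
  by have /andP[] := charac_gap_bounds uw (fun t => Xle n k t) I0.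
have goodE k : (k < N n)%N -> G n k ->
    \int[mu]_(x in `[X n k 0, X n k.+1 0]) tsq c (w x 0) <=
    (1 + al) * (sqint (w ^~ T) (X n k T) (X n k.+1 T) +
       2 / (T * kappa) * \int[mu]_(t in `[0, T]) charac_gap u w (X n k) (X n k.+1) t) +
    K * charac_gap u w (X n k) (X n k.+1) 0.
  move=> kN Gk; have hk := h0E n k kN; have hk0 : X n k 0 < X n k.+1 0 by rewrite -subr_gt0 hk.
  have intg0 : 0 <= \int[mu]_(t in `[0, T]) charac_gap u w (X n k) (X n k.+1) t.
    apply: Rintegral_ge0 => t; rewrite /= in_itv/= => tI.
    by have /andP[] := charac_gap_bounds uw (fun t => Xle n k t) tI.
  have low : tsq d (om k) * (X n k.+1 0 - X n k 0) <=
      sqint (w ^~ T) (X n k T) (X n k.+1 T) +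
       2 / (T * kappa) * \int[mu]_(t in `[0, T]) charac_gap u w (X n k) (X n k.+1) t.
    rewrite /tsq; case: ifPn => [dom|_]; last first.
      by rewrite mul0r addr_ge0 ?sqint_ge0// mulr_ge0// divr_ge0// ltW.
    have -> : om k ^+ 2 * (X n k.+1 0 - X n k 0) = (u (X n k.+1 0) 0 - u (X n k 0) 0) ^+ 2 / (X n k.+1 0 - X n k 0).
      by rewrite /om; field; rewrite subr_eq0 gt_eqF.
    have := charac_pair_lower uw weak (lexx 0) T0' (Xch n k) (Xch n k.+1) (fun t => Xle n k t) T0 hk0 kap0.
    rewrite subr0; apply; rewrite /kappa -/(om k) lerD2l -mulrN ler_wpM2l ?divr_ge0//; exact: ltW.
  have i1 := tsq_integrable (uw.2 0) c (measurable_itv `[X n k 0, X n k.+1 0]).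
  have i2 : mu.-integrable `[X n k 0, X n k.+1 0] (EFin \o (fun x => (w x 0 - om k) ^+ 2)).
    rewrite (_ : (fun x => _) = fun x => w x 0 ^+ 2 - 2 * om k * w x 0 + om k ^+ 2); last first.
      by apply/funext => x; ring.
    apply: integrable_add => //; last exact: integrable_cst_itv.
    apply: integrable_sub => //; first exact: (finite_energy_sqr_integrable (uw.2 0)).
    by apply: integrable_scale => //; exact: (finite_energy_integrable (uw.2 0)).
  (* [tsq_compare] at each point with the mean slope as [z]; the quadratic error integrates to the
     variance at time [0]. *)
  apply: (@le_trans _ _ (\int[mu]_(x in `[X n k 0, X n k.+1 0]) ((1 + al) * tsq d (om k) + K * (w x 0 - om k) ^+ 2))).
    apply: le_Rintegral => //.
    by apply: integrable_add => //; [exact: integrable_cst_itv|exact: integrable_scale].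
  rewrite RintegralD//; [|exact: integrable_cst_itv|exact: integrable_scale].
  rewrite Rintegral_cst_itv ?(ltW hk0)// RintegralZl// (sqint_avg (uw.2 0) hk0).
  by rewrite lerD2r -[(1 + al) * tsq _ _ * _]mulrA; apply: ler_wpM2l.
have split0 : \int[mu]_(x in `[a, b]) tsq c (w x 0) =
    \sum_(k < N n) \int[mu]_(x in `[X n k 0, X n k.+1 0]) tsq c (w x 0).
  have aux m : (m <= N n)%N -> \int[mu]_(x in `[a, mesh a b n m]) tsq c (w x 0) =
      \sum_(k < m) \int[mu]_(x in `[X n k 0, X n k.+1 0]) tsq c (w x 0).
    elim: m => [|m IH] mN; first by rewrite mesh0 Rintegral_point big_ord0.
    have am := mesh_bounds ab (ltnW mN).
    rewrite big_ord_recr/= -IH ?(ltnW mN)// (X0 n m.+1)// (X0 n m) ?(ltnW mN)//.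
    apply: Rintegral_split; [by case/andP: am|exact: mesh_le|].
    by apply: (tsq_integrable (uw.2 0)); exact: measurable_itv.
  by rewrite -aux// meshN.
rewrite split0 (bigID (fun k : 'I_(N n) => G n k))/=.
have badc : \sum_(k < N n | ~~ G n k) \int[mu]_(x in `[X n k 0, X n k.+1 0]) tsq c (w x 0) <= ep.
  apply: le_trans bad; apply: ler_sum => k _; apply: le_Rintegral => //.
  - by apply: (tsq_integrable (uw.2 0)); exact: measurable_itv.
  - by apply: (finite_energy_sqr_integrable (uw.2 0)); exact: measurable_itv.
  - by move=> x _; exact: tsq_le.
have goodc : \sum_(k < N n | G n k) \int[mu]_(x in `[X n k 0, X n k.+1 0]) tsq c (w x 0) <=
   (1 + al) * (S + 2 / (T * kappa) * ep) + K * ep.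
  apply: (@le_trans _ _ (\sum_(k < N n | G n k) ((1 + al) * (sqint (w ^~ T) (X n k T) (X n k.+1 T) +
       2 / (T * kappa) * \int[mu]_(t in `[0, T]) charac_gap u w (X n k) (X n k.+1) t) +
    K * charac_gap u w (X n k) (X n k.+1) 0))).
    by apply: ler_sum => k Gk; exact: goodE.
  rewrite big_split/= -mulr_sumr big_split/= -!mulr_sumr.
  apply: lerD; last by rewrite ler_wpM2l//; exact: le_trans (ler_norm _) (ltW Gc).
  rewrite ler_wpM2l//; apply: lerD; last first.
    by rewrite ler_wpM2l ?divr_ge0 ?(ltW kk)//; exact: le_trans (ler_norm _) (ltW Vc).
  have [m1 E] := sum_sqint (N := N n) (p := fun k => X n k T) (uw.2 T) (fun k _ => XTle k).
  apply: (@le_trans _ _ (\sum_(k < N n) sqint (w ^~ T) (X n k T) (X n k.+1 T))).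
    by rewrite [leRHS](bigID (fun k : 'I_(N n) => G n k))/= lerDl sumr_ge0// => k _; exact: sqint_ge0.
  rewrite E; have /andP[_ h1] := XAB n (N n) T IT; have /andP[h2 _] := XAB n 0%N T IT.
  exact: (sqint_mono uw).
apply: le_trans (lerD goodc badc) _; rewrite /k1.
move: (2 / (T * kappa)) => q.
by rewrite le_eqVlt; apply/orP; left; apply/eqP; ring.
Qed.

End OrderedFamilies.

(** * Lower bounds at the exact threshold, on intervals, half-lines and the line *)

Section LowerBounds.
Context {R : realType}.
Local Notation mu := (@lebesgue_measure R).
Implicit Types (a b c d t x : R).

Lemma cvg_le_bound (s : nat -> R) l K : s n @[n --> \oo] --> l -> (forall n, s n <= K) -> l <= K.
Proof.
move=> sl sK; rewrite -subr_ge0.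
apply: (@cvg_to_ge0 R nat \oo _ (fun n => K - s n)); first by apply: cvgB => //; exact: cvg_cst.
by apply: nearW => n; rewrite subr_ge0.
Qed.

Variables (C : R) (u w : R -> R -> R).
Hypothesis uw : finite_energy_flow C u w.
Hypothesis weak : source_identity u w.
Variables (T : R).
Hypothesis T0 : 0 < T.

(** The cuts [c n < d n < 2 / T] increase to the threshold, where [tsq_cvg_cut] applies. *)
Lemma energy_lower (A B : R -> R) :
  charac u 0 T A -> charac u 0 T B -> (forall t, 0 <= t <= T -> A t <= B t) ->
  \int[mu]_(x in `[A 0, B 0]) tsq (2 / T) (w x 0) <= sqint (w ^~ T) (A T) (B T).
Proof.
move=> Ach Bch AB.
have : A 0 <= B 0 by apply: AB; rewrite lexx ltW.
rewrite le_eqVlt => /predU1P[->|AB0]; first by rewrite Rintegral_point; exact: sqint_ge0.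
have V0 : 0 < T^-1 by rewrite invr_gt0.
pose c (n : nat) := 2 / T - T^-1 * n.+1%:R^-1.
pose d (n : nat) := 2 / T - T^-1 * n.+1%:R^-1 / 2.
have n1 n : n.+1%:R^-1 <= 1 :> R by rewrite invf_le1// ler1n.
have n0 n : 0 < n.+1%:R^-1 :> R by rewrite invr_gt0.
have bounds n : [/\ 0 < c n, c n < d n & d n < 2 / T].
  have := n1 n; have := n0 n; rewrite /c /d; move: (n.+1%:R^-1) (T^-1) V0 => q v v0 q0 q1.
  have : 0 < v * q by exact: mulr_gt0.
  have : v * q <= v by rewrite ler_piMr// ltW.
  by move: (v * q) => r r1 r0; split; lra.
apply: (@cvg_le_bound (fun n => \int[mu]_(x in `[A 0, B 0]) tsq (c n) (w x 0))).
  apply: (tsq_cvg_cut (uw.2 0)) => //; last first.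
    by move=> n; have [_ h1 h2] := bounds n; exact: lt_trans h1 h2.
  rewrite -[X in _ --> X]subr0; apply: cvgB; first exact: cvg_cst.
  by rewrite -[X in _ --> X](mulr0 T^-1); apply: cvgMr; exact: cvg_harmonic.
by move=> n; have [h0 h1 h2] := bounds n; exact: (energy_lower_cut uw weak T0 h0 h1 h2).
Qed.

Lemma ray_le_line t x : \int[mu]_(y in `]-oo, x]) w y t ^+ 2 <= \int[mu]_y w y t ^+ 2.
Proof.
have i2 := finite_energy_sqr_integrableT (uw.2 t).
rewrite -subr_ge0; apply: (@cvg_to_ge0 R nat \oo _ (fun n => \int[mu]_(y in `[x, x + n%:R]) w y t ^+ 2)).
  exact: (@cvg_coray R (fun y => w y t ^+ 2) x i2).
by apply: nearW => n; exact: sqr_Rintegral_ge0.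
Qed.

Let I0 : 0 <= (0 : R) <= T. Proof. by rewrite lexx ltW. Qed.
Let IT : 0 <= T <= T. Proof. by rewrite lexx ltW. Qed.

(** The half-line is exhausted by the intervals from [A 0 - n%:R] to [A 0]; a characteristic from
    the left end is capped by [A], in case it crosses it. *)
Lemma energy_lower_ray (A : R -> R) : charac u 0 T A ->
  \int[mu]_(y in `]-oo, A 0]) tsq (2 / T) (w y 0) <= \int[mu]_(y in `]-oo, A T]) w y T ^+ 2.
Proof.
move=> Ach; have [Z HZ] := charac_flow_exists uw (ltW T0).
have cv := @cvg_ray R (fun y => tsq (2 / T) (w y 0)) (A 0) (tsq_integrable (uw.2 0) (2 / T) measurableT).
apply: (cvg_le_bound cv) => n.
pose B t := Num.min (Z (A 0 - n%:R) t) (A t).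
have Bch : charac u 0 T B by apply: charac_min => //; exact: (HZ _).2.
have BA t : 0 <= t <= T -> B t <= A t by move=> _; rewrite ge_min lexx orbT.
have B0 : B 0 = A 0 - n%:R by rewrite /B (HZ _).1; apply/min_idPl; rewrite gerBl.
rewrite -B0; apply: (le_trans (energy_lower Bch Ach BA)).
by rewrite (ray_split (uw.2 T) (BA T IT)) lerDr sqr_Rintegral_ge0.
Qed.

Lemma energy_lower_coray (A : R -> R) : charac u 0 T A ->
  \int[mu]_y tsq (2 / T) (w y 0) - \int[mu]_(y in `]-oo, A 0]) tsq (2 / T) (w y 0) <=
  \int[mu]_y w y T ^+ 2 - \int[mu]_(y in `]-oo, A T]) w y T ^+ 2.
Proof.
move=> Ach; have [Z HZ] := charac_flow_exists uw (ltW T0).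
have cv := @cvg_coray R (fun y => tsq (2 / T) (w y 0)) (A 0) (tsq_integrable (uw.2 0) (2 / T) measurableT).
apply: (cvg_le_bound cv) => n.
pose B t := Num.max (Z (A 0 + n%:R) t) (A t).
have Bch : charac u 0 T B by apply: charac_max => //; exact: (HZ _).2.
have AB t : 0 <= t <= T -> A t <= B t by move=> _; rewrite le_max lexx orbT.
have B0 : B 0 = A 0 + n%:R by rewrite /B (HZ _).1; apply/max_idPl; rewrite lerDl.
rewrite -B0; apply: (le_trans (energy_lower Ach Bch AB)).
by rewrite lerBrDl -(ray_split (uw.2 T) (AB T IT)); exact: ray_le_line.
Qed.

Lemma energy_lower_line : \int[mu]_y tsq (2 / T) (w y 0) <= \int[mu]_y w y T ^+ 2.
Proof.
have [Z HZ] := charac_flow_exists uw (ltW T0).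
have := energy_lower_ray (HZ 0).2; have := energy_lower_coray (HZ 0).2; lra.
Qed.

End LowerBounds.

(** * Upper bound for the energy of the dissipative solution *)

Section UpperBounds.
Context {R : realType}.
Local Notation mu := (@lebesgue_measure R).
Implicit Types (a b c d t x y : R).

Lemma ae_le_Rintegral_cst (f : R -> R) a b M : a <= b -> mu.-integrable `[a, b] (EFin \o f) ->
  {ae mu, forall x, a <= x <= b -> f x <= M} -> \int[mu]_(x in `[a, b]) f x <= M * (b - a).
Proof.
move=> ab fi fM; have mf := integrable_measurable fi.
have mm : measurable_fun `[a, b] (fun x => Num.min (f x) M).
  by apply: measurable_minr => //; exact: measurable_cst.
have -> : \int[mu]_(x in `[a, b]) f x = \int[mu]_(x in `[a, b]) Num.min (f x) M.
  congr fine; apply: ae_eq_integral => //; [exact/measurable_EFinP|exact/measurable_EFinP|].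
  apply: (@filterS _ _ (ae_filter_ringOfSetsType mu) _ _ _ fM) => x h xab /=; congr EFin.
  by apply/esym/min_idPl/h; move: xab; rewrite /= in_itv.
apply: le_Rintegral_cst => //.
  apply: (integrable_le (h := fun x => `|f x| + `|M|)) => //.
    apply: integrable_add => //; [exact: (integrable_norm fi)|exact: integrable_cst_itv].
  move=> x _; case: (leP (f x) M) => _; [by rewrite lerDl|by rewrite lerDr].
by move=> x _; rewrite ge_min lexx orbT.
Qed.

Lemma le_sum_subset N (P Q : pred 'I_N) (F : 'I_N -> R) : (forall k, 0 <= F k) ->
  (forall k, P k -> Q k) -> \sum_(k | P k) F k <= \sum_(k | Q k) F k.
Proof.
move=> F0 PQ; rewrite [leRHS](bigID P)/= (eq_bigl P) => [|k]; first by rewrite lerDl sumr_ge0.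
by rewrite andbC; case Pk : (P k) => //=; exact: PQ.
Qed.

Variables (C C0 : R) (u w : R -> R -> R) (u0 w0 : R -> R).
Hypothesis uw : finite_energy_flow C u w.
Hypothesis weak : source_identity u w.
Hypothesis uw0 : finite_energy C0 u0 w0.
Hypothesis onesided : forall K : set (R * R), compact K -> K `<=` [set p | 0 < p.2] ->
  exists M : R, forall t, {ae mu, forall x, K (x, t) -> w x t <= M}.

Lemma sqr_dist_integrable t (D : set R) : measurable D ->
  mu.-integrable D (EFin \o (fun x => (w x t - w0 x) ^+ 2)).
Proof.
move=> mD; have [_ mw _] := uw.2 t; have [_ mw0 _] := uw0.
apply: (integrable_le (h := fun x => 2 * w x t ^+ 2 + 2 * w0 x ^+ 2)) => //.
- apply: (measurable_funS measurableT) => //.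
  by apply: (measurable_funX 2); apply: measurable_funB.
- by apply: integrable_add => //; apply: integrable_scale => //;
    [exact: (finite_energy_sqr_integrable (uw.2 t))|exact: (finite_energy_sqr_integrable uw0)].
- move=> x _; rewrite ger0_norm ?sqr_ge0//.
  have := sqr_ge0 (w x t + w0 x); nra.
Qed.

(** Integrates the upper bound of [w] on a compact rectangle: an Oleinik-type one-sided Lipschitz
    bound, uniform in time as long as time stays away from [0]. *)
Lemma uniform_oleinik M ta tb : 0 < ta -> exists2 K, 0 <= K & forall t x y, ta <= t <= tb ->
  - M <= x -> x <= y -> y <= M -> u y t - u x t <= K * (y - x).
Proof.
move=> ta0.
have cK : compact (`[- M, M]%classic `*` `[ta, tb]%classic) by apply: compact_setX; exact: segment_compact.
have [|K HK] := onesided cK.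
  by move=> [x t] /= [_]; rewrite in_itv/= => /andP[h _]; exact: lt_le_trans h.
exists (Num.max K 0) => [|t x y tab Mx xy yM]; first by rewrite le_max lexx orbT.
rewrite -(finite_energy_FTC (uw.2 t) xy).
apply: ae_le_Rintegral_cst => //; first exact: (finite_energy_integrable (uw.2 t)).
apply: (@filterS _ _ (ae_filter_ringOfSetsType mu) _ _ _ (HK t)) => z h /andP[z1 z2].
rewrite le_max h//; split; rewrite /= in_itv//=; apply/andP; split; lra.
Qed.

(** The common bound [M] confines all backward characteristics from [[a, b]] to one strip, hence to
    one rectangle for [uniform_oleinik], before any mesh is chosen. *)
Lemma backward_flow_exists T a b : 0 <= T -> a <= b -> exists (M : R) (Z : R -> R -> R),
  forall y, a <= y <= b -> [/\ Z y T = y, charac u 0 T (Z y) &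
    forall t, 0 <= t <= T -> `|Z y t| <= M].
Proof.
move=> T0 ab; pose L := Num.max `|a| `|b|.
have L0 : 0 <= L by rewrite le_max normr_ge0.
have [M HM] := charac_exists uw T0 L0; exists M.
have H y : exists x : R -> R, a <= y <= b -> [/\ x T = y, charac u 0 T x &
    forall t, 0 <= t <= T -> `|x t| <= M].
  have [yab|nyab] := boolP (a <= y <= b); last by exists (fun=> 0).
  have TI : 0 <= T <= T by rewrite lexx T0.
  have yL : `|y| <= L.
    case/andP: yab => h1 h2; rewrite ler_norml /L lerNl !le_max -normrN.
    by rewrite (le_trans _ (ler_norm (- a))) ?lerN2//= (le_trans h2 (ler_norm b)) orbT.
  by have [x Hx] := HM T y TI yL; exists x.
by have [Z HZ] := choice H; exists Z.
Qed.

(* The mesh is equal at time [T] and the characteristics run backwards to [tau].  Narrow cells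
   whose slope at [tau] lies below [- 2 / (T - tau)] are short at time [T] by [charac_pair_upper]. *)
Lemma energy_upper_step T tau c d al K a b : 0 < tau -> tau < T -> 2 / (T - tau) <= d ->
  0 <= al -> 0 <= K -> (forall y z, tsq d y <= (1 + al) * tsq c z + K * (y - z) ^+ 2) ->
  a < b -> sqint (w ^~ T) a b <=
    (1 + al) * \int[mu]_x tsq c (w0 x) + 2 * K * \int[mu]_x (w x tau - w0 x) ^+ 2.
Proof.
move=> tau0 tauT dT al0 K0 HK ab.
have T0 := lt_trans tau0 tauT.
have [Mb [Z HZ]] := backward_flow_exists (ltW T0) (ltW ab).
have [M M0 HM] := uniform_oleinik Mb T tau0.
have Itau : tau <= tau <= T by rewrite lexx ltW.
have IT : tau <= T <= T by rewrite lexx ltW.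
have sub t : tau <= t <= T -> 0 <= t <= T by move=> /andP[h1 h2]; rewrite h2 (le_trans (ltW tau0)).
pose N n := (n.+1 ^ 2)%N.
(* Capped at [b], since [Z] is controlled only on [[a, b]] while [k] ranges over all naturals. *)
pose yy n k := Num.min b (mesh a b n k).
have yyI n k : a <= yy n k <= b.
  rewrite /yy le_min (ltW ab)/= ge_min lexx/= andbT.
  by rewrite /mesh lerDl mulr_ge0// divr_ge0// subr_ge0 ltW.
have yyle n k : yy n k <= yy n k.+1 by rewrite /yy; apply: le_min2 => //; exact: mesh_le (ltW ab).
pose X n := running_max (fun k => Z (yy n k)).
have Xch n k : charac u tau T (X n k).
  apply: charac_running_max => j; have [_ h _] := HZ _ (yyI n j).
  exact: charac_sub (ltW tau0) (lexx T) h.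
have Xle n k t : tau <= t <= T -> X n k t <= X n k.+1 t by move=> _; exact: running_max_le.
have XM n k t : tau <= t <= T -> `|X n k t| <= Mb.
  by move=> tI; apply: running_max_bounded => j; have [_ _ ->//] := HZ _ (yyI n j); exact: sub.
have XT n k : (k <= N n)%N -> X n k T = mesh a b n k.
  move=> kN; have /andP[_ h2] := mesh_bounds (ltW ab) kN.
  rewrite /X running_max_mono => [|j]; last first.
    by have [-> _ _] := HZ _ (yyI n j); have [-> _ _] := HZ _ (yyI n j.+1).
  by have [-> _ _] := HZ _ (yyI n k); rewrite /yy; apply/min_idPr.
pose eps n := (b - a) * n.+1%:R^-1.
pose eta n := (b - a) / (N n)%:R.
pose ht n k := X n k.+1 tau - X n k tau.
pose G n k := ht n k <= eps n.
have ba : 0 < b - a by rewrite subr_gt0.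
have N0 n : 0 < (N n)%:R :> R by rewrite ltr0n expn_gt0.
have eta0 n : 0 < eta n by exact: divr_gt0.
have eps_gt0 n : 0 < eps n by rewrite mulr_gt0// invr_gt0.
have etaE n : eta n = eps n * n.+1%:R^-1.
  by rewrite /eta /eps /N natrX -exprVn expr2 mulrA.
have V1 n : n.+1%:R^-1 <= 1 :> R by rewrite invf_le1// ler1n.
have eta_eps n : eta n <= eps n by rewrite etaE ler_piMr// ltW.
have hTE n k : (k < N n)%N -> X n k.+1 T - X n k T = eta n.
  by move=> kN; rewrite !XT//; [rewrite meshS|exact: ltnW].
have Gle n k : (k < N n)%N -> G n k -> X n k.+1 tau - X n k tau <= eps n /\ X n k.+1 T - X n k T <= eps n.
  by move=> kN Gk; rewrite hTE.
have eps0 : eps @ \oo --> 0.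
  by rewrite -[X in _ --> X](mulr0 (b - a)); apply: cvgMr; exact: cvg_harmonic.
have tau0' := ltW tau0; have tauT' := ltW tauT.
have Vc := gap_integral_sum_cvg uw weak tau0' tauT' Xch Xle Gle eps0.
have Gc1 := gap_sum_cvg uw weak tau0' tauT' Xch Xle Gle eps0 Itau.
have Gc2 := gap_sum_cvg uw weak tau0' tauT' Xch Xle Gle eps0 IT.
pose kappa := expR (- M * (T - tau) / 2).
have kap0 : 0 < kappa by exact: expR_gt0.
(* The constant in the second alternative of [charac_pair_upper]: a cell with too low a slope at
   [tau] has length at most [q] times its integrated gap. *)
pose q := (T - tau) / (4 * kappa).
have q0 : 0 <= q by rewrite divr_ge0//; [lra|rewrite mulr_ge0// ltW].
have Mk0 : 0 <= M / kappa by rewrite divr_ge0// ltW.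
have K2 : 0 <= 2 * K by rewrite mulr_ge0.
pose k1 := 1 + M / kappa + 2 * K + 1.
have k10 : 0 <= k1 by rewrite !addr_ge0.
apply: (le_of_scaled_error k10) => ep ep0.
have [dl dl0 Hdl] := small_cells (uw.2 T) ep0.
pose D := 2 * Mb.
have bad0 : D * n.+1%:R^-1 @[n --> \oo] --> (0 : R).
  by rewrite -[X in _ --> X](mulr0 D); apply: cvgMr; exact: cvg_harmonic.
have dl2 : 0 < dl / 2 by rewrite divr_gt0.
have q1 : 0 < q + 1 by rewrite ltr_wpDl.
have e1 : 0 < Num.min ep (dl / 2 / (q + 1)) by rewrite lt_min ep0 divr_gt0.
move/cvgrPdist_lt : Vc => /(_ _ e1) Vc; move/cvgrPdist_lt : Gc1 => /(_ _ ep0) Gc1.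
move/cvgrPdist_lt : Gc2 => /(_ _ ep0) Gc2; move/cvgrPdist_lt : bad0 => /(_ _ dl2) bad0.
have [n _ /(_ n (leqnn n)) [[[]]]] := filterI (filterI (filterI Vc Gc1) Gc2) bad0.
rewrite !sub0r !normrN lt_min => /andP[{}Vc Vq] {}Gc1 {}Gc2 {}bad0.
pose ig k := \int[mu]_(t in `[tau, T]) charac_gap u w (X n k) (X n k.+1) t.
have gap0 k t : tau <= t <= T -> 0 <= charac_gap u w (X n k) (X n k.+1) t.
  by move=> tI; have /andP[] := charac_gap_bounds uw (fun t => Xle n k t) tI.
have ig0 k : 0 <= ig k.
  by apply: Rintegral_ge0 => t; rewrite /= in_itv/=; exact: gap0.
have ht0 k : 0 <= ht n k by rewrite subr_ge0 Xle.
pose om k := (u (X n k.+1 tau) tau - u (X n k tau) tau) / (X n k.+1 tau - X n k tau).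
(* Cells to be compared with the initial data. The others are either narrow with a low slope or wide
   at [tau], and in both cases have small total length at time [T]. *)
pose P k := G n k && (- (2 / (T - tau)) < om k).
have up k : (k < N n)%N -> [/\ X n k tau < X n k.+1 tau,
      (u (X n k.+1 T) T - u (X n k T) T) ^+ 2 / (X n k.+1 T - X n k T) <=
      (u (X n k.+1 tau) tau - u (X n k tau) tau) ^+ 2 / (X n k.+1 tau - X n k tau) + M / kappa * ig k &
    - (2 / (T - tau)) < om k \/ eta n <= q * ig k].
  move=> kN; have hk : X n k T < X n k.+1 T by rewrite -subr_gt0 hTE.
  have [t /[dup] tI /andP[t1 t2]|] := charac_pair_upper uw weak tau0' tauT' (Xch n k) (Xch n k.+1) (fun t => Xle n k t) tauT hk M0.
    have := XM n k t tI; have := XM n k.+1 t tI; rewrite !ler_norml => /andP[_ h1] /andP[h2 _].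
    by apply: HM => //; exact: Xle.
  by rewrite hTE.
have badP : \sum_(k < N n | ~~ P k) sqint (w ^~ T) (X n k T) (X n k.+1 T) <= ep.
  apply: (Hdl (N n) (fun k => X n k T) (fun k => ~~ P k)); first by move=> k _; exact: Xle.
  rewrite (eq_bigr (fun=> eta n)); last by move=> k _; exact: hTE.
  rewrite (bigID (fun k : 'I_(N n) => G n k))/=.
  have b1 : \sum_(k < N n | ~~ P k && G n k) eta n <= q * \sum_(k < N n | G n k) ig k.
    rewrite mulr_sumr; apply: (@le_trans _ _ (\sum_(k < N n | ~~ P k && G n k) q * ig k)).
      apply: ler_sum => k /andP[nP Gk]; have [_ _ []//] := up k (ltn_ord k).
      by move: nP; rewrite /P Gk/= => /negP.
    by apply: le_sum_subset => [k|k /andP[]//]; rewrite mulr_ge0.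
  have b2 : \sum_(k < N n | ~~ P k && ~~ G n k) eta n <= D * n.+1%:R^-1.
    have hD : \sum_(k < N n) ht n k <= D.
      rewrite (telescope_ord (fun k => X n k tau)).
      have := XM n (N n) tau Itau; have := XM n 0%N tau Itau; rewrite !ler_norml /D.
      by move=> /andP[h1 _] /andP[_ h2]; lra.
    apply: (@le_trans _ _ (\sum_(k < N n | ~~ G n k) eta n)).
      by apply: le_sum_subset => [k|k /andP[]//]; exact: ltW.
    apply: le_trans (bad_cells_length (eps_gt0 n) (ltW (eta0 n)) (fun k _ => ht0 k) hD) _.
    rewrite etaE; have := eps_gt0 n; move: (eps n) (n.+1%:R^-1) => e v e0.
    by rewrite (_ : e * v * D / e = D * v)//; field; rewrite gt_eqF.
  have b3 : q * \sum_(k < N n | G n k) ig k <= dl / 2.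
    have h : \sum_(k < N n | G n k) ig k <= dl / 2 / (q + 1) by exact: le_trans (ler_norm _) (ltW Vq).
    have := ler_wpM2l q0 h => h'; apply: le_trans h' _.
    by rewrite mulrCA ler_piMr ?(ltW dl2)// ler_pdivrMr// mul1r lerDl.
  have b4 : D * n.+1%:R^-1 < dl / 2 by exact: le_lt_trans (ler_norm _) bad0.
  by apply: le_lt_trans (lerD b1 b2) _; rewrite [ltRHS]splitr; exact: ler_ltD.
have i0 D' (mD : measurable D') := tsq_integrable uw0 c mD.
have cell k : (k < N n)%N -> P k -> sqint (w ^~ T) (X n k T) (X n k.+1 T) <=
    charac_gap u w (X n k) (X n k.+1) T + M / kappa * ig k +
    (2 * K * charac_gap u w (X n k) (X n k.+1) tau +
    ((1 + al) * (\int[mu]_(x in `[X n k tau, X n k.+1 tau]) tsq c (w0 x)) +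
     2 * K * (\int[mu]_(x in `[X n k tau, X n k.+1 tau]) (w x tau - w0 x) ^+ 2))).
  move=> kN /andP[Gk omk]; have [hk h2 _] := up k kN.
  set J := `[X n k tau, X n k.+1 tau]%classic.
  have mJ : measurable J by exact: measurable_itv.
  have i1 := i0 J mJ; have i2 := sqr_dist_integrable tau mJ.
  have i3 : mu.-integrable J (EFin \o (fun x => (w x tau - om k) ^+ 2)).
    rewrite (_ : (fun x => _) = fun x => w x tau ^+ 2 - 2 * om k * w x tau + om k ^+ 2); last first.
      by apply/funext => x; ring.
    apply: integrable_add => //; last exact: integrable_cst_itv.
    apply: integrable_sub => //; first exact: (finite_energy_sqr_integrable (uw.2 tau)).
    by apply: integrable_scale => //; exact: (finite_energy_integrable (uw.2 tau)).
  have tau_bound : (u (X n k.+1 tau) tau - u (X n k tau) tau) ^+ 2 / (X n k.+1 tau - X n k tau) <=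
     2 * K * charac_gap u w (X n k) (X n k.+1) tau +
    ((1 + al) * (\int[mu]_(x in J) tsq c (w0 x)) + 2 * K * (\int[mu]_(x in J) (w x tau - w0 x) ^+ 2)).
    have -> : (u (X n k.+1 tau) tau - u (X n k tau) tau) ^+ 2 / (X n k.+1 tau - X n k tau) =
        tsq d (om k) * (X n k.+1 tau - X n k tau).
      (* The slope passes the cut at [d], because [2 / (T - tau) <= d]. *)
      rewrite /tsq ifT; last by apply: le_lt_trans omk; rewrite lerN2.
      by rewrite /om; field; rewrite subr_eq0 gt_eqF.
    rewrite -Rintegral_cst_itv ?(ltW hk)// -/J.
    rewrite /charac_gap -(sqint_avg (uw.2 tau) hk) -/(om k) -/J.
    rewrite -!RintegralZl// -RintegralD//; [|exact: integrable_scale..].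
    rewrite -RintegralD//; [|exact: integrable_scale|by apply: integrable_add => //; exact: integrable_scale].
    apply: le_Rintegral => //; first exact: integrable_cst_itv.
      apply: integrable_add => //; [exact: integrable_scale|].
      by apply: integrable_add => //; exact: integrable_scale.
    (* The mean slope is compared with [w0] through [w] at time [tau]; splitting the square costs
       the factor in [2 * K], and yields the variance at [tau] plus the distance to the initial
       data. *)
    move=> x _; apply: le_trans (HK (om k) (w0 x)) _.
    have -> : om k - w0 x = (om k - w x tau) + (w x tau - w0 x) by ring.
    rewrite -[(w x tau - om k) ^+ 2]sqrrN opprB.
    move: (om k - w x tau) (w x tau - w0 x) (tsq c (w0 x)) => r s t.
    have : 0 <= K * (r - s) ^+ 2 by rewrite mulr_ge0// sqr_ge0.
    have -> : K * (r - s) ^+ 2 = 2 * K * r ^+ 2 + 2 * K * s ^+ 2 - K * (r + s) ^+ 2 by ring.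
    lra.
  have -> : sqint (w ^~ T) (X n k T) (X n k.+1 T) = charac_gap u w (X n k) (X n k.+1) T +
     (u (X n k.+1 T) T - u (X n k T) T) ^+ 2 / (X n k.+1 T - X n k T) by rewrite /charac_gap subrK.
  rewrite -[X in _ <= X]addrA; apply: lerD => //; apply: (le_trans h2).
  by rewrite [X in X <= _]addrC; exact: lerD.
have [_ ET] := sum_sqint (N := N n) (p := fun k => X n k T) (uw.2 T) (fun k _ => Xle n k T IT).
have -> : sqint (w ^~ T) a b = \sum_(k < N n) sqint (w ^~ T) (X n k T) (X n k.+1 T).
  by rewrite ET !XT// mesh0 meshN.
rewrite (bigID (fun k : 'I_(N n) => P k))/=.
have disj (f : R -> R) : (forall x, 0 <= f x) -> mu.-integrable setT (EFin \o f) ->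
    \sum_(k < N n | P k) \int[mu]_(x in `[X n k tau, X n k.+1 tau]) f x <= \int[mu]_x f x.
  move=> f0 fi.
  apply: le_trans (sum_Rintegral_disjoint (n := N n) (s := fun k => X n k tau) (t := fun k => X n k.+1 tau) f0 fi _).
    by apply: le_sum_subset => // k; exact: Rintegral_ge0.
  have mono i j : (i <= j)%N -> X n i tau <= X n j tau.
    elim: j => [|j IH]; first by rewrite leqn0 => /eqP->.
    rewrite leq_eqVlt => /predU1P[->//|]; rewrite ltnS => ij.
    by apply: le_trans (IH ij) _; exact: Xle.
  by move=> i j iN jN /eqP; rewrite neq_ltn => /orP[ij|ij]; [left|right]; exact: mono.
have PG (F : nat -> R) : (forall k, 0 <= F k) -> \sum_(k < N n | P k) F k <= \sum_(k < N n | G n k) F k.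
  by move=> F0; apply: le_sum_subset => [k|k /andP[]//].
have goodP : \sum_(k < N n | P k) sqint (w ^~ T) (X n k T) (X n k.+1 T) <=
   ep + M / kappa * ep + (2 * K * ep + ((1 + al) * (\int[mu]_x tsq c (w0 x)) +
     2 * K * \int[mu]_x (w x tau - w0 x) ^+ 2)).
  apply: (@le_trans _ _ (\sum_(k < N n | P k) (charac_gap u w (X n k) (X n k.+1) T + M / kappa * ig k +
    (2 * K * charac_gap u w (X n k) (X n k.+1) tau +
    ((1 + al) * (\int[mu]_(x in `[X n k tau, X n k.+1 tau]) tsq c (w0 x)) +
     2 * K * (\int[mu]_(x in `[X n k tau, X n k.+1 tau]) (w x tau - w0 x) ^+ 2)))))).
    by apply: ler_sum => k Pk; exact: cell.
  rewrite !big_split/= -!mulr_sumr.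
  apply: lerD; apply: lerD; last apply: lerD.
  - rewrite -big_split/=.
    have := PG (fun k => charac_gap u w (X n k) (X n k.+1) T) (fun k => gap0 k T IT).
    by move=> /le_trans; apply; exact: le_trans (ler_norm _) (ltW Gc2).
  - by rewrite ler_wpM2l//; apply: le_trans (PG ig ig0) _; exact: le_trans (ler_norm _) (ltW Vc).
  - rewrite ler_wpM2l//; apply: le_trans (PG (fun k => charac_gap u w (X n k) (X n k.+1) tau) (fun k => gap0 k tau Itau)) _.
    exact: le_trans (ler_norm _) (ltW Gc1).
  - rewrite ler_wpM2l//; first by rewrite addr_ge0.
    by apply: disj => [x|]; [exact: tsq_ge0|exact: i0].
  - by rewrite ler_wpM2l//; apply: disj => [x|]; [exact: sqr_ge0|exact: sqr_dist_integrable].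
apply: le_trans (lerD goodP badP) _; rewrite /k1; move: (M / kappa) => q'.
by rewrite le_eqVlt; apply/orP; left; apply/eqP; ring.
Qed.

End UpperBounds.

(** * Backward estimate down to time zero, and the exact threshold *)

Section EnergyUpper.
Context {R : realType}.
Local Notation mu := (@lebesgue_measure R).
Implicit Types (a b c d t x y : R).

Variables (C C0 : R) (u w : R -> R -> R) (u0 w0 : R -> R).
Hypothesis uw : finite_energy_flow C u w.
Hypothesis weak : source_identity u w.
Hypothesis uw0 : finite_energy C0 u0 w0.
Hypothesis onesided : forall K : set (R * R), compact K -> K `<=` [set p | 0 < p.2] ->
  exists M : R, forall t, {ae mu, forall x, K (x, t) -> w x t <= M}.
Hypothesis trace : (fun t => (\int[mu]_x (((w x t - w0 x) ^+ 2)%:E))%E) @ 0^'+ --> 0%E.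

(** In [energy_upper_step] the constants [al] and [K] are fixed before [tau], so the strong
    convergence of [w] to [w0] removes the last term as [tau] tends to [0]. *)
Lemma energy_upper_cut T c a b : 0 < T -> 2 / T < c -> a < b ->
  sqint (w ^~ T) a b <= \int[mu]_x tsq c (w0 x).
Proof.
move=> T0 Tc ab; have T2 : 0 < 2 / T by exact: divr_gt0.
(* Room on both sides: [d < c] for [tsq_compare], and [2 / T < d] so that [2 / (T - tau) <= d] once
   [tau < T - 2 / d]. *)
pose d := (2 / T + c) / 2.
have [Td dc] : 2 / T < d /\ d < c by rewrite /d; move: (2 / T) Tc => q h; split; lra.
have d0 : 0 < d by exact: lt_trans Td.
pose I := \int[mu]_x tsq c (w0 x).
have I0 : 0 <= I by apply: Rintegral_ge0 => x _; exact: tsq_ge0.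
apply: (le_of_scaled_error I0) => al al0.
have [K K0 HK] := tsq_compare d0 dc al0.
have K2 : 0 <= 2 * K by rewrite mulr_ge0.
apply: (le_of_scaled_error K2) => ep ep0.
have Td' : 0 < T - 2 / d.
  by move: Td; rewrite ltr_pdivrMr// => h; rewrite subr_gt0 ltr_pdivrMr// mulrC.
have e0E : (0 < ep%:E)%E by rewrite lte_fin.
have h1 : \forall t \near 0^'+, (\int[mu]_x ((w x t - w0 x) ^+ 2)%:E < ep%:E)%E.
  exact: trace (open_nbhs_nbhs (conj (@open_ereal_lt_ereal R ep%:E) e0E)).
have h2 : \forall t \near (0 : R)^'+, 0 < t by exact: nbhs_right_gt.
have h3 : \forall t \near (0 : R)^'+, t < T - 2 / d by exact: nbhs_right_lt.
have [tau [[tau1 tau0] tauT]] : exists tau, ((\int[mu]_x ((w x tau - w0 x) ^+ 2)%:E < ep%:E)%E /\ 0 < tau) /\ tau < T - 2 / d.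
  have H : \forall t \near (0 : R)^'+, ((\int[mu]_x ((w x t - w0 x) ^+ 2)%:E < ep%:E)%E /\ 0 < t) /\ t < T - 2 / d.
    by apply: filterI => //; exact: filterI.
  exact: (@filter_ex _ (0 : R)^'+ _ _ H).
have d2 : 0 < 2 / d by exact: divr_gt0.
have tT : tau < T by lra.
have dist : \int[mu]_x (w x tau - w0 x) ^+ 2 <= ep.
  rewrite -lee_fin EFin_Rintegral//; first exact: ltW.
  exact: (sqr_dist_integrable uw uw0).
have step := @energy_upper_step R C C0 u w u0 w0 uw weak uw0 onesided T tau c d al K a b tau0 tT.
apply: (le_trans (step _ (ltW al0) K0 HK ab)).
  rewrite ler_pdivrMr ?subr_gt0// mulrC -ler_pdivrMr//; lra.
rewrite -/I mulrDl mul1r [al * I]mulrC; apply: lerD => //.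
by apply: ler_wpM2l.
Qed.

(* At times [s > T] the cut [2 / T] is larger than [2 / s], so [energy_upper_cut] applies with
   [c = 2 / T]; the energy is lower semicontinuous as [s] decreases to [T]. *)
Lemma energy_upper_itv T a b : 0 < T -> a < b ->
  sqint (w ^~ T) a b <= \int[mu]_x tsq (2 / T) (w0 x).
Proof.
move=> T0 ab; set I := \int[mu]_x _.
(* A lower approximation of the energy on [[a, b]] that is continuous in [s], because it involves
   only [u]. It transfers the bound from times [s > T] to [T]; then the mesh is refined. *)
pose S n s := \sum_(k < n.+1 ^ 2) (u (mesh a b n k.+1) s - u (mesh a b n k) s) ^+ 2 / (mesh a b n k.+1 - mesh a b n k).
have ml n k : mesh a b n k <= mesh a b n k.+1 by exact: mesh_le (ltW ab).
have later n s : T < s -> S n s <= I.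
  move=> Ts; apply: (@le_trans _ _ (sqint (w ^~ s) a b)); last first.
    by apply: energy_upper_cut => //; [exact: lt_trans Ts|rewrite ltr_pM2l// ltf_pV2// posrE (lt_trans T0)].
  have [_ E] := sum_sqint (N := (n.+1 ^ 2)%N) (p := mesh a b n) (uw.2 s) (fun k _ => ml n k).
  rewrite -{1}(mesh0 a b n) -{2}(meshN a b n) -E; apply: ler_sum => k _.
  exact: (incr_quot_le_sqint (uw.2 s)).
have now n : S n T <= I.
  have cvT : S n s @[s --> T^'+] --> S n T.
    apply: cvg_at_right_filter; rewrite /S; move: (n.+1 ^ 2)%N => m.
    elim: m => [|m IH]; first by rewrite big_ord0; under eq_fun do rewrite big_ord0; exact: cvg_cst.
    rewrite big_ord_recr/=; under eq_fun do rewrite big_ord_recr/=.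
    apply: cvgD => //; apply: cvgM; last exact: cvg_cst.
    have cc x : {for T, continuous (fun s => u x s)}.
      by apply: (@cont2_comp R u (fun=> x) T uw.1); exact: cvg_cst.
    by apply: (@cont_sqr R (fun s => u (mesh a b n m.+1) s - u (mesh a b n m) s)); apply: cvgB; exact: cc.
  rewrite -subr_ge0; apply: (@cvg_to_ge0 R R (T^'+) _ (fun s => I - S n s)).
    by apply: cvgB => //; exact: cvg_cst.
  have h : \forall s \near T^'+, T < s by exact: nbhs_right_gt.
  by apply: filterS h => s Ts; rewrite subr_ge0; exact: later.
have eps0 : (fun n => (b - a) * n.+1%:R^-1) @ \oo --> (0 : R).
  by rewrite -[X in _ --> X](mulr0 (b - a)); apply: cvgMr; exact: cvg_harmonic.
have V := @variance_cvg R C (u ^~ T) (w ^~ T) (uw.2 T) (fun n => (n.+1 ^ 2)%N) (mesh a b) (fun _ _ => true) _ (fun n k _ => ml n k) _ eps0.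
apply: (@le_trans _ _ (I + 0)); last by rewrite addr0.
rewrite -subr_ge0 -addrA.
have hm n k : (k < n.+1 ^ 2)%N -> true -> mesh a b n k.+1 - mesh a b n k <= (b - a) * n.+1%:R^-1.
  move=> _ _; rewrite meshS ler_pM2l ?subr_gt0// lef_pV2 ?posrE ?ltr0n ?expn_gt0//.
  by rewrite ler_nat expnS expn1 leq_pmulr.
pose W n := \sum_(k < n.+1 ^ 2) (sqint (w ^~ T) (mesh a b n k) (mesh a b n k.+1) -
  (u (mesh a b n k.+1) T - u (mesh a b n k) T) ^+ 2 / (mesh a b n k.+1 - mesh a b n k)).
apply: (@cvg_to_ge0 R nat \oo _ (fun n => I + (W n - sqint (w ^~ T) a b))).
  by apply: cvgD; [exact: cvg_cst|apply: cvgB; [exact: V hm|exact: cvg_cst]].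
apply: nearW => n; rewrite /W sumrB -/(S n T).
have [_ ->] := sum_sqint (N := (n.+1 ^ 2)%N) (p := mesh a b n) (uw.2 T) (fun k _ => ml n k).
rewrite mesh0 meshN; have := now n; move: (sqint _ _ _) (S n T) => q s; lra.
Qed.

Lemma energy_upper T : 0 < T -> \int[mu]_x w x T ^+ 2 <= \int[mu]_x tsq (2 / T) (w0 x).
Proof.
move=> T0; have i2 := finite_energy_sqr_integrableT (uw.2 T).
have c1 := @cvg_ray R (fun x => w x T ^+ 2) 0 i2; have c2 := @cvg_coray R (fun x => w x T ^+ 2) 0 i2.
have cv := cvgD c1 c2; rewrite subrKC in cv.
apply: (@cvg_le_bound R (fun n => sqint (w ^~ T) (0 - n%:R) 0 + sqint (w ^~ T) 0 (0 + n%:R))) => [|n].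
  exact: cv.
rewrite sub0r add0r -(sqint_split (uw.2 T)) ?oppr_le0//.
have [->|n0] := eqVneq n 0%N.
  by rewrite oppr0 /sqint Rintegral_point; apply: Rintegral_ge0 => x _; exact: tsq_ge0.
apply: energy_upper_itv => //; have : 0 < n%:R :> R by rewrite ltr0n lt0n.
lra.
Qed.

End EnergyUpper.

(** * Rigidity *)

Section Rigidity.
Context {R : realType}.
Local Notation mu := (@lebesgue_measure R).
Implicit Types (a b c s t x : R).

Section ExplicitSource.
Variables (C : R) (u w : R -> R -> R).
Hypothesis uw : finite_energy_flow C u w.
Hypothesis weak : source_identity u w.
Hypothesis least : forall t, 0 < t -> \int[mu]_x w x t ^+ 2 <= \int[mu]_x tsq (2 / t) (w x 0).

(** The lower bounds for the two half-lines separated by [A] add up to the upper bound for the line,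
    so both are equalities; the source at [A] is therefore given by the initial data. *)
Lemma charac_explicit T (A : R -> R) t : charac u 0 T A -> 0 <= t <= T ->
  u (A t) t = u (A 0) 0 +
    \int[mu]_(s in `]0, t]) (2^-1 * \int[mu]_(x in `]-oo, A 0]) tsq (2 / s) (w x 0)).
Proof.
move=> Ach /andP[t0 tT].
have Act : charac u 0 t A by exact: charac_sub (lexx 0) tT Ach.
have := charac_source_law uw weak (lexx 0) t0 Act.
have Hi : mu.-integrable `[0, t] (EFin \o (fun r => HS_source w (A r) r)).
  apply: (@integrable_bounded _ _ _ _ C).
    by apply: (measurable_HS_source uw) => r h; exact: charac_cont Act _ h.
  by move=> r _; have /andP[h1 h2] := HS_source_bounds uw (A r) r; rewrite ger0_norm.
(* Time [0] is left out, because the cut [2 / s] has the meaningless value [0] there. *)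
rewrite -(@Rintegral_itv_obnd_cbnd _ 0 (BRight t)); last first.
  by apply: (integrableS _ _ _ Hi) => //; apply: subset_itvr; rewrite bnd_simp.
move=> /eqP; rewrite subr_eq addrC => /eqP ->; congr (_ + _).
apply: eq_Rintegral => s /set_mem/=; rewrite in_itv/= => /andP[s0 st].
have Acs : charac u 0 s A by exact: charac_sub (lexx 0) (le_trans st tT) Ach.
rewrite /HS_source; congr (_ * _); apply/eqP; rewrite eq_le.
have h1 := energy_lower_ray uw weak s0 Acs; have h2 := energy_lower_coray uw weak s0 Acs.
have h3 := least s0; rewrite h1 andbT; lra.
Qed.

End ExplicitSource.

Variables (C C' : R) (u w v z : R -> R -> R).
Hypotheses (uw : finite_energy_flow C u w) (vz : finite_energy_flow C' v z).
Hypotheses (weaku : source_identity u w) (weakv : source_identity v z).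
Hypothesis leastu : forall t, 0 < t -> \int[mu]_x w x t ^+ 2 <= \int[mu]_x tsq (2 / t) (w x 0).
Hypothesis leastv : forall t, 0 < t -> \int[mu]_x z x t ^+ 2 <= \int[mu]_x tsq (2 / t) (z x 0).
Hypothesis init : forall x, u x 0 = v x 0.
Hypothesis initw : forall c a, \int[mu]_(x in `]-oo, a]) tsq c (w x 0) =
  \int[mu]_(x in `]-oo, a]) tsq c (z x 0).

(** A characteristic of [u] is followed back from [(x, t)], and one of [v] forward from its foot. By
    [charac_explicit] their speeds are the same function of time, so they end at the same point with
    the same speed. *)
Lemma flow_rigidity x t : 0 < t -> u x t = v x t.
Proof.
move=> t0; have It : 0 <= t <= t by rewrite lexx ltW.
have [M HM] := charac_exists uw (ltW t0) (normr_ge0 x).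
have [A [At Ach _]] := HM t x It (lexx _).
have [Z HZ] := charac_flow_exists vz (ltW t0).
have [B0 Bch] := HZ (A 0); set B := Z (A 0) in B0 Bch.
have E s : 0 <= s <= t -> u (A s) s = v (B s) s.
  move=> st; rewrite (charac_explicit uw weaku leastu Ach st) (charac_explicit vz weakv leastv Bch st).
  by rewrite B0 init; congr (_ + _); apply: eq_Rintegral => r _; rewrite initw.
have AB : A t = B t.
  have [c [ct]] := @mvt_closed R (fun s => A s - B s) (fun s => u (A s) s - v (B s) s) 0 t (ltW t0)
    (fun s st => is_deriveB (Ach s st) (Bch s st)).
  by rewrite E// subrr mul0r B0 subrr subr0 => /eqP; rewrite subr_eq0 => /eqP.
by have := E t It; rewrite -AB At.
Qed.

End Rigidity.

(** * Weak solutions as flows on the whole plane *)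

Section Extension.
Context {R : realType}.
Local Notation mu := (@lebesgue_measure R).
Implicit Types (f : R -> R -> R) (g h : R -> R) (x t c : R).

(* Constant in time for [t <= 0], so that the extension is continuous on the whole plane. *)
Definition extend f x t := f x (Num.max 0 t).

Lemma extendE f x t : 0 <= t -> extend f x t = f x t.
Proof. by move=> t0; rewrite /extend (max_idPr t0). Qed.

Lemma extend_cont f : {within [set p : R * R | 0 <= p.2], continuous (fun p => f p.1 p.2)} ->
  continuous (fun p : R * R => extend f p.1 p.2).
Proof.
move=> fc p; pose r (q : R * R) : R * R := (q.1, Num.max 0 q.2).
have rA q : 0 <= (r q).2 by rewrite /r/= le_max lexx.
have rc : r q @[q --> p] --> r p.
  have c1 : q.1 @[q --> p] --> p.1 by exact: cvg_fst.
  have c2 : Num.max 0 q.2 @[q --> p] --> Num.max 0 p.2.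
    apply: (@cvg_comp _ _ _ snd (fun t : R => Num.max 0 t) _ (nbhs p.2)); first exact: cvg_snd.
    by apply: cont_max; [exact: cvg_cst|exact: cvg_id].
  exact: (cvg_pair c1 c2).
have := fc (r p); rewrite /continuous_at => H.
move=> V /H; rewrite /nbhs/= -/(nbhs _) => HV.
have : within [set p : R * R | 0 <= p.2] (nbhs (r p)) [set q | V (f q.1 q.2)].
  by rewrite (@nbhs_subspace_in _ [set q : R * R | 0 <= q.2] (r p) (rA p)).
move=> HW; have {}HW := rc _ HW.
by apply: (@filterS _ (nbhs p) _ _ _ _ HW) => q /= /(_ (rA q)).
Qed.

Lemma ae_tsq_eq C C' (f g f' g' : R -> R) c (D : set R) : measurable D ->
  finite_energy C f g -> finite_energy C' f' g' -> {ae mu, forall x, g x = g' x} ->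
  \int[mu]_(x in D) tsq c (g x) = \int[mu]_(x in D) tsq c (g' x).
Proof.
move=> mD fg fg' gg; congr fine; apply: ae_eq_integral => //.
- by apply/measurable_EFinP; apply: (measurable_funS measurableT) => //; exact: measurable_tsq_comp fg c.
- by apply/measurable_EFinP; apply: (measurable_funS measurableT) => //; exact: measurable_tsq_comp fg' c.
- by apply: (@filterS _ _ (ae_filter_ringOfSetsType mu) _ _ _ gg) => x h _ /=; rewrite h.
Qed.

Lemma AC_deriv_unique (f g h : R -> R) : AC_with_deriv f g -> AC_with_deriv f h -> {ae mu, forall x, g x = h x}.
Proof.
move=> [_ fg] [_ fh].
by apply: (@filterS2 _ _ (ae_filter_ringOfSetsType mu) _ _ _ _ fg fh) => x; exact: is_derive_unique.
Qed.

Lemma weak_solution_flow (u0 : R -> R) (u w : R -> R -> R) : weak_solution u0 u w ->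
  exists C, [/\ finite_energy_flow C (extend u) (extend w), source_identity (extend u) (extend w) &
    forall x, u x 0 = u0 x].
Proof.
(* [energy] carries a factor 1/2, whereas [finite_energy] bounds the full integral. *)
move=> [uc uAC [C HC] _ [weak init]]; exists (2 * C).
have m0 t : 0 <= Num.max 0 t by rewrite le_max lexx.
split => //.
- split; first exact: extend_cont.
  move=> t; have [mw E] := HC _ (m0 t); split => //; first exact: uAC.
  move: E; rewrite /energy; set I := integral _ _ _ => E.
  have : (2%:E * (2^-1%:E * I) <= 2%:E * C%:E)%E by exact: lee_wpmul2l.
  by rewrite muleA -!EFinM divff// mul1e.
- move=> phi tphi phi0; have := weak phi tphi.
  have -> : \int[mu]_x (u0 x * phi x 0) = 0.
    transitivity (\int[mu]_x (0 : R)); last by rewrite /Rintegral integral0.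
    by apply: eq_Rintegral => x _; rewrite phi0 mulr0.
  rewrite addr0 => W; rewrite -[RHS]W; apply: eq_Rintegral => t /set_mem/=; rewrite in_itv/= andbT => t0.
  apply: eq_Rintegral => x _; rewrite extendE//; congr (_ + _ * _); congr (_ * _).
  by apply: eq_Rintegral => y _; rewrite extendE.
Qed.

End Extension.

(** * Energy comparison and rigidity for the dissipative solution *)

Theorem theorem1p1 (R : realType) (u0 w0 : R -> R) (ut wt u w : R -> R -> R) :
  AC_with_deriv u0 w0 -> L2 w0 ->
  dissipative_solution u0 w0 ut wt ->
  weak_solution u0 u w ->
  (forall t : R, 0 <= t -> (energy wt t <= energy w t)%E) /\
  ((forall t : R, 0 <= t -> energy w t = energy wt t) ->
     forall x t : R, 0 <= t -> u x t = ut x t).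
Proof.
move=> uw0 [mw0 L2w0] [/weak_solution_flow [Ct [flowt weakt initt]] onesided trace].
move=> /weak_solution_flow [C [flow weak init]].
set mu := @lebesgue_measure R.
pose C0 := fine (\int[mu]_x ((w0 x ^+ 2)%:E))%E.
have fe0 : finite_energy C0 u0 w0.
  split => //; rewrite fineK// ge0_fin_numE//.
  by apply: integral_ge0 => x _; rewrite lee_fin sqr_ge0.
(* The initial slopes of the two solutions and [w0] are all derivatives of [u0], so they agree
   almost everywhere and give the same truncated energies. *)
have ae0 (v z : R -> R -> R) c : finite_energy_flow c (extend v) (extend z) -> (forall x, v x 0 = u0 x) ->
    {ae mu, forall x, extend z x 0 = w0 x}.
  move=> vz v0; apply: (@AC_deriv_unique R u0) => //.
  have [ac _ _] := vz.2 0.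
  by have <- : (extend v) ^~ 0 = u0 by apply/funext => x; rewrite extendE.
have aet := ae0 _ _ _ flowt initt; have aew := ae0 _ _ _ flow init.
have tsq0t c (D : set R) : measurable D ->
    \int[mu]_(x in D) tsq c (extend wt x 0) = \int[mu]_(x in D) tsq c (w0 x).
  by move=> mD; exact: (ae_tsq_eq c mD (flowt.2 0) fe0 aet).
have tsq0 c (D : set R) : measurable D ->
    \int[mu]_(x in D) tsq c (extend w x 0) = \int[mu]_(x in D) tsq c (w0 x).
  by move=> mD; exact: (ae_tsq_eq c mD (flow.2 0) fe0 aew).
have E2 (v : R -> R -> R) c z t : finite_energy_flow c z (extend v) -> 0 <= t ->
    energy v t = (2^-1 * \int[mu]_x extend v x t ^+ 2)%:E.
  move=> vz t0; rewrite EFinM EFin_Rintegral//; last exact: finite_energy_sqr_integrableT (vz.2 t).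
  by congr (_ * _)%E; apply: eq_integral => x _; rewrite extendE.
have upper t : 0 < t -> \int[mu]_x extend wt x t ^+ 2 <= \int[mu]_x tsq (2 / t) (w0 x).
  apply: (energy_upper flowt weakt fe0).
    move=> K cK K0; have [M HM] := onesided K cK K0; exists M => s.
    have [s0|s0] := leP 0 s.
      by apply: (@filterS _ _ (ae_filter_ringOfSetsType mu) _ _ _ (HM s)) => x; rewrite extendE.
    by apply: aeW => x /K0/= s1; move: (lt_trans s1 s0); rewrite ltxx.
  move: trace; apply: cvg_trans; apply: near_eq_cvg.
  have h : \forall s \near (0 : R)^'+, 0 < s by exact: nbhs_right_gt.
  by apply: filterS h => s s0; apply: eq_integral => x _; rewrite extendE// ltW.
split.
(* At time [0] the two energies coincide; for [t > 0] the truncated initial energy with cut [2 / t]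
   lies between them. *)
- move=> t; rewrite le_eqVlt => /predU1P[<-|t0].
    rewrite /energy le_eqVlt; apply/orP; left; apply/eqP; congr (_ * _)%E.
    have [_ mt _] := flowt.2 0; have [_ mw _] := flow.2 0.
    transitivity (\int[mu]_y (extend wt y 0 ^+ 2)%:E)%E.
      by apply: eq_integral => x _; rewrite extendE.
    transitivity (\int[mu]_y (extend w y 0 ^+ 2)%:E)%E; last first.
      by apply: eq_integral => x _; rewrite extendE.
    apply: ae_eq_integral => //; try by apply/measurable_EFinP; exact: measurable_funX.
    apply: (@filterS2 _ _ (ae_filter_ringOfSetsType mu) _ _ _ _ aet aew) => x h1 h2 _.
    by rewrite h1 h2.
  rewrite (E2 _ _ _ _ flowt (ltW t0)) (E2 _ _ _ _ flow (ltW t0)) lee_fin ler_pM2l//.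
  apply: (le_trans (upper t t0)); rewrite -(tsq0 (2 / t) _ measurableT).
  exact: (energy_lower_line flow weak t0).
- move=> HE x t; rewrite le_eqVlt => /predU1P[<-|t0]; first by rewrite init initt.
  (* Equality of the energies hands the upper bound of the dissipative solution on to [u], so that
     both solutions have the least possible energy. *)
  have same s : 0 < s -> \int[mu]_y extend w y s ^+ 2 = \int[mu]_y extend wt y s ^+ 2.
    move=> s0; have := HE s (ltW s0).
    by rewrite (E2 _ _ _ _ flowt (ltW s0)) (E2 _ _ _ _ flow (ltW s0)) => -[] /mulfI; apply.
  rewrite -(extendE u x (ltW t0)) -(extendE ut x (ltW t0)).
  apply: (flow_rigidity flow flowt weak weakt) t0.
  + by move=> s s0; rewrite same// (tsq0 (2 / s) _ measurableT); exact: upper.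
  + by move=> s s0; rewrite (tsq0t (2 / s) _ measurableT); exact: upper.
  + by move=> y; rewrite !extendE// init initt.
  + by move=> c a; rewrite tsq0 ?tsq0t//; exact: measurable_itv.
Qed.
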